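(* Let $B$ be an elliptic or doubly parabolic finite Blaschke product of degree $d\ge 2$. Let $\lambda_1,\dots,\lambda_m\in\mathbb{C}$ with $0\le|\lambda_1|<|\lambda_2|<\dots<|\lambda_m|$. Then there is $w\in\mathbb{A}$ such that the operator $T:\mathbb{A}\to\mathbb{A}$, $(Tf)(z)=w(z)f(B(z))$, $f\in\mathbb{A}$, $z\in\mathbb{D}$, satisfies $\sigma_{usf}(T)=\bigcup_{j=1}^m \lambda_j\mathbb{T}$.
   Context: $\mathbb{U}$ is the open unit disc, $\mathbb{D}$ the closed unit disc, $\mathbb{T}=\partial\mathbb{D}$; $\lambda\mathbb{T}=\{\lambda t: t\in\mathbb{T}\}$. The disc algebra $\mathbb{A}$ consists of functions analytic in $\mathbb{U}$ and continuous on $\mathbb{D}$, with the sup norm. A finite Blaschke product of degree $d$ is $B(z)=e^{i\theta}\prod_{j=1}^d \frac{z-a_j}{1-\overline{a_j}z}$, $|a_j|<1$. Its Wolff–Denjoy point $z_0\in\mathbb{D}$ is the unique point such that the iterates of $B$ converge to $z_0$ uniformly on compact subsets of $\mathbb{U}$; $B$ is elliptic if $z_0\in\mathbb{U}$, and doubly parabolic if $z_0\in\mathbb{T}$, $|B'(z_0)|=1$ and $z_0$ is a fixed point of multiplicity 2. For a bounded operator $T$ on a Banach space $X$, $\sigma_{usf}(T)$ (upper semi-Fredholm spectrum) is the set of $\lambda$ for which there exist $x_n\in X$, $\|x_n\|=1$, with $Tx_n-\lambda x_n\to0$ and $(x_n)$ having no norm-convergent subsequence. *)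

(* Defs.v *)
(* mathcomp-analysis + real_closed complex numbers.
   The complex plane is modelled as (R[i])^o for an arbitrary realType R
   (the regular-algebra alias gives R[i] its normed-module structure over
   itself, so that [derivable f z 1] is complex differentiability). *)
From mathcomp Require Import all_boot all_order all_algebra.
From mathcomp Require Import all_classical all_reals all_analysis.
From mathcomp.real_closed Require Import complex.
Export complex.
Import Order.TTheory GRing.Theory Num.Theory.
Import numFieldNormedType.Exports.

Set Implicit Arguments.
Unset Strict Implicit.
Unset Printing Implicit Defensive.

Local Open Scope ring_scope.
Local Open Scope classical_set_scope.
Local Open Scope complex_scope.

Section Defs.
Variable R : realType.
Local Notation C := (R[i])^o.

(* The disc algebra: analytic in the open unit disc U, continuous on the
   closed unit disc D.  (Values outside D are irrelevant.) *)
Definition in_disc_algebra (f : C -> C) : Prop :=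
  (forall z : C, `|z| < 1 -> derivable f z 1) /\
  {within [set z : C | `|z| <= 1], continuous f}.

(* Finite Blaschke product of degree d: c * prod_j (z - a_j)/(1 - conj(a_j) z),
   to be used with |c| = 1 and |a_j| < 1. *)
Definition blaschke (d : nat) (c : C) (a : 'I_d -> C) : C -> C :=
  fun z => c * \prod_(j < d) ((z - a j) / (1 - (a j)^* * z)).

Definition wolff_denjoy_point (B : C -> C) (z0 : C) : Prop :=
  `|z0| <= 1 /\
  forall K : set C, compact K -> K `<=` [set z : C | `|z| < 1] ->
    forall eps : C, 0 < eps ->
      exists N : nat, forall n : nat, (N <= n)%N ->
        forall z, K z -> `|iter n B z - z0| < eps.

Definition elliptic (B : C -> C) : Prop :=
  exists z0 : C, wolff_denjoy_point B z0 /\ `|z0| < 1.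

(* z0 in T, |B'(z0)| = 1 and z0 is a fixed point of multiplicity 2,
   i.e. B(z0) - z0 = 0, B'(z0) - 1 = 0, B''(z0) <> 0. *)
Definition doubly_parabolic (B : C -> C) : Prop :=
  exists z0 : C, wolff_denjoy_point B z0 /\ `|z0| = 1 /\
    derivable B z0 1 /\ `|B^`() z0| = 1 /\
    B z0 = z0 /\ B^`() z0 = 1 /\
    derivable (B^`()) z0 1 /\ B^`(2) z0 != 0.

Definition supnorm_eq1 (f : C -> C) : Prop :=
  (forall z : C, `|z| <= 1 -> `|f z| <= 1) /\
  (forall eps : C, 0 < eps -> exists z : C, `|z| <= 1 /\ 1 - eps < `|f z|).

Definition supnorm_cvg (u : nat -> C -> C) (g : C -> C) : Prop :=
  forall eps : C, 0 < eps ->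
    exists N : nat, forall n : nat, (N <= n)%N ->
      forall z : C, `|z| <= 1 -> `|u n z - g z| <= eps.

Definition usf_spectrum (T : (C -> C) -> (C -> C)) (mu : C) : Prop :=
  exists x : nat -> C -> C,
    (forall n, in_disc_algebra (x n)) /\
    (forall n, supnorm_eq1 (x n)) /\
    supnorm_cvg (fun n z => T (x n) z - mu * x n z) (fun _ => 0) /\
    ~ (exists phi : nat -> nat, (forall n, (phi n < phi n.+1)%N) /\
         exists g : C -> C, in_disc_algebra g /\
           supnorm_cvg (fun n => x (phi n)) g).

End Defs.

(* Main.v *)
(* Let w_k = w (w o B) ... (w o B^(k-1)).  If mu lies in the spectrum, then at a limit x of
   almost-maximum points of the approximate eigenvectors |w_k(x)| >= |mu|^k, and
   |w_k(y)| <= |mu|^k for every y with B^k(y) = x.  Conversely, if p is on the circle and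
   the maximum of |w_k| over the k-th preimages of p is |mu|^k for all k, then mu lies in
   the spectrum.

   Hence choose w of norm |lambda_m| in the following way: it attains that norm on one cycle
   of B in the circle, it has modulus |lambda_j| on another cycle O_j and vanishes on
   B^-1(O_j) \ O_j, and |w(z0)| = |lambda_1| at the Wolff-Denjoy point z0.  For x in some
   O_j the backward branches leaving O_j are killed, so |mu| = |lambda_j|; for x = z0, a
   fixed point, |mu| = |lambda_1|.  The backward tree of any other x comes arbitrarily
   close to the first cycle and can stay there, so |mu| = |lambda_m|.  The value at z0 is
   prescribed because z0 may have no preimage but itself; this makes the maximum principle
   unnecessary. *)
Require Import Defs.
From mathcomp Require Import all_boot all_order all_algebra.
From mathcomp Require Import all_classical all_reals all_analysis.
From mathcomp.real_closed Require Import complex.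
From mathcomp Require Import ring lra zify.
Import Order.TTheory GRing.Theory Num.Theory.
Import numFieldNormedType.Exports.
Set Implicit Arguments.
Unset Strict Implicit.
Unset Printing Implicit Defensive.
Local Open Scope ring_scope.
Local Open Scope classical_set_scope.
Local Open Scope complex_scope.
Local Notation Re := complex.Re.
Local Notation Im := complex.Im.


(** * Modulus and compactness of the closed disc *)

(** The Wolff-Denjoy point acts through one inequality. Let G be the [k]-th iterate of [B] and [p],
    on the circle, a fixed point of G other than [z0]. Then |G'(p)| > 1, and for each [l] every [x]
    in the closed disc has a preimage [y] under G^l with |G'(p)|^l |y - p|^2 |G^l(0) - x|^2 <= |x -
    p|^2. As G^l(0) tends to [z0], some backward branch of any [x] other than [z0] is drawn to [p].
    This stands in for normal families and the theory of the Julia set.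

    Reaching the first cycle helps only if [w] has no zero on the way back to [x]. So the zeros of
    [w] must be controlled too: each is mapped into some O_j or is [z0], and a path ending outside
    these sets meets none. Interpolation with such control uses quotients (f + b) / (f + c), where f
    has nonnegative real part and poles at the nodes.

    Each |lambda_j|, the extreme ones included, gets a cycle O_j, so neither the first cycle nor
    [z0] adds a circle. For m = 1 the weight is constant: at an interior [z0], |w(z0)| can equal the
    norm only for constant [w]. *)

Section Modulus.
Variable R : realType.
Local Notation C := (R[i])^o.

(** The norm of [R[i]] takes its values in [R[i]]; a modulus in [R] lives in a total order, where
    [lra] and [nra] apply. *)
Definition nm (z : C) : R := Normc.normc z.
Arguments nm : simpl never.

Lemma normCE (z : C) : `|z| = (nm z)%:C.
Proof. by []. Qed.

Lemma nm_ge0 z : 0 <= nm z.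
Proof. by case: z => a b; rewrite /nm /= sqrtr_ge0. Qed.

Lemma nm_sq z : nm z ^+ 2 = Re z ^+ 2 + Im z ^+ 2.
Proof. by case: z => a b; rewrite /nm /= sqr_sqrtr// addr_ge0// sqr_ge0. Qed.

Lemma nm0 : nm 0 = 0. Proof. exact: Normc.normc0. Qed.
Lemma nm1 : nm 1 = 1. Proof. exact: Normc.normc1. Qed.
Lemma nmM z z' : nm (z * z') = nm z * nm z'. Proof. exact: Normc.normcM. Qed.
Lemma nmV z : nm z^-1 = (nm z)^-1. Proof. exact: Normc.normcV. Qed.
Lemma nmD z z' : nm (z + z') <= nm z + nm z'. Proof. exact: le_normcD. Qed.
Lemma nmN z : nm (- z) = nm z. Proof. exact: normcN. Qed.
Lemma nmB z z' : nm (z - z') <= nm z + nm z'.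
Proof. by rewrite (le_trans (nmD _ _))// nmN. Qed.
Lemma nm_distC z z' : nm (z - z') = nm (z' - z).
Proof. by rewrite -nmN opprB. Qed.

Lemma nm_eq0 z : (nm z == 0) = (z == 0).
Proof.
by apply/eqP/eqP => [/Normc.eq0_normc//|->]; rewrite nm0.
Qed.

Lemma nm_gt0 z : (0 < nm z) = (z != 0).
Proof. by rewrite lt_neqAle nm_ge0 andbT eq_sym nm_eq0. Qed.

Lemma nmJ z : nm z^* = nm z.
Proof. by case: z => a b; rewrite /nm /= sqrrN. Qed.

Lemma nm_real (x : R) : nm x%:C = `|x|.
Proof. by rewrite /nm /= expr0n addr0 sqrtr_sqr. Qed.

Lemma nmX z n : nm (z ^+ n) = nm z ^+ n.
Proof. by elim: n => [|n IH]; rewrite ?expr0 ?nm1// !exprS nmM IH. Qed.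

Lemma nm_prod (I : Type) (r : seq I) (P : pred I) (F : I -> C) :
  nm (\prod_(i <- r | P i) F i) = \prod_(i <- r | P i) nm (F i).
Proof. exact: (big_morph nm nmM nm1). Qed.

Lemma nm_sum (I : Type) (r : seq I) (P : pred I) (F : I -> C) :
  nm (\sum_(i <- r | P i) F i) <= \sum_(i <- r | P i) nm (F i).
Proof.
elim/big_rec2: _ => [|i x y _ h]; first by rewrite nm0.
by rewrite (le_trans (nmD _ _))// lerD2l.
Qed.

Lemma nm_dist z z' : `|nm z - nm z'| <= nm (z - z').
Proof.
have h1 : nm z <= nm (z - z') + nm z' by rewrite -[X in nm X <= _](subrK z') nmD.
have h2 : nm z' <= nm (z' - z) + nm z by rewrite -[X in nm X <= _](subrK z) nmD.
by rewrite ler_norml; rewrite nm_distC in h2; apply/andP; split; lra.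
Qed.

Lemma nm_triangle y x z : nm (x - z) <= nm (x - y) + nm (y - z).
Proof. by rewrite (_ : x - z = (x - y) + (y - z)) ?nmD//; ring. Qed.

Lemma normC_lt (z : C) (r : R) : (`|z| < r%:C) = (nm z < r).
Proof. by rewrite normCE ltcR. Qed.
Lemma normC_le (z : C) (r : R) : (`|z| <= r%:C) = (nm z <= r).
Proof. by rewrite normCE lecR. Qed.
Lemma normC_lt1 (z : C) : (`|z| < 1) = (nm z < 1).
Proof. exact: normC_lt. Qed.
Lemma normC_le1 (z : C) : (`|z| <= 1) = (nm z <= 1).
Proof. exact: normC_le. Qed.
Lemma normC_eq (z z' : C) : (`|z| = `|z'|) <-> (nm z = nm z').
Proof. by rewrite !normCE; split => [[]//|->]. Qed.

Lemma posC_real (e : C) : 0 < e -> exists2 r : R, 0 < r & e = r%:C.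
Proof.
by case: e => a b; rewrite ltcE /= => /andP[/eqP-> h]; exists a.
Qed.

(** Divided by the first square, this is the formula for 1 - |mob y z|^2, the source of the
    Schwarz-Pick estimates and of the Poisson kernel below. *)
Lemma nm_mobius z y :
  nm (1 - y^* * z) ^+ 2 - nm (z - y) ^+ 2 = (1 - nm z ^+ 2) * (1 - nm y ^+ 2).
Proof. by case: z => a b; case: y => e f; rewrite !nm_sq /=; ring. Qed.

Lemma nm_le1_sq z : (nm z <= 1) = (nm z ^+ 2 <= 1).
Proof. by rewrite expr_le1// nm_ge0. Qed.
Lemma nm_lt1_sq z : (nm z < 1) = (nm z ^+ 2 < 1).
Proof. by rewrite expr_lt1// nm_ge0. Qed.

Lemma mobius_den_neq0 z y : nm z <= 1 -> nm y < 1 -> 1 - y^* * z != 0.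
Proof.
move=> hz hy; rewrite subr_eq0; apply/eqP => h.
have : nm (y^* * z) = 1 by rewrite -h nm1.
rewrite nmM nmJ => /eqP; rewrite lt_eqF//.
by rewrite (le_lt_trans (ler_piMr (nm_ge0 _) hz)).
Qed.

Lemma nm_Re z : `|Re z| <= nm z.
Proof.
have := nm_sq z; have := nm_ge0 z; set n := nm z; set a := Re z; set b := Im z.
by move=> n0 h; rewrite -ler_sqr ?nnegrE// real_normK ?num_real// h lerDl sqr_ge0.
Qed.

Lemma nm_Im z : `|Im z| <= nm z.
Proof.
have := nm_sq z; have := nm_ge0 z; set n := nm z; set a := Re z; set b := Im z.
by move=> n0 h; rewrite -ler_sqr ?nnegrE// real_normK ?num_real// h lerDr sqr_ge0.
Qed.

Lemma nm_ReIm z : nm z <= `|Re z| + `|Im z|.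
Proof.
rewrite -ler_sqr ?nnegrE ?nm_ge0 ?addr_ge0// nm_sq sqrrD !real_normK ?num_real//.
by rewrite addrAC lerDl mulrn_wge0// mulr_ge0.
Qed.

Definition Dset : set C := [set z : C | `|z| <= 1].

Lemma DsetE z : Dset z = is_true (nm z <= 1).
Proof. by rewrite /Dset /= normC_le1. Qed.

Lemma nbhs_nmP (z : C) (A : set C) :
  nbhs z A <-> exists2 e : R, 0 < e & forall z', nm (z' - z) < e -> A z'.
Proof.
split.
  move=> /(@nbhs_normP _ C)[e /= /posC_real[r r0 ->] h]; exists r => // z' hz'.
  by apply: h; rewrite /ball_ /= normC_lt nm_distC.
move=> [e e0 h]; apply/(@nbhs_normP _ C); exists e%:C; first by rewrite /= ltcR.
by move=> z' /=; rewrite normC_lt nm_distC => /h.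
Qed.

Lemma contD_CP (f : C -> C) :
  {within Dset, continuous f} <->
  forall z, nm z <= 1 -> forall e : R, 0 < e ->
    exists2 d : R, 0 < d & forall z', nm z' <= 1 -> nm (z' - z) < d ->
      nm (f z' - f z) < e.
Proof.
split.
  move=> /subspace_continuousP h z hz e e0.
  have /h : Dset z by rewrite DsetE.
  move=> /(_ [set u | nm (u - f z) < e]).
  case; first by apply/nbhs_nmP; exists e.
  move=> /= r /posC_real[d d0 ->] hd; exists d => // z' hz' hzz'.
  by apply: hd; rewrite ?DsetE//= normC_lt nm_distC.
move=> h; apply/subspace_continuousP => z; rewrite DsetE => hz A /nbhs_nmP[e e0 hA].
have [d d0 hd] := h _ hz _ e0.
apply/nbhs_nmP; exists d => // z' hz' hz'1.
by apply/hA/hd => //; move: hz'1; rewrite DsetE.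
Qed.

Lemma contD_RP (f : C -> R) :
  {within Dset, continuous f} <->
  forall z, nm z <= 1 -> forall e : R, 0 < e ->
    exists2 d : R, 0 < d & forall z', nm z' <= 1 -> nm (z' - z) < d ->
      `|f z' - f z| < e.
Proof.
split.
  move=> /subspace_continuousP h z hz e e0.
  have /h : Dset z by rewrite DsetE.
  move=> /(_ [set u | `|u - f z| < e]).
  case; first by apply/nbhs_normP; exists e => //= u /=; rewrite distrC.
  move=> /= r /posC_real[d d0 ->] hd; exists d => // z' hz' hzz'.
  by apply: hd; rewrite ?DsetE//= normC_lt nm_distC.
move=> h; apply/subspace_continuousP => z; rewrite DsetE => hz A /nbhs_normP[e /= e0 hA].
have [d d0 hd] := h _ hz _ e0.
apply/nbhs_nmP; exists d => // z' hz' hz'1.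
by apply/hA; rewrite /= distrC; apply/hd => //; move: hz'1; rewrite DsetE.
Qed.

Lemma contD_nm (f : C -> C) :
  {within Dset, continuous f} -> {within Dset, continuous (fun z => nm (f z))}.
Proof.
move=> /contD_CP h; apply/contD_RP => z hz e e0; have [d d0 hd] := h z hz e e0.
by exists d => // z' hz' hzz'; rewrite (le_lt_trans (nm_dist _ _))// hd.
Qed.

Lemma contD_cst (V : topologicalType) (c : V) : {within Dset, continuous (fun=> c)}.
Proof. by move=> z; apply: cvg_cst. Qed.

Lemma contD_id : {within Dset, continuous (fun z : C => z)}.
Proof. by apply/contD_CP => z hz e e0; exists e. Qed.

Lemma contD_add (f g : C -> C) : {within Dset, continuous f} ->
  {within Dset, continuous g} -> {within Dset, continuous (fun z => f z + g z)}.
Proof. by move=> hf hg z; apply: cvgD; [exact: hf|exact: hg]. Qed.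

Lemma contD_mul (f g : C -> C) : {within Dset, continuous f} ->
  {within Dset, continuous g} -> {within Dset, continuous (fun z => f z * g z)}.
Proof. by move=> hf hg z; apply: (@cvgM R[i]); [exact: hf|exact: hg]. Qed.

Lemma contD_inv (f : C -> C) : (forall z, nm z <= 1 -> f z != 0) ->
  {within Dset, continuous f} -> {within Dset, continuous (fun z => (f z)^-1)}.
Proof.
move=> f0 /subspace_continuousP hf; apply/subspace_continuousP => z hz.
by apply: (@cvgV R[i]); [apply: f0; rewrite -DsetE|exact: hf].
Qed.

Lemma contD_addR (f g : C -> R) : {within Dset, continuous f} ->
  {within Dset, continuous g} -> {within Dset, continuous (fun z => f z + g z)}.
Proof. by move=> hf hg z; apply: cvgD; [exact: hf|exact: hg]. Qed.

Lemma contD_mulR (f g : C -> R) : {within Dset, continuous f} ->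
  {within Dset, continuous g} -> {within Dset, continuous (fun z => f z * g z)}.
Proof. by move=> hf hg z; apply: cvgM; [exact: hf|exact: hg]. Qed.

Lemma contD_invR (f : C -> R) : (forall z, nm z <= 1 -> f z != 0) ->
  {within Dset, continuous f} -> {within Dset, continuous (fun z => (f z)^-1)}.
Proof.
move=> f0 /subspace_continuousP hf; apply/subspace_continuousP => z hz.
by apply: cvgV; [apply: f0; rewrite -DsetE|exact: hf].
Qed.

Lemma contD_sumR (I : eqType) (r : seq I) (f : I -> C -> R) :
  (forall i, i \in r -> {within Dset, continuous (f i)}) ->
  {within Dset, continuous (fun z => \sum_(i <- r) f i z)}.
Proof.
elim: r => [|i r IH] hf.
  rewrite (_ : (fun z => _) = fun=> 0); first exact: contD_cst.
  by apply/funext => z; rewrite big_nil.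
rewrite (_ : (fun z => _) = (fun z => f i z + \sum_(j <- r) f j z)).
  apply: contD_addR; first by apply: hf; rewrite mem_head.
  by apply: IH => j jr; apply: hf; rewrite in_cons jr orbT.
by apply/funext => z; rewrite big_cons.
Qed.

Lemma contD_comp (V : topologicalType) (f : C -> C) (g : C -> V) :
  (forall z, nm z <= 1 -> nm (f z) <= 1) ->
  {within Dset, continuous f} -> {within Dset, continuous g} ->
  {within Dset, continuous (fun z => g (f z))}.
Proof.
move=> fD /contD_CP hf /subspace_continuousP hg.
apply/subspace_continuousP => z zD A hA.
have hz : nm z <= 1 by move: zD; rewrite DsetE.
have /hg/(_ _ hA)/nbhs_nmP[e e0 he] : Dset (f z) by rewrite DsetE fD.
have [d d0 hd] := hf _ hz _ e0.
apply/nbhs_nmP; exists d => // z' hz'; rewrite DsetE => z'D.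
by apply: he; [exact: hd|rewrite DsetE fD].
Qed.

Lemma contD_iter (f : C -> C) n : (forall z, nm z <= 1 -> nm (f z) <= 1) ->
  {within Dset, continuous f} -> {within Dset, continuous (iter n f)}.
Proof.
move=> fD cf; elim: n => [|n IH]; first exact: contD_id.
apply: contD_comp cf => //; elim: (n) => [|k IHk] z hz //=; exact/fD/IHk.
Qed.

Lemma iter_disc (f : C -> C) n z : (forall z, nm z <= 1 -> nm (f z) <= 1) ->
  nm z <= 1 -> nm (iter n f z) <= 1.
Proof. by move=> h hz; elim: n => [|n IH] //=; exact: h. Qed.

Lemma disc_compact : compact Dset.
Proof.
have cf : continuous (fun u : R * R => (u.1 +i* u.2 : C)).
  move=> u A /nbhs_nmP[e e0 hA].
  have e2 : 0 < e / 2 by lra.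
  exists ([set x | `|u.1 - x| < e / 2], [set x | `|u.2 - x| < e / 2]).
    by split; apply/nbhs_normP; exists (e / 2).
  move=> [x y] /= [h1 h2]; apply: hA; apply: le_lt_trans (nm_ReIm _) _ => /=.
  by rewrite [`|x - _|]distrC [`|y - _|]distrC; lra.
have hc : compact ((fun u : R * R => (u.1 +i* u.2 : C)) @` (`[-1, 1] `*` `[-1, 1])).
  apply: continuous_compact; first exact: continuous_subspaceT.
  by apply: compact_setX; exact: segment_compact.
apply: subclosed_compact hc _.
  move=> z h; rewrite DsetE leNgt; apply/negP => hz.
  have [|z' []] := h [set z' | nm (z' - z) < nm z - 1].
    by apply/nbhs_nmP; exists (nm z - 1) => //; rewrite subr_gt0.
  rewrite DsetE /= => h1 h2; have := nm_dist z' z; rewrite ler_norml => /andP[].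
  by move=> *; lra.
move=> [a b]; rewrite DsetE => h; exists (a, b) => //=.
have := nm_Re (a +i* b); have := nm_Im (a +i* b); rewrite /= !ler_norml.
by move=> /andP[? ?] /andP[? ?]; split; rewrite /= in_itv /=; apply/andP; split; lra.
Qed.

Lemma disc_cluster (x : nat -> C) : (forall n, nm (x n) <= 1) ->
  exists2 z, nm z <= 1 & forall (e : R) N, 0 < e ->
    exists2 n, (N <= n)%N & nm (x n - z) < e.
Proof.
move=> xD; have [|z] := disc_compact (F := x n @[n --> \oo]).
  by exists 0%N => // n _; change (Dset (x n)); rewrite DsetE.
move=> [+ zc]; rewrite DsetE => zD; exists z => // e N e0.
have [||y [[n /= hn <-] hy]] :=
    zc (x @` [set n | (N <= n)%N]) [set y | nm (y - z) < e].
- by exists N => // n /= hn; exists n.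
- by apply/nbhs_nmP; exists e.
by exists n.
Qed.

(** Cluster points stand in for convergent subsequences: by continuity, a strict failure at [z]
    would persist at some late [x n]. *)
Lemma cluster_le (x : nat -> C) z (f g : C -> R) N :
  (forall n, nm (x n) <= 1) -> nm z <= 1 ->
  (forall (e : R) N, 0 < e -> exists2 n, (N <= n)%N & nm (x n - z) < e) ->
  {within Dset, continuous f} -> {within Dset, continuous g} ->
  (forall n, (N <= n)%N -> f (x n) <= g (x n)) -> f z <= g z.
Proof.
move=> xD zD zc /contD_RP cf /contD_RP cg hfg; rewrite leNgt; apply/negP => h.
have e0 : 0 < (f z - g z) / 2 by lra.
have [d1 d10 h1] := cf z zD _ e0; have [d2 d20 h2] := cg z zD _ e0.
have [|n hn hx] := zc (Num.min d1 d2) N; first by rewrite lt_min d10.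
have := h1 _ (xD n); have := h2 _ (xD n); rewrite lt_min in hx.
case/andP: hx => -> -> /(_ isT); rewrite ltr_norml => /andP[a1 a2] /(_ isT).
by rewrite ltr_norml => /andP[a3 a4]; have := hfg _ hn; lra.
Qed.

Lemma disc_radial z : nm z <= 1 -> exists x : nat -> C,
  (forall n, nm (x n) < 1) /\
  forall e : R, 0 < e -> exists N, forall n, (N <= n)%N -> nm (x n - z) < e.
Proof.
move=> zD; exists (fun n => (1 - n.+1%:R^-1)%:C * z); split.
  move=> n; have n0 : 0 < (n.+1%:R^-1 : R) by rewrite invr_gt0.
  have n1 : (n.+1%:R^-1 : R) <= 1 by rewrite invf_le1// ler1n.
  rewrite nmM nm_real ger0_norm ?subr_ge0//.
  by rewrite (le_lt_trans (ler_piMr _ zD)) ?subr_ge0// ltrBlDr ltrDl.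
move=> e e0; exists (Num.trunc e^-1) => n hn.
rewrite (_ : _ - z = - (n.+1%:R^-1)%:C * z); last first.
  by rewrite rmorphB rmorph1; ring.
rewrite nmM nmN nm_real ger0_norm ?invr_ge0// (le_lt_trans (ler_piMr _ zD))//.
by rewrite invf_plt ?posrE// -truncn_le_nat.
Qed.

Lemma disc_interior_le (f g : C -> R) z :
  {within Dset, continuous f} -> {within Dset, continuous g} ->
  (forall z, nm z < 1 -> f z <= g z) -> nm z <= 1 -> f z <= g z.
Proof.
move=> cf cg hfg zD; have [x [xU xz]] := disc_radial zD.
apply: (@cluster_le x z f g 0%N) => //.
- by move=> n; exact/ltW.
- move=> e N e0; have [N' hN'] := xz _ e0.
  by exists (maxn N N'); [exact: leq_maxl|apply/hN'/leq_maxr].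
- by move=> n _; exact: hfg.
Qed.

Lemma disc_max (f : C -> R) : {within Dset, continuous f} ->
  exists2 z, nm z <= 1 & forall z', nm z' <= 1 -> f z' <= f z.
Proof.
move=> cf; have D0 : Dset !=set0 by exists 0; rewrite DsetE nm0.
have [z] := compact_EVT_max D0 disc_compact cf.
rewrite inE DsetE => zD hz; exists z => // z' z'D.
by apply: hz; rewrite inE DsetE.
Qed.

(** One-sided Dini theorem. If it failed, points [x M] with [c <= F M (x M)] would cluster at some
    [z]; by monotonicity [c <= F M (x n)] for [n >= M], hence [c <= F M z] for every [M]. *)
Lemma disc_dini (F : nat -> C -> R) (c : R) :
  (forall M, {within Dset, continuous (F M)}) ->
  (forall M z, nm z <= 1 -> F M.+1 z <= F M z) ->
  (forall z, nm z <= 1 -> exists M, F M z < c) ->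
  exists M0, forall M z, (M0 <= M)%N -> nm z <= 1 -> F M z < c.
Proof.
move=> cF dF hF; apply: contrapT => hn.
have dec M M' z : (M <= M')%N -> nm z <= 1 -> F M' z <= F M z.
  move=> /subnK <- zD; elim: (M' - M)%N => [|k IH] //.
  by rewrite addSn (le_trans (dF _ _ zD)).
have : forall M, exists z, nm z <= 1 /\ c <= F M z.
  move=> M; apply: contrapT => h; apply: hn; exists M => M' z hM zD.
  rewrite (le_lt_trans (dec _ _ _ hM zD))// ltNge; apply/negP => h'.
  by apply: h; exists z.
move=> /choice[x hx].
have [z zD zc] := disc_cluster (fun n => (hx n).1).
have [M hM] := hF _ zD.
have : c <= F M z.
  apply: (@cluster_le x z (fun=> c) (F M) M) => //.
  - by move=> n; exact: (hx n).1.
  - exact: contD_cst.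
  - by move=> n hn'; rewrite (le_trans (hx n).2)// dec// (hx n).1.
by rewrite leNgt hM.
Qed.

End Modulus.

Arguments nm [R] z : simpl never.


(** * The disc algebra and Blaschke products *)

Section DiscAlgebra.
Variable R : realType.
Local Notation C := (R[i])^o.

Lemma disc_algebra_cst (c : C) : in_disc_algebra (fun=> c).
Proof. by split => [z _|]; [exact: derivable_cst|exact: contD_cst]. Qed.

Lemma disc_algebra_id : in_disc_algebra (fun z : C => z).
Proof. by split => [z _|]; [exact: derivable_id|exact: contD_id]. Qed.

Lemma disc_algebra_add (f g : C -> C) : in_disc_algebra f -> in_disc_algebra g ->
  in_disc_algebra (fun z => f z + g z).
Proof.
move=> [df cf] [dg cg]; split => [z hz|]; last exact: (contD_add cf cg).
by apply: derivableD; [exact: df|exact: dg].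
Qed.

Lemma disc_algebra_mul (f g : C -> C) : in_disc_algebra f -> in_disc_algebra g ->
  in_disc_algebra (fun z => f z * g z).
Proof.
move=> [df cf] [dg cg]; split => [z hz|]; last exact: (contD_mul cf cg).
by apply: (@derivableM _ C); [exact: df|exact: dg].
Qed.

Lemma disc_algebra_inv (f : C -> C) : (forall z, nm z <= 1 -> f z != 0) ->
  in_disc_algebra f -> in_disc_algebra (fun z => (f z)^-1).
Proof.
move=> f0 [df cf]; split => [z hz|]; last exact: (contD_inv f0 cf).
apply: (@derivableV _ C); last exact: df.
by apply/f0/ltW; rewrite -normC_lt1.
Qed.

Lemma disc_algebra_comp (f g : C -> C) :
  (forall z, nm z <= 1 -> nm (f z) <= 1) -> (forall z, nm z < 1 -> nm (f z) < 1) ->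
  in_disc_algebra f -> in_disc_algebra g -> in_disc_algebra (fun z => g (f z)).
Proof.
move=> fD fU [df cf] [dg cg]; split => [z hz|]; last exact: (contD_comp fD cf cg).
apply/(@derivable1_diffP R[i] C (fun z => g (f z)) z).
apply: (@differentiable_comp R[i] C C C f g).
  by apply/(@derivable1_diffP R[i] C f z); exact: df.
apply/(@derivable1_diffP R[i] C g (f z)); apply: dg.
by rewrite normC_lt1 fU// -normC_lt1.
Qed.

Lemma disc_algebra_iter (f : C -> C) n :
  (forall z, nm z <= 1 -> nm (f z) <= 1) -> (forall z, nm z < 1 -> nm (f z) < 1) ->
  in_disc_algebra f -> in_disc_algebra (iter n f).
Proof.
move=> fD fU hf; elim: n => [|n IH]; first exact: disc_algebra_id.
apply: disc_algebra_comp hf => //; first by move=> z; exact: iter_disc.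
by elim: (n) => [|k IHk] z hz //=; exact/fU/IHk.
Qed.

Lemma disc_algebra_sum (I : Type) (r : seq I) (f : I -> C -> C) :
  (forall i, in_disc_algebra (f i)) ->
  in_disc_algebra (fun z => \sum_(i <- r) f i z).
Proof.
move=> hf; elim: r => [|i r IH].
  rewrite (_ : (fun z => _) = fun=> 0); first exact: disc_algebra_cst.
  by apply/funext => z; rewrite big_nil.
rewrite (_ : (fun z => _) = (fun z => f i z + \sum_(j <- r) f j z)).
  exact: (disc_algebra_add (hf i) IH).
by apply/funext => z; rewrite big_cons.
Qed.

Lemma disc_algebra_prod (I : eqType) (r : seq I) (f : I -> C -> C) :
  (forall i, i \in r -> in_disc_algebra (f i)) ->
  in_disc_algebra (fun z => \prod_(i <- r) f i z).
Proof.
elim: r => [|i r IH] hf.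
  rewrite (_ : (fun z => _) = fun=> 1); first exact: disc_algebra_cst.
  by apply/funext => z; rewrite big_nil.
rewrite (_ : (fun z => _) = (fun z => f i z * \prod_(j <- r) f j z)).
  apply: disc_algebra_mul; first by apply: hf; rewrite mem_head.
  by apply: IH => j jr; apply: hf; rewrite in_cons jr orbT.
by apply/funext => z; rewrite big_cons.
Qed.

End DiscAlgebra.

Section Mobius.
Variable R : realType.
Local Notation C := (R[i])^o.
Implicit Types a z : C.

Definition mob a z : C := (z - a) / (1 - a^* * z).

Lemma nm_mob_le1 a z : nm a < 1 -> nm z <= 1 -> nm (mob a z) <= 1.
Proof.
move=> ha hz; rewrite /mob nmM nmV ler_pdivrMr ?nm_gt0 ?mobius_den_neq0// mul1r.
rewrite -ler_sqr ?nnegrE ?nm_ge0// -subr_ge0 nm_mobius mulr_ge0// subr_ge0.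
  by rewrite -nm_le1_sq.
by rewrite -nm_le1_sq ltW.
Qed.

Lemma nm_mob_lt1 a z : nm a < 1 -> nm z < 1 -> nm (mob a z) < 1.
Proof.
move=> ha hz; rewrite /mob nmM nmV ltr_pdivrMr ?nm_gt0 ?mobius_den_neq0 1?ltW// mul1r.
rewrite -ltr_sqr ?nnegrE ?nm_ge0// -subr_gt0 nm_mobius mulr_gt0// subr_gt0.
  by rewrite -nm_lt1_sq.
by rewrite -nm_lt1_sq.
Qed.

Lemma nm_mob_eq1 a z : nm a < 1 -> nm z = 1 -> nm (mob a z) = 1.
Proof.
move=> ha hz; apply/eqP; rewrite /mob nmM nmV eq_le; apply/andP; split.
  by rewrite -nmV -nmM nm_mob_le1// hz.
rewrite ler_pdivlMr ?nm_gt0 ?mobius_den_neq0 ?hz// mul1r.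
rewrite -ler_sqr ?nnegrE ?nm_ge0// -subr_ge0 -opprB nm_mobius hz.
by rewrite expr1n subrr mul0r oppr0.
Qed.

Lemma one_sub_nm_mob_sq a z : nm a < 1 -> nm z <= 1 ->
  1 - nm (mob a z) ^+ 2 =
  (1 - nm z ^+ 2) * ((1 - nm a ^+ 2) / nm (1 - a^* * z) ^+ 2).
Proof.
move=> ha hz; have d0 : nm (1 - a^* * z) != 0 by rewrite nm_eq0 mobius_den_neq0.
rewrite mulrA -nm_mobius /mob nmM nmV expr_div_n mulrBl divff//.
by rewrite sqrf_eq0.
Qed.

Lemma disc_algebra_mob a : nm a < 1 -> in_disc_algebra (mob a).
Proof.
move=> ha; apply: disc_algebra_mul.
  by apply: disc_algebra_add; [exact: disc_algebra_id|exact: disc_algebra_cst].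
apply: disc_algebra_inv => [z hz|]; first exact: mobius_den_neq0.
under eq_fun do rewrite -mulNr; apply: disc_algebra_add; first exact: disc_algebra_cst.
by apply: disc_algebra_mul; [exact: disc_algebra_cst|exact: disc_algebra_id].
Qed.

End Mobius.

Section BlaschkeDisc.
Variables (R : realType) (d : nat) (c : (R[i])^o) (a : 'I_d -> (R[i])^o).
Local Notation C := (R[i])^o.
Hypothesis d0 : (0 < d)%N.
Hypothesis c1 : nm c = 1.
Hypothesis a1 : forall j, nm (a j) < 1.
Local Notation B := (blaschke c a).

Lemma blaschkeE z : B z = c * \prod_(j < d) mob (a j) z.
Proof. by []. Qed.

Lemma nm_blaschke z : nm (B z) = \prod_(j < d) nm (mob (a j) z).
Proof. by rewrite blaschkeE nmM c1 mul1r nm_prod. Qed.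

Lemma blaschke_disc z : nm z <= 1 -> nm (B z) <= 1.
Proof.
by move=> hz; rewrite nm_blaschke prodr_ile1// => j _; rewrite nm_ge0 nm_mob_le1.
Qed.

Lemma blaschke_open_disc z : nm z < 1 -> nm (B z) < 1.
Proof.
move=> hz; rewrite nm_blaschke.
rewrite (bigD1 (Ordinal d0))//= (le_lt_trans _ (nm_mob_lt1 (a1 (Ordinal d0)) hz))//.
rewrite ler_piMr ?nm_ge0// prodr_ile1// => j _.
by rewrite nm_ge0 nm_mob_le1// ltW.
Qed.

Lemma blaschke_circle z : nm z = 1 -> nm (B z) = 1.
Proof. by move=> hz; rewrite nm_blaschke big1// => j _; rewrite nm_mob_eq1. Qed.

Lemma disc_algebra_blaschke : in_disc_algebra B.
Proof.
apply: disc_algebra_mul; first exact: disc_algebra_cst.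
by apply: disc_algebra_prod => j _; exact: disc_algebra_mob.
Qed.

Lemma contD_blaschke : {within @Dset R, continuous B}.
Proof. exact: disc_algebra_blaschke.2. Qed.

(* At a point p of the circle, K p is the modulus of the derivative of B. *)
Lemma blaschke_kernel : exists K : C -> R,
  [/\ {within @Dset R, continuous K}, forall z, nm z <= 1 -> 0 <= K z &
   forall z, nm z <= 1 -> 1 - nm (B z) ^+ 2 = (1 - nm z ^+ 2) * K z].
Proof.
have H (s : seq 'I_d) : exists K : C -> R,
  [/\ {within @Dset R, continuous K}, forall z, nm z <= 1 -> 0 <= K z &
   forall z, nm z <= 1 -> 1 - (\prod_(j <- s) nm (mob (a j) z)) ^+ 2 = (1 - nm z ^+ 2) * K z].
  elim: s => [|j s [K [cK K0 KE]]].
    exists (fun=> 0); split=> // [|z hz]; first exact: contD_cst.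
    by rewrite big_nil expr1n subrr mulr0.
  have dj z : nm z <= 1 -> nm (1 - (a j)^* * z) != 0.
    by move=> hz; rewrite nm_eq0 mobius_den_neq0.
  (* Splits [1 - u v] as [(1 - v) + v (1 - u)], with [u] the squared modulus of the new factor and
     [v] that of the product of the others. *)
  exists (fun z => K z + (1 - nm (a j) ^+ 2) / (nm (1 - (a j)^* * z) ^+ 2) *
            (\prod_(j <- s) nm (mob (a j) z)) ^+ 2); split.
  - have cm : {within @Dset R, continuous (fun z => \prod_(j <- s) nm (mob (a j) z))}.
      under eq_fun do rewrite -nm_prod; apply: contD_nm.
      by apply: (disc_algebra_prod _).2 => i _; exact: disc_algebra_mob.
    apply: contD_addR => //; apply: contD_mulR; last exact: contD_mulR.
    apply: contD_mulR; first exact: contD_cst.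
    have cn : {within @Dset R, continuous (fun z : C => nm (1 - (a j)^* * z))}.
      apply: contD_nm; under eq_fun do rewrite -mulNr.
      apply: contD_add; first exact: contD_cst.
      by apply: contD_mul; [exact: contD_cst|exact: contD_id].
    by apply: contD_invR; [move=> z hz; rewrite sqrf_eq0 dj|exact: contD_mulR].
  - move=> z hz; rewrite addr_ge0 ?K0// mulr_ge0 ?sqr_ge0// divr_ge0 ?sqr_ge0//.
    by rewrite subr_ge0 -nm_le1_sq ltW.
  - move=> z hz; rewrite big_cons exprMn mulrDr -KE// mulrA -one_sub_nm_mob_sq//.
    by ring.
have [K [cK K0 KE]] := H (index_enum 'I_d).
by exists K; split => // z hz; rewrite nm_blaschke KE.
Qed.

End BlaschkeDisc.


(** * Fibres of a Blaschke product *)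

(** The linear coefficients may vanish, as in [1 - conj (a j) 'X] for [a j = 0]; so the coefficient
    of degree [size s] is computed instead of the leading one. *)
Lemma coef_prod_top (K : comNzRingType) (I : Type) (s : seq I) (p : I -> {poly K}) :
  (forall i, (size (p i) <= 2)%N) ->
  (size (\prod_(i <- s) p i)%R <= (size s).+1)%N /\
  (\prod_(i <- s) p i)`_(size s) = \prod_(i <- s) (p i)`_1.
Proof.
move=> hp; elim: s => [|i s [IH1 IH2]].
  by rewrite !big_nil size_poly1 coef1.
rewrite !big_cons /=; split.
  apply: leq_trans (size_polyMleq _ _) _; move: (hp i) IH1; move: (size _) (size _).
  by move=> m n; lia.
rewrite coefM !big_ord_recl /= /bump /= !subSS !subn0 IH2.
rewrite (nth_default 0 (n := (size s).+1)) ?IH1// mulr0 add0r [X in _ + X]big1 ?addr0// => j _.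
by rewrite (nth_default 0 (n := (1 + (1 + j))%N)) ?mul0r// (leq_trans (hp i)).
Qed.

Section Conjugate.
Variable R : realType.
Local Notation C := (R[i])^o.
Local Notation cj := (@Num.conj R[i]).

Lemma cjM (u v : C) : cj (u * v) = cj u * cj v.
Proof. exact: rmorphM. Qed.
Lemma cjB (u v : C) : cj (u - v) = cj u - cj v.
Proof. exact: rmorphB. Qed.
Lemma cjV (u : C) : cj u^-1 = (cj u)^-1.
Proof. exact: fmorphV. Qed.
Lemma cj1 : cj 1 = 1. Proof. exact: rmorph1. Qed.
Lemma cjK (u : C) : cj (cj u) = u. Proof. exact: conjCK. Qed.
Lemma cj_prod (I : Type) (r : seq I) (F : I -> C) :
  cj (\prod_(i <- r) F i) = \prod_(i <- r) cj (F i).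
Proof. exact: rmorph_prod. Qed.

End Conjugate.

Section Fiber.
Variables (R : realType) (d : nat) (c : (R[i])^o) (a : 'I_d -> (R[i])^o).
Local Notation C := (R[i])^o.
Hypothesis d0 : (0 < d)%N.
Hypothesis c1 : nm c = 1.
Hypothesis a1 : forall j, nm (a j) < 1.
Local Notation B := (blaschke c a).

Let N (z : C) : C := \prod_(j < d) (z - a j).
Let Q (z : C) : C := \prod_(j < d) (1 - (a j)^* * z).

Let Q_neq0 z : nm z <= 1 -> Q z != 0.
Proof. by move=> hz; apply/prodf_neq0 => j _; exact: mobius_den_neq0. Qed.

Let BQ z : nm z <= 1 -> B z * Q z = c * N z.
Proof.
move=> hz; rewrite /blaschke -mulrA -big_split/=; congr (_ * _).
by apply: eq_bigr => j _; rewrite mulfVK ?mobius_den_neq0.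
Qed.

Let cJ : c * c^* = 1.
Proof.
have := sqr_normc (c : R[i]); rewrite -[`|_|]/((nm c)%:C) c1 => <-.
by rewrite -rmorphXn expr1n.
Qed.

(** With B = c N / Q this is c N - x Q: for |x| <= 1 its roots are the fibre over [x], with
    multiplicity. *)
Definition fiber_poly (x : R[i]) : {poly R[i]} :=
  (c : R[i])%:P * \prod_(j < d) ('X - (a j : R[i])%:P) -
  x%:P * \prod_(j < d) (1 - ((a j : R[i])^*)%:P * 'X).

Let fiber_polyE x z : (fiber_poly x).[z] = c * N z - x * Q z.
Proof.
rewrite /fiber_poly hornerD hornerN !hornerM !hornerC !horner_prod.
congr (_ * _ - _ * _); apply: eq_bigr => j _; rewrite !hornerE//.
Qed.

Let sfactor (u v : R[i]) : (size (u%:P + v%:P * 'X)%R <= 2)%N.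
Proof.
rewrite (leq_trans (size_polyD _ _))// geq_max (leq_trans (size_polyC_leq1 _))//.
rewrite (leq_trans (size_polyMleq _ _))// size_polyX.
by have := size_polyC_leq1 v; move: (size _) => n; lia.
Qed.

Let lc (x : R[i]) : R[i] := c - x * \prod_(j < d) (- (a j : R[i])^*).

Let fiber_poly_lc x : (size (fiber_poly x) <= d.+1)%N /\ (fiber_poly x)`_d = lc x.
Proof.
have [|h1 h2] := @coef_prod_top R[i] _ (index_enum 'I_d) (fun j => 'X - (a j : R[i])%:P).
  by move=> j; rewrite size_XsubC.
have [|h3 h4] := @coef_prod_top R[i] _ (index_enum 'I_d)
    (fun j => 1 - ((a j : R[i])^*)%:P * 'X).
  by move=> j; rewrite -mulNr -polyCN -polyC1; exact: sfactor.
have sd : size (index_enum 'I_d) = d by rewrite [index_enum _]unlock -enumT size_enum_ord.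
rewrite sd in h1 h2 h3 h4; split.
  rewrite (leq_trans (size_polyD _ _))// geq_max size_polyN.
  by rewrite !mul_polyC !(leq_trans (size_scale_leq _ _)).
rewrite /fiber_poly coefD coefN !coefCM h2 h4 /lc big1 ?mulr1; last first.
  by move=> j _; rewrite coefB coefX coefC subr0.
congr (_ - _ * _); apply: eq_bigr => j _.
by rewrite coefB coef1 coefCM coefX mulr1 sub0r.
Qed.

(** A lower bound, uniform for |x| <= 1, of the modulus of the coefficient of degree [d] of
    [fiber_poly x]. Every fibre thus has [d] points, counted with multiplicity, and the constant in
    [blaschke_lift] is independent of [x]. *)
Definition blaschke_gap : R := 1 - \prod_(j < d) nm (a j).

Lemma blaschke_gap_gt0 : 0 < blaschke_gap.
Proof.
rewrite subr_gt0 (bigD1 (Ordinal d0))//= (le_lt_trans _ (a1 (Ordinal d0)))//.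
by rewrite ler_piMr ?nm_ge0// prodr_ile1// => j _; rewrite nm_ge0 ltW.
Qed.

Let nm_lc x : nm x <= 1 -> blaschke_gap <= nm (lc x).
Proof.
move=> hx; have h : nm c <= nm (lc x) + nm (x * \prod_(j < d) (- (a j)^*)).
  by rewrite -[X in nm X <= _](subrK (x * \prod_(j < d) (- (a j)^*))) nmD.
have h' : nm (x * \prod_(j < d) (- (a j)^*)) <= \prod_(j < d) nm (a j).
  rewrite nmM nm_prod (eq_bigr (fun j => nm (a j))); last first.
    by move=> j _; rewrite nmN nmJ.
  by rewrite ler_piMl// prodr_ge0// => j _; rewrite nm_ge0.
by rewrite c1 in h; rewrite /blaschke_gap; lra.
Qed.

Let ge_sq (z z' : C) : (nm z <= nm z') = (nm z ^+ 2 <= nm z' ^+ 2).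
Proof. by rewrite ler_sqr ?nnegrE ?nm_ge0. Qed.

(** [r] lists the roots of [fiber_poly x] and [l] is its leading coefficient. The roots lie in the
    closed disc because |N| > |Q| outside it, while a root satisfies |N| = |x| |Q|. The last formula
    is the reflection of the previous one in the unit circle. *)
Lemma blaschke_fiber x : nm x <= 1 -> exists (r : seq C) (l : C),
  [/\ size r = d, blaschke_gap <= nm l,
   forall y, y \in r -> [/\ nm y <= 1, B y = x & (nm x < 1 -> nm y < 1)],
   forall z, nm z <= 1 ->
     (B z - x) * \prod_(j < d) (1 - (a j)^* * z) = l * \prod_(y <- r) (z - y) &
   forall z, nm z <= 1 ->
     nm ((1 - x^* * B z) * \prod_(j < d) (1 - (a j)^* * z)) =
     nm l * \prod_(y <- r) nm (1 - y^* * z)].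
Proof.
move=> hx; have [sF cF] := fiber_poly_lc x.
have l0 : lc x != 0.
  by rewrite -[_ == _]nm_eq0 gt_eqF// (lt_le_trans blaschke_gap_gt0)// nm_lc.
have sizeF : size (fiber_poly x) = d.+1.
  apply/eqP; rewrite eqn_leq sF /= ltnNge; apply/negP => h.
  by move: cF; rewrite nth_default// => h'; rewrite -h' eqxx in l0.
have lF : lead_coef (fiber_poly x) = lc x by rewrite lead_coefE sizeF.
have [r rE] := closed_field_poly_normal (fiber_poly x).
rewrite lF in rE; have rz z : c * N z - x * Q z = lc x * \prod_(y <- r) (z - y).
  rewrite -fiber_polyE rE hornerZ horner_prod; congr (_ * _).
  by apply: eq_bigr => y _; rewrite hornerXsubC.
have sr : size r = d.
  by apply: succn_inj; rewrite -sizeF rE size_scale// size_prod_XsubC.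
have cNE z : c * N z = x * Q z -> nm (N z) = nm x * nm (Q z).
  by move=> /(congr1 (@nm R)); rewrite !nmM c1 mul1r.
have rD y : y \in r -> c * N y = x * Q y.
  move=> yr; apply/eqP; rewrite -subr_eq0 rz; apply/eqP.
  by rewrite (big_rem y yr) /= subrr mul0r mulr0.
have NQ z : 1 <= nm z -> nm (Q z) <= nm (N z).
  move=> hz; rewrite /N /Q !nm_prod ler_prod// => j _; rewrite nm_ge0 ge_sq /=.
  rewrite -subr_ge0 -opprB nm_mobius -mulNr opprB mulr_ge0// subr_ge0.
    by rewrite -[1](expr1n _ 2) ler_sqr ?nnegrE ?nm_ge0.
  by rewrite -nm_le1_sq ltW.
have N0 z : 1 <= nm z -> N z != 0.
  move=> hz; apply/prodf_neq0 => j _; rewrite subr_eq0; apply/eqP => h.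
  by have := a1 j; rewrite -h ltNge hz.
have rD1 y : y \in r -> nm y <= 1.
  move=> yr; rewrite leNgt; apply/negP => hy.
  have Ny : 0 < \prod_(i < d | i != Ordinal d0) nm (y - a i).
    apply: prodr_gt0 => j _; rewrite nm_gt0 subr_eq0; apply/eqP => h.
    by have := a1 j; rewrite -h ltNge ltW.
  have fac j : nm (1 - (a j)^* * y) < nm (y - a j).
    rewrite -ltr_sqr ?nnegrE ?nm_ge0// -subr_gt0 -opprB nm_mobius -mulNr opprB.
    rewrite mulr_gt0// subr_gt0; last by rewrite -nm_lt1_sq.
    by rewrite -[1](expr1n _ 2) ltr_sqr ?nnegrE ?nm_ge0.
  have : nm (Q y) < nm (N y).
    rewrite /N /Q !nm_prod (bigD1 (Ordinal d0))//= [ltRHS](bigD1 (Ordinal d0))//=.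
    apply: le_lt_trans (_ : _ <= nm (1 - (a (Ordinal d0))^* * y) *
      \prod_(i < d | i != Ordinal d0) nm (y - a i)) _.
      by rewrite ler_wpM2l ?nm_ge0// ler_prod// => j _; rewrite nm_ge0 ltW.
    by rewrite ltr_pM2r.
  by rewrite (cNE _ (rD _ yr)) ltNge ler_piMl ?nm_ge0.
exists r, (lc x); split => //; first exact: nm_lc.
- move=> y yr; split; [exact: rD1| |].
    apply: (mulIf (Q_neq0 (rD1 _ yr))); rewrite BQ ?rD1//; exact: rD.
  move=> x1; rewrite ltNge; apply/negP => y1.
  have := cNE _ (rD _ yr); have := NQ _ y1.
  have : 0 < nm (N y) by rewrite nm_gt0 N0.
  move: (nm_ge0 x) (nm_ge0 (Q y)) x1; move: (nm x) (nm (N y)) (nm (Q y)) => *; nra.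
- by move=> z hz; rewrite mulrBl BQ.
move=> z hz; rewrite mulrBl mul1r -mulrA BQ//.
(* The reflection of 0 is the point at infinity, so at [z = 0] the formula is checked directly on
   the leading coefficient. *)
have [->|z0] := eqVneq z 0.
  rewrite [X in _ = _ * X]big1; last by move=> y _; rewrite mulr0 subr0 nm1.
  rewrite mulr1 -(nmJ (lc x)) -[RHS]mul1r -c1 -nmM; congr nm.
  rewrite /lc rmorphB rmorphM rmorph_prod mulrBr cJ /Q /N big1; last first.
    by move=> j _; rewrite mulr0 subr0.
  rewrite mulrCA; congr (_ - _ * (_ * _)); apply: eq_bigr => j _.
  by rewrite sub0r rmorphN /= conjcK.
have e1 (f : 'I_d -> C) : z ^+ d * \prod_(j < d) f j = \prod_(j < d) (z * f j).
  by rewrite big_split/= prodr_const card_ord.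
have e2 (f : C -> C) : z ^+ d * \prod_(y <- r) f y = \prod_(y <- r) (z * f y).
  rewrite -sr; elim: (r) => [|y s IH]; first by rewrite !big_nil mulr1.
  by rewrite !big_cons /= exprS -IH; ring.
(* The first factorisation is evaluated at the reflected point 1 / conj z, conjugated and multiplied
   by [z ^+ d]; the factor of a root [y] becomes 1 - (conj y) z. *)
have h : z ^+ d * (c * N (z^*)^-1 - x * Q (z^*)^-1)^* =
         z ^+ d * (lc x * \prod_(y <- r) ((z^*)^-1 - y))^* by rewrite rz.
rewrite (_ : nm (lc x) * _ = nm ((lc x)^* * \prod_(y <- r) (1 - y^* * z))); last first.
  by rewrite nmM nmJ nm_prod.
have -> : Q z - x^* * (c * N z) = c * (c^* * Q z - x^* * N z).
  by rewrite mulrBr (mulrA c) cJ mul1r (mulrCA c).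
rewrite nmM c1 mul1r; congr nm.
have <- : z ^+ d * (c * N (z^*)^-1 - x * Q (z^*)^-1)^* = c^* * Q z - x^* * N z.
  rewrite cjB !cjM mulrBr !(mulrCA (z ^+ d)) !cj_prod !e1.
  congr (_ * _ - _ * _); apply: eq_bigr => j _.
    by rewrite cjB cjV cjK mulrBr divff// mulrC.
  by rewrite cjB cj1 cjM cjV !cjK mulrBr mulr1 mulrCA divff// mulr1.
rewrite h cjM mulrCA cj_prod e2; congr (_ * _); apply: eq_bigr => y _.
by rewrite cjB cjV cjK mulrBr divff// mulrC.
Qed.

End Fiber.

Section FiberConsequences.
Variables (R : realType) (d : nat) (c : (R[i])^o) (a : 'I_d -> (R[i])^o).
Local Notation C := (R[i])^o.
Hypothesis d0 : (0 < d)%N.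
Hypothesis c1 : nm c = 1.
Hypothesis a1 : forall j, nm (a j) < 1.
Local Notation B := (blaschke c a).

(** Quotient of the two factorisations in [blaschke_fiber]: up to a unimodular constant, [mob x]
    after [B] is the Blaschke product whose zeros are the fibre over [x]. *)
Lemma blaschke_preimages x : nm x < 1 -> exists r : seq C,
  [/\ (0 < size r)%N, forall y, y \in r -> nm y < 1 /\ B y = x &
   forall z, nm z <= 1 -> \prod_(y <- r) nm (mob y z) = nm (mob x (B z))].
Proof.
move=> hx; have [r [l [sr hl rP r1 r2]]] := blaschke_fiber d0 c1 a1 (ltW hx).
have l0 : nm l != 0 by rewrite gt_eqF// (lt_le_trans (blaschke_gap_gt0 d0 a1)).
exists r; split; first by rewrite sr.
  by move=> y /rP[_ -> /(_ hx)].
move=> z hz; have Q0 : nm (\prod_(j < d) (1 - (a j)^* * z)) != 0.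
  by rewrite nm_eq0; apply/prodf_neq0 => j _; exact: mobius_den_neq0.
have := congr1 (@nm R) (r1 z hz); rewrite !nmM nm_prod => e1.
have := r2 z hz; rewrite nmM => e2.
have mobE y u : nm (mob y u) = nm (u - y) * (nm (1 - y^* * u))^-1.
  by rewrite /mob nmM nmV.
rewrite nmV -(mulfK Q0 (nm (B z - x))) e1 -(mulfK Q0 (nm (1 - _))) e2.
under eq_bigr do rewrite mobE.
rewrite big_split /= prodfV; set u := \prod_(y <- r) nm (z - y).
have v0 : \prod_(y <- r) nm (1 - y^* * z) != 0.
  rewrite prodf_seq_neq0; apply/allP => y yr; rewrite nm_eq0 implyTb.
  by rewrite mobius_den_neq0//; have [_ _ ->] := rP _ yr.
by field; rewrite Q0 v0 l0.
Qed.

(** The product of the distances from [y] to the [d] points of the fibre over [x] is |B y - x| |Q y|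
    / |l|, with |Q y| <= 2^d and |l| at least the gap; so the smallest distance is at most the
    [d]-th root of the bound. This is a quantitative openness of [B] on the closed disc. *)
Lemma blaschke_lift : exists2 M : R, 0 < M & forall y x, nm y <= 1 -> nm x <= 1 ->
  exists y', [/\ nm y' <= 1, B y' = x & nm (y' - y) ^+ d <= M * nm (x - B y)].
Proof.
have g0 := blaschke_gap_gt0 d0 a1.
exists (2 ^+ d / blaschke_gap a); first by rewrite divr_gt0// exprn_gt0.
move=> y x hy hx; have [r [l [sr hl rP r1 _]]] := blaschke_fiber d0 c1 a1 hx.
apply: contrapT => hn.
have hr y' : y' \in r ->
    0 <= 2 ^+ d / blaschke_gap a * nm (x - B y) < nm (y' - y) ^+ d.
  move=> /rP[h1 h2 _]; rewrite mulr_ge0 ?nm_ge0 ?divr_ge0 ?(ltW g0) ?exprn_ge0//=.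
  by rewrite ltNge; apply/negP => h3; apply: hn; exists y'.
set X := 2 ^+ d / _ * _ in hr.
have : X ^+ d < (\prod_(y' <- r) nm (y' - y)) ^+ d.
  rewrite -prodrXl -[X in X < _](_ : \prod_(y' <- r) X = X ^+ d); last first.
    by rewrite big_const_seq count_predT sr -Monoid.iteropE.
  have : (0 < size r)%N by rewrite sr.
  move: (hr); case: (r) => // y1 s hs _.
  rewrite !big_cons; have /andP[X0 h1] := hs _ (mem_head _ _).
  apply: le_lt_trans (_ : _ <= X * \prod_(j <- s) nm (j - y) ^+ d) _.
    rewrite ler_wpM2l// !big_seq ler_prod// => j js.
    by have /andP[-> /ltW] := hs j (mem_behead (s := y1 :: s) js).
  rewrite ltr_pM2r// big_seq prodr_gt0// => j js.
  have /andP[X1 h2] := hs j (mem_behead (s := y1 :: s) js); exact: le_lt_trans h2.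
have := congr1 (@nm R) (r1 y hy); rewrite !nmM !nm_prod => e.
rewrite ltr_pXn2r ?nnegrE//; last 2 first.
- have : r != [::] by rewrite -size_eq0 sr -lt0n.
  by case: (r) hr => // y1 s hs _; have /andP[] := hs _ (mem_head _ _).
- by rewrite prodr_ge0// => j _; rewrite nm_ge0.
apply/negP; rewrite -leNgt /X mulrAC ler_pdivlMr//.
under eq_bigr do rewrite nm_distC.
apply: le_trans (_ : _ <= nm l * \prod_(i <- r) nm (y - i)) _.
  by rewrite mulrC ler_wpM2r// prodr_ge0// => j _; rewrite nm_ge0.
rewrite -e nm_distC mulrC ler_wpM2r ?nm_ge0//.
rewrite -[d in 2 ^+ d]card_ord -prodr_const ler_prod// => j _; rewrite nm_ge0 /=.
apply: le_trans (nmB _ _) _; rewrite nm1 nmM nmJ.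
have := a1 j; have := nm_ge0 (a j); have := nm_ge0 y.
by move: hy; move: (nm y) (nm (a j)) => *; nra.
Qed.

Lemma blaschke_iter_lift k y (e : R) : nm y <= 1 -> 0 < e ->
  exists2 dl : R, 0 < dl & forall x, nm x <= 1 -> nm (x - iter k B y) < dl ->
    exists y', [/\ nm y' <= 1, iter k B y' = x & nm (y' - y) < e].
Proof.
have [M M0 h] := blaschke_lift.
move=> hy; elim: k e => [|k IH] e e0; first by exists e => // x hx h1; exists x.
have [dl dl0 hdl] := IH e e0.
have by1 : nm (iter k B y) <= 1 by apply: iter_disc => // z; exact: blaschke_disc.
exists (dl ^+ d / M); first by rewrite divr_gt0// exprn_gt0.
move=> x hx; rewrite ltr_pdivlMr// mulrC => hxy.
have [y1 [y11 y12 y13]] := h _ _ by1 hx.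
have [|y' [h1 h2 h3]] := hdl _ y11.
  rewrite -(@ltr_pXn2r _ d)// ?nnegrE ?nm_ge0 ?(ltW dl0)//.
  exact: le_lt_trans y13 hxy.
by exists y'; split => //=; rewrite h2.
Qed.

Lemma blaschke_fiber_finite x : nm x <= 1 ->
  exists r : seq C, forall y, (nm y <= 1 /\ B y = x) <-> y \in r.
Proof.
move=> hx; have [r [l [sr hl rP r1 _]]] := blaschke_fiber d0 c1 a1 hx.
exists r => y; split; last by move=> /rP[].
move=> [hy hB]; have := r1 y hy; rewrite hB subrr mul0r => /esym/eqP.
rewrite mulf_eq0 -[l == 0]nm_eq0 gt_eqF ?(lt_le_trans (blaschke_gap_gt0 d0 a1))//=.
by rewrite prodf_seq_eq0 => /hasP[y' yr]; rewrite /= subr_eq0 => /eqP->.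
Qed.

End FiberConsequences.


Lemma one_sub_prod_le (R : realDomainType) (I : eqType) (r : seq I) (t : I -> R) :
  (forall i, i \in r -> 0 <= t i <= 1) ->
  0 <= \prod_(i <- r) t i <= 1 /\ 1 - \prod_(i <- r) t i <= \sum_(i <- r) (1 - t i).
Proof.
elim: r => [|i r IH] h; first by rewrite !big_nil ler01 lexx subrr.
have [|/andP[p0 p1] h1] := IH; first by move=> j jr; rewrite h// in_cons jr orbT.
have /andP[t0 t1] := h i (mem_head _ _).
rewrite !big_cons; set p := \prod_(_ <- _) _ in p0 p1 h1 *.
set s := \sum_(_ <- _) _ in h1 *; set u := t i in t0 t1 *.
by split; [apply/andP; split|]; nra.
Qed.

(** Form without logarithms of [sum (1 - t) <= - log (prod t) <= 1 / prod t - 1]; it bounds the sum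
    of 1 - |y|^2 over a fibre through the product of the |y|^2. *)
Lemma sum_one_sub_le (R : realFieldType) (I : eqType) (r : seq I) (t : I -> R) :
  (forall i, i \in r -> 0 < t i <= 1) ->
  \sum_(i <- r) (1 - t i) <= (\prod_(i <- r) t i)^-1 - 1.
Proof.
move=> h; suff [_ [p1]] : 0 < \prod_(i <- r) t i /\ \prod_(i <- r) t i <= 1 /\
    \sum_(i <- r) (1 - t i) <= (\prod_(i <- r) t i)^-1 - 1 by [].
elim: r h => [|i r IH] h; first by rewrite !big_nil ltr01 lexx invr1 subrr.
have [|p0 [p1 h1]] := IH; first by move=> j jr; rewrite h// in_cons jr orbT.
have /andP[t0 t1] := h i (mem_head _ _).
rewrite !big_cons; set p := \prod_(_ <- _) _ in p0 p1 h1 *.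
set s := \sum_(_ <- _) _ in h1 *; set u := t i in t0 t1 *.
split; first exact: mulr_gt0.
split; first by nra.
have pi1 : 1 <= p^-1 by rewrite invf_ge1.
have ui : 1 - u <= u^-1 - 1.
  rewrite -subr_ge0 (_ : _ - _ = (1 - u) ^+ 2 / u); first by rewrite divr_ge0 ?sqr_ge0 ?ltW.
  by field; rewrite gt_eqF.
have ui1 : 1 <= u^-1 by rewrite invf_ge1.
rewrite invfM; move: ui ui1 pi1 h1; move: (p^-1) (u^-1) => a b *; nra.
Qed.

Lemma ltr_sum_seq (R : numDomainType) (I : eqType) (r : seq I) (f g : I -> R) :
  (0 < size r)%N -> (forall i, i \in r -> f i < g i) ->
  \sum_(i <- r) f i < \sum_(i <- r) g i.
Proof.
case: r => // i r _ h; rewrite !big_cons ltr_leD ?h ?mem_head//.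
by rewrite !big_seq ler_sum// => j jr; rewrite ltW// h// in_cons jr orbT.
Qed.

(** * Backward orbits *)

Section Dynamics.
Variables (R : realType) (d : nat) (c : (R[i])^o) (a : 'I_d -> (R[i])^o).
Local Notation C := (R[i])^o.
Hypothesis d0 : (0 < d)%N.
Hypothesis c1 : nm c = 1.
Hypothesis a1 : forall j, nm (a j) < 1.
Local Notation B := (blaschke c a).

Let BD z : nm z <= 1 -> nm (B z) <= 1. Proof. exact: blaschke_disc. Qed.
Let BU z : nm z < 1 -> nm (B z) < 1. Proof. exact: blaschke_open_disc. Qed.

Lemma iter_open_disc n z : nm z < 1 -> nm (iter n B z) < 1.
Proof. by move=> hz; elim: n => [|n IH] //=; exact: BU. Qed.

Lemma iter_circle n z : nm z = 1 -> nm (iter n B z) = 1.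
Proof. by move=> hz; elim: n => [|n IH] //=; exact: blaschke_circle. Qed.

(** On the circle this is the Poisson kernel of [y]. Its denominator, which equals |p - y|^2 there,
    has no zero for [p] in the closed disc, so boundary inequalities can be obtained by continuity
    from inside. *)
Definition poisson (p y : C) : R := (1 - nm y ^+ 2) / nm (1 - y^* * p) ^+ 2.

Lemma contD_poisson y : nm y < 1 -> {within @Dset R, continuous (fun p => poisson p y)}.
Proof.
move=> hy; apply: contD_mulR; first exact: contD_cst.
have cn : {within @Dset R, continuous (fun z : C => nm (1 - y^* * z))}.
  apply: contD_nm; under eq_fun do rewrite -mulNr.
  apply: contD_add; first exact: contD_cst.
  by apply: contD_mul; [exact: contD_cst|exact: contD_id].
apply: contD_invR; last exact: contD_mulR.
by move=> z hz; rewrite sqrf_eq0 nm_eq0 mobius_den_neq0.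
Qed.

Lemma poisson_circle p y : nm p = 1 ->
  poisson p y = (1 - nm y ^+ 2) / nm (p - y) ^+ 2.
Proof.
move=> hp; congr (_ / _); apply/eqP; rewrite -subr_eq0 nm_mobius hp.
by rewrite expr1n subrr mul0r.
Qed.

Variable K : C -> R.
Hypothesis cK : {within @Dset R, continuous K}.
Hypothesis K_ge0 : forall z, nm z <= 1 -> 0 <= K z.
Hypothesis KE : forall z, nm z <= 1 -> 1 - nm (B z) ^+ 2 = (1 - nm z ^+ 2) * K z.

Let cB : {within @Dset R, continuous B}. Proof. exact: contD_blaschke. Qed.

Let one_sub_mobB x z : nm x < 1 -> nm z <= 1 ->
  1 - nm (mob x (B z)) ^+ 2 = (1 - nm z ^+ 2) * (K z * poisson (B z) x).
Proof. by move=> hx hz; rewrite one_sub_nm_mob_sq ?BD// KE// -mulrA. Qed.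

Let contD_KP x : nm x < 1 ->
  {within @Dset R, continuous (fun p => K p * poisson (B p) x)}.
Proof.
move=> hx; apply: contD_mulR => //.
by apply: (contD_comp (g := fun p => poisson p x)) => //; exact: contD_poisson.
Qed.

Let sq1 (z : C) : nm z < 1 -> 0 < 1 - nm z ^+ 2.
Proof. by move=> hz; rewrite subr_gt0 -nm_lt1_sq. Qed.

(** Inside the disc, divide [1 - prod |mob y z|^2 <= sum (1 - |mob y z|^2)] by 1 - |z|^2; the
    boundary follows by continuity. On the circle both sides are the modulus of the derivative of
    [mob x] after [B]. *)
Lemma poisson_transfer x : nm x < 1 -> exists r : seq C,
  [/\ (0 < size r)%N, forall y, y \in r -> nm y < 1 /\ B y = x,
   forall z, nm z <= 1 -> \prod_(y <- r) nm (mob y z) = nm (mob x (B z)) &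
   forall p, nm p <= 1 -> K p * poisson (B p) x <= \sum_(y <- r) poisson p y].
Proof.
move=> hx; have [r [r0 rP rE]] := blaschke_preimages d0 c1 a1 hx.
exists r; split => // p.
apply: (@disc_interior_le R (fun p => K p * poisson (B p) x)
  (fun p => \sum_(y <- r) poisson p y)); first exact: contD_KP.
  by apply: contD_sumR => y /rP[hy _]; exact: contD_poisson.
move=> z hz; rewrite -(ler_pM2l (sq1 hz)) -one_sub_mobB ?(ltW hz)//.
rewrite -rE ?(ltW hz)// mulr_sumr -prodrXl.
have [|_] := @one_sub_prod_le _ _ r (fun y => nm (mob y z) ^+ 2).
  by move=> y /rP[hy _]; rewrite sqr_ge0 -nm_le1_sq nm_mob_le1// ltW.
move=> /le_trans; apply; rewrite le_eqVlt; apply/orP; left; apply/eqP.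
apply: eq_big_seq => y /rP[hy _]; by rewrite one_sub_nm_mob_sq// ltW.
Qed.

(* Julia's lemma, obtained by letting the point of the Schwarz-Pick inequality go to
   the boundary. *)
Lemma poisson_julia z p : nm z < 1 -> nm p <= 1 ->
  poisson p z <= K p * poisson (B p) (B z).
Proof.
move=> hz; have hBz := BU hz.
have [r [r0 rP rE]] := blaschke_preimages d0 c1 a1 hBz.
apply: (@disc_interior_le R (poisson^~ z) (fun p => K p * poisson (B p) (B z)));
  [exact: contD_poisson|exact: contD_KP|move=> u hu].
rewrite -(ler_pM2l (sq1 hu)) -one_sub_mobB ?(ltW hu)//.
rewrite -one_sub_nm_mob_sq ?(ltW hu)// lerD2l lerN2 ler_sqr ?nnegrE ?nm_ge0//.
rewrite -rE ?(ltW hu)//.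
(* [z] itself lies in the fibre over [B z], so the product of pseudo-hyperbolic distances is at most
   its factor: the Schwarz-Pick inequality. *)
have zr : z \in r.
  have := rE z (ltW hz); rewrite {2}/mob subrr mul0r nm0 => /eqP.
  rewrite prodf_seq_eq0 => /hasP[y yr] /=; rewrite nm_eq0 mulf_eq0 invr_eq0.
  have [hy _] := rP _ yr; rewrite (negbTE (mobius_den_neq0 (ltW hz) hy)) orbF.
  by rewrite subr_eq0 => /eqP->.
rewrite (big_rem z zr) /= ler_piMr ?nm_ge0//.
have [|/andP[]//] := @one_sub_prod_le _ _ (rem z r) (fun y => nm (mob y u)).
by move=> y /mem_rem/rP[hy _]; rewrite nm_ge0 nm_mob_le1// ltW.
Qed.

(** By the chain rule, the modulus of the derivative of the [n]-th iterate of [B] at a point of the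
    circle. *)
Definition kap n p : R := \prod_(i < n) K (iter i B p).

Lemma kapS n p : kap n.+1 p = K p * kap n (B p).
Proof.
by rewrite /kap big_ord_recl; congr (_ * _); apply: eq_bigr => i _; rewrite -iterSr.
Qed.

Lemma kap_ge0 n p : nm p <= 1 -> 0 <= kap n p.
Proof. by move=> hp; apply: prodr_ge0 => i _; apply/K_ge0/iter_disc. Qed.

Lemma kapM k l p : iter k B p = p -> kap (l * k) p = kap k p ^+ l.
Proof.
move=> kp; elim: l => [|l IH]; first by rewrite /kap big_ord0.
rewrite exprS -IH mulSn /kap big_split_ord /=; congr (_ * _).
by apply: eq_bigr => i _; rewrite addnC iterD kp.
Qed.

Lemma iter_poisson_julia n z p : nm z < 1 -> nm p <= 1 ->
  poisson p z <= kap n p * poisson (iter n B p) (iter n B z).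
Proof.
elim: n z p => [|n IH] z p hz hp; first by rewrite /kap big_ord0 mul1r.
rewrite kapS !iterSr -mulrA (le_trans (poisson_julia hz hp))//.
by rewrite ler_wpM2l ?K_ge0// IH ?BU ?BD.
Qed.

Lemma iter_poisson_transfer n x : nm x < 1 -> exists r : seq C,
  [/\ (0 < size r)%N, forall y, y \in r -> nm y < 1 /\ iter n B y = x,
   forall z, nm z <= 1 -> \prod_(y <- r) nm (mob y z) = nm (mob x (iter n B z)) &
   forall p, nm p <= 1 -> kap n p * poisson (iter n B p) x <= \sum_(y <- r) poisson p y].
Proof.
move=> hx; elim: n => [|n [s [s0 sP sE sK]]].
  exists [:: x]; split => // [y|z hz|p hp]; first by rewrite inE => /eqP->.
    by rewrite big_seq1.
  by rewrite big_seq1 /kap big_ord0 mul1r.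
have /choice[pre preP] : forall y, exists r : seq C, nm y < 1 ->
  [/\ (0 < size r)%N, forall y', y' \in r -> nm y' < 1 /\ B y' = y,
   forall z, nm z <= 1 -> \prod_(y' <- r) nm (mob y' z) = nm (mob y (B z)) &
   forall p, nm p <= 1 -> K p * poisson (B p) y <= \sum_(y' <- r) poisson p y'].
  move=> y; have [hy|hy] := boolP (nm y < 1); last by exists [::].
  by have [r hr] := poisson_transfer hy; exists r.
exists (flatten (map pre s)); split.
- case: s s0 sP {sE sK} => // y s _ sP; rewrite /= size_cat.
  have [hy _] := sP y (mem_head _ _); have [h _ _ _] := preP _ hy.
  by rewrite addn_gt0 h.
- move=> y' /flattenP[r /mapP[y /sP[hy hyx] ->] y'r].
  have [_ h _ _] := preP _ hy; have [hy' By'] := h _ y'r.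
  by split => //; rewrite iterSr By'.
- move=> z hz; rewrite big_flatten big_map iterSr -sE ?BD//.
  by apply: eq_big_seq => y /sP[hy _]; have [_ _ h _] := preP _ hy; rewrite h.
- move=> p hp; rewrite big_flatten big_map iterSr kapS.
  apply: le_trans (_ : _ <= \sum_(y <- s) K p * poisson (B p) y) _.
    by rewrite -mulr_sumr -mulrA ler_wpM2l ?K_ge0// sK ?BD.
  by rewrite !big_seq ler_sum// => y /sP[hy _]; have [_ _ _ h] := preP _ hy; rewrite h.
Qed.

(* The Poisson kernels of the preimages y of x at p add up to at least kap times that
   of x, while the sum of 1 - |y|^2 is controlled by the product of the |y|, which is the
   pseudo-hyperbolic distance from x to the n-th iterate of 0.  Hence some y is near p. *)
Let iter_backward_open n p x : nm p = 1 -> iter n B p = p -> nm x < 1 ->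
  exists y, [/\ nm y <= 1, iter n B y = x &
    kap n p * nm (p - y) ^+ 2 * nm (iter n B 0 - x) ^+ 2 <= nm (p - x) ^+ 2].
Proof.
move=> hp np hx; have [r [r0 rP rE rK]] := iter_poisson_transfer n hx.
set b := iter n B 0; have [bx|bx] := eqVneq b x.
  case: r r0 rP {rE rK} => // y r _ rP.
  have [hy yx] := rP y (mem_head _ _); exists y; split => //; first exact: ltW.
  by rewrite bx subrr nm0 expr0n mulr0 sqr_ge0.
apply: contrapT => hn.
have D0 : 0 < nm (b - x) ^+ 2 by rewrite exprn_gt0// nm_gt0 subr_eq0.
have P0 : 0 < nm (p - x) ^+ 2.
  rewrite exprn_gt0// nm_gt0 subr_eq0; apply/eqP => h.
  by move: hx; rewrite -h hp ltxx.
have p1 : nm p <= 1 by rewrite hp.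
have k0 := kap_ge0 n p1.
have hr y : y \in r -> poisson p y <
    (1 - nm y ^+ 2) * (kap n p * nm (b - x) ^+ 2 / nm (p - x) ^+ 2).
  move=> /rP[hy yx]; rewrite poisson_circle// ltr_pM2l ?sq1//.
  have py : 0 < nm (p - y) ^+ 2.
    rewrite exprn_gt0// nm_gt0 subr_eq0; apply/eqP => h.
    by move: hy; rewrite -h hp ltxx.
  rewrite ltr_pdivlMr// mulrC ltr_pdivrMr// ltNge; apply/negP => h.
  by apply: hn; exists y; split; rewrite ?(ltW hy)//; move: h; lra.
have := ltr_sum_seq r0 hr; rewrite -mulr_suml.
have hS : \sum_(y <- r) (1 - nm y ^+ 2) <= (1 - nm x ^+ 2) / nm (b - x) ^+ 2.
  have m0 (y : C) : nm (mob y 0) = nm y.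
    by rewrite /mob sub0r mulr0 subr0 divr1 nmN.
  have prE : \prod_(y <- r) nm y ^+ 2 = nm (b - x) ^+ 2 / nm (1 - x^* * b) ^+ 2.
    rewrite prodrXl -expr_div_n -nmV -nmM -/(mob x b) -rE ?nm0//.
    by congr (_ ^+ 2); apply: eq_bigr => y _; rewrite m0.
  have E0 : 0 < nm (1 - x^* * b) ^+ 2.
    by rewrite exprn_gt0// nm_gt0 mobius_den_neq0// iter_disc// nm0.
  have p0 : 0 < \prod_(y <- r) nm y ^+ 2 by rewrite prE divr_gt0.
  apply: le_trans (sum_one_sub_le (t := fun y => nm y ^+ 2) _) _.
    move=> y yr; have [hy _] := rP _ yr; rewrite -nm_le1_sq (ltW hy) andbT.
    rewrite lt0r sqr_ge0 andbT; apply/eqP => h.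
    by move: p0; rewrite (big_rem y yr)/= h mul0r ltxx.
  rewrite prE invf_div.
  have -> : nm (1 - x^* * b) ^+ 2 / nm (b - x) ^+ 2 - 1 =
     (1 - nm b ^+ 2) * (1 - nm x ^+ 2) / nm (b - x) ^+ 2.
    by rewrite -nm_mobius mulrBl divff// gt_eqF.
  by rewrite ler_pM2r ?invr_gt0// ler_piMl// ?(ltW (sq1 hx))// lerBlDr lerDl sqr_ge0.
rewrite ltNge => /negP; apply.
have := rK p p1; rewrite np poisson_circle//; apply: le_trans.
apply: le_trans (ler_wpM2r _ hS) _.
  by rewrite mulr_ge0 ?invr_ge0 ?mulr_ge0 ?nm_ge0.
rewrite le_eqVlt; apply/orP; left; apply/eqP.
move: D0 P0; move: (nm (b - x) ^+ 2) (nm (p - x) ^+ 2) => u v u0 v0.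
by field; rewrite !gt_eqF.
Qed.

(** The fibre product is available for |x| < 1 only. For [x] on the circle, preimages of radial
    approximations are clustered; the estimate, free of denominators, passes to the limit. *)
Lemma iter_backward n p x : nm p = 1 -> iter n B p = p -> nm x <= 1 ->
  exists y, [/\ nm y <= 1, iter n B y = x &
    kap n p * nm (p - y) ^+ 2 * nm (iter n B 0 - x) ^+ 2 <= nm (p - x) ^+ 2].
Proof.
move=> hp np hx; have [u [uU ux]] := disc_radial hx.
have /choice[y hy] : forall k, exists y, [/\ nm y <= 1, iter n B y = u k &
    kap n p * nm (p - y) ^+ 2 * nm (iter n B 0 - u k) ^+ 2 <= nm (p - u k) ^+ 2].
  by move=> k; exact: iter_backward_open.
have yD k : nm (y k) <= 1 by have [] := hy k.
have [v vD vc] := disc_cluster yD.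
have cG : {within @Dset R, continuous (iter n B)} by exact: contD_iter.
have cd (q : C) (f : C -> C) : {within @Dset R, continuous f} ->
    {within @Dset R, continuous (fun z => nm (q - f z))}.
  move=> cf; apply: contD_nm; apply: contD_add; first exact: contD_cst.
  under eq_fun do rewrite -mulN1r.
  by apply: (contD_mul _ cf); exact: contD_cst.
have Gv : iter n B v = x.
  apply/eqP; rewrite -subr_eq0 -nm_eq0 eq_le nm_ge0 andbT leNgt; apply/negP => e0.
  have e2 : 0 < nm (iter n B v - x) / 2 by rewrite divr_gt0.
  have [N hN] := ux _ e2.
  have : nm (x - iter n B v) <= nm (iter n B v - x) / 2.
    apply: (@cluster_le R y v (fun z => nm (x - iter n B z))
      (fun=> nm (iter n B v - x) / 2) N) => //.
    - exact: cd.
    - exact: contD_cst.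
    - by move=> k hk; have [_ -> _] := hy k; rewrite nm_distC ltW// hN.
  by rewrite nm_distC; move: e0; lra.
exists v; split => //; rewrite -Gv.
apply: (@cluster_le R y v
  (fun z => kap n p * nm (p - z) ^+ 2 * nm (iter n B 0 - iter n B z) ^+ 2)
  (fun z => nm (p - iter n B z) ^+ 2) 0%N) => //.
- apply: contD_mulR; last by apply: contD_mulR; exact: cd.
  apply: contD_mulR; first exact: contD_cst.
  by apply: contD_mulR; apply: (cd _ id); exact: contD_id.
- by apply: contD_mulR; exact: cd.
- by move=> k _; have [_ -> ] := hy k.
Qed.

End Dynamics.


Lemma expr_unbounded (R : realType) (x M : R) : 1 < x ->
  exists N, forall n, (N <= n)%N -> M < x ^+ n.
Proof.
move=> x1; have hb n : 1 + (x - 1) * n%:R <= x ^+ n.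
  elim: n => [|n IH]; first by rewrite mulr0 addr0 expr0.
  rewrite exprS; apply: le_trans (_ : _ <= x * (1 + (x - 1) * n%:R)) _; last first.
    by rewrite ler_wpM2l// (le_trans ler01)// ltW.
  have -> : 1 + (x - 1) * n.+1%:R = x * (1 + (x - 1) * n%:R) - (x - 1) ^+ 2 * n%:R.
    by rewrite -natr1; ring.
  by rewrite gerBl mulr_ge0 ?sqr_ge0.
exists (Num.trunc (M / (x - 1))).+1 => n hn.
apply: lt_le_trans (hb n); rewrite -ltrBlDl; apply: (@lt_trans _ _ M); first by lra.
rewrite -ltr_pdivrMl ?subr_gt0// mulrC (lt_le_trans (truncnS_gt _))//.
by rewrite ler_nat.
Qed.

(** * Repelling cycles on the circle *)

Section WolffDenjoy.
Variables (R : realType) (d : nat) (c : (R[i])^o) (a : 'I_d -> (R[i])^o).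
Local Notation C := (R[i])^o.
Hypothesis d0 : (0 < d)%N.
Hypothesis c1 : nm c = 1.
Hypothesis a1 : forall j, nm (a j) < 1.
Local Notation B := (blaschke c a).
Variable z0 : C.
Hypothesis wd : wolff_denjoy_point B z0.

Lemma wd_disc : nm z0 <= 1.
Proof. by rewrite -normC_le1; exact: wd.1. Qed.

Lemma wd_cvg z (e : R) : nm z < 1 -> 0 < e ->
  exists N, forall n, (N <= n)%N -> nm (iter n B z - z0) < e.
Proof.
move=> hz e0; have [|||N hN] := wd.2 [set z] _ _ e%:C.
- exact: compact_set1.
- by move=> u /= ->; rewrite normC_lt1.
- by rewrite ltcR.
by exists N => n hn; rewrite -normC_lt; exact: hN.
Qed.

Lemma wd_fixed : B z0 = z0.
Proof.
apply/eqP; rewrite -subr_eq0 -nm_eq0 eq_le nm_ge0 andbT leNgt; apply/negP => e0.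
set e := nm _ in e0; have e2 : 0 < e / 2 by rewrite divr_gt0.
have /contD_CP/(_ _ wd_disc _ e2)[dl dl0 hdl] := contD_blaschke (c := c) a1.
have n01 : nm (0 : C) < 1 by rewrite nm0.
have [N hN] := wd_cvg n01 dl0; have [N' hN'] := wd_cvg n01 e2.
have h1 := hN _ (leq_maxl N N').
have h2 := hN' _ (leqW (leq_maxr N N')).
have h3 : nm (iter (maxn N N') B 0) <= 1.
  by apply: iter_disc; [move=> z; exact: blaschke_disc|exact: ltW].
have := hdl _ h3 h1; have := nm_triangle (iter (maxn N N').+1 B 0) (B z0) z0.
by rewrite -/e [nm (B z0 - _)]nm_distC /= in h2 *; move: h2; lra.
Qed.

Section Repelling.
Variables (p : C) (k : nat).
Hypothesis (hp : nm p = 1) (k0 : (0 < k)%N) (kp : iter k B p = p) (pz0 : p != z0).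

Let p1 : nm p <= 1. Proof. by rewrite hp. Qed.

(** If the multiplier were at most 1, Julia's lemma along the period would give
    [poisson p z <= poisson p u] for every u = B^(nk)(z), hence in the limit (1 - |z|^2) |p - z0|^2
    <= (1 - |z0|^2) |p - z|^2. On the radius to [p] the left side is of first order in |p - z|, the
    right side of second order. *)
Lemma kap_gt1 (K : C -> R) : {within @Dset R, continuous K} ->
  (forall z, nm z <= 1 -> 0 <= K z) ->
  (forall z, nm z <= 1 -> 1 - nm (B z) ^+ 2 = (1 - nm z ^+ 2) * K z) ->
  1 < kap c a K k p.
Proof.
move=> cK K0 KE; rewrite ltNge; apply/negP => kap1.
have kapg := kap_ge0 c1 a1 K0 k p1.
have H z : nm z < 1 ->
    (1 - nm z ^+ 2) * nm (p - z0) ^+ 2 <= (1 - nm z0 ^+ 2) * nm (p - z) ^+ 2.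
  move=> hz; have zD n : nm (iter (n * k) B z) <= 1.
    by apply: iter_disc; [move=> u; exact: blaschke_disc|exact: ltW].
  have cd : {within @Dset R, continuous (fun z => nm (p - z))}.
    apply: contD_nm; under eq_fun do rewrite -mulN1r.
    apply: contD_add; first exact: contD_cst.
    by apply: contD_mul; [exact: contD_cst|exact: contD_id].
  apply: (@cluster_le R (fun n => iter (n * k) B z) z0
    (fun u => (1 - nm z ^+ 2) * nm (p - u) ^+ 2)
    (fun u => (1 - nm u ^+ 2) * nm (p - z) ^+ 2) 0%N) => //.
  - exact: wd_disc.
  - move=> e N e0; have [N' hN'] := wd_cvg hz e0.
    exists (maxn N N'); first exact: leq_maxl.
    by apply: hN'; rewrite (leq_trans (leq_maxr N N'))// leq_pmulr.
  - by apply: contD_mulR; [exact: contD_cst|exact: contD_mulR].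
  - apply: contD_mulR; last exact: contD_cst.
    have cn : {within @Dset R, continuous (@nm R)}.
      by apply: (@contD_nm R id); exact: contD_id.
    under eq_fun do rewrite expr2 -mulNr -mulN1r.
    apply: contD_addR; first exact: contD_cst.
    apply: contD_mulR => //; apply: contD_mulR => //; exact: contD_cst.
  - move=> n _; have := iter_poisson_julia d0 c1 a1 cK K0 KE (n * k) hz p1.
    have -> : iter (n * k) B p = p.
      by elim: n => [|n IH] //; rewrite mulSn iterD IH.
    rewrite !poisson_circle// kapM//; set u := iter _ _ z.
    have hu : nm u < 1 by exact: iter_open_disc.
    have pos v : nm v < 1 -> 0 < nm (p - v) ^+ 2.
      move=> hv; rewrite exprn_gt0// nm_gt0 subr_eq0; apply/eqP => h.
      by move: hv; rewrite -h hp ltxx.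
    have hl : kap c a K k p ^+ n <= 1 by rewrite exprn_ile1.
    have hq : 0 <= (1 - nm u ^+ 2) / nm (p - u) ^+ 2.
      by rewrite divr_ge0 ?sqr_ge0// subr_ge0 -nm_le1_sq ltW.
    move=> /le_trans/(_ (ler_piMl hq hl)).
    by rewrite ler_pdivrMr ?pos// mulrAC ler_pdivlMr ?pos.
set A := nm (p - z0) ^+ 2 in H.
have A0 : 0 < A by rewrite exprn_gt0// nm_gt0 subr_eq0.
have A4 : A <= 4.
  have : nm (p - z0) <= 2.
    by rewrite (le_trans (nmB _ _))// hp -[2]/(1 + 1) lerD2l wd_disc.
  by rewrite /A; have := nm_ge0 (p - z0); move: (nm _) => *; nra.
(* The point of the radius at distance A / 4 <= 1 from [p] is near enough for the two orders to
   conflict. *)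
have := H ((1 - A / 4)%:C * p); rewrite nmM hp mulr1 nm_real ger0_norm; last by lra.
have -> : p - (1 - A / 4)%:C * p = (A / 4)%:C * p by rewrite rmorphB rmorph1; ring.
rewrite nmM hp mulr1 nm_real ger0_norm; last by lra.
have lt1 : 1 - A / 4 < 1 by lra.
move=> /(_ lt1); have := sqr_ge0 (nm z0); move: (nm z0 ^+ 2) => q *; nra.
Qed.

(** [L] is the multiplier of the cycle. For [x] other than [z0] the factor |B^(lk)(0) - x| stays
    away from 0 for large [l], so [y] tends to [p] geometrically. *)
Lemma backward_estimate : exists2 L : R, 1 < L & forall l x, nm x <= 1 ->
  exists y, [/\ nm y <= 1, iter (l * k) B y = x &
    L ^+ l * nm (y - p) ^+ 2 * nm (iter (l * k) B 0 - x) ^+ 2 <= nm (x - p) ^+ 2].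
Proof.
have [K [cK K0 KE]] := blaschke_kernel c1 a1.
exists (kap c a K k p); first exact: kap_gt1.
move=> l x hx; have lp : iter (l * k) B p = p.
  by elim: l => [|l IH] //; rewrite mulSn iterD IH.
have [y] := iter_backward d0 c1 a1 cK K0 KE hp lp hx.
by rewrite kapM// [nm (p - y)]nm_distC [nm (p - x)]nm_distC; exists y.
Qed.

Lemma backward_reach x (e : R) : nm x <= 1 -> x != z0 -> 0 < e ->
  exists n y, [/\ nm y <= 1, iter n B y = x & nm (y - p) < e].
Proof.
move=> hx xz e0; have [L L1 h] := backward_estimate.
have A0 : 0 < nm (z0 - x) / 2 by rewrite divr_gt0// nm_gt0 subr_eq0 eq_sym.
set A := nm _ / 2 in A0.
have n01 : nm (0 : C) < 1 by rewrite nm0.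
have [N hN] := wd_cvg n01 A0.
(* Here |x - p|^2 <= 4, and [A] will bound |B^(lk)(0) - x| from below. *)
have [N' hN'] := expr_unbounded (4 / (e ^+ 2 * A ^+ 2)) L1.
set l := maxn N N'; have [y [hy yx hyp]] := h l x hx.
exists (l * k)%N, y; split => //.
have hb : A <= nm (iter (l * k) B 0 - x).
  have := nm_triangle (iter (l * k) B 0) z0 x; rewrite [nm (z0 - iter _ _ _)]nm_distC.
  have := hN (l * k)%N; rewrite (leq_trans (leq_maxl N N'))// ?leq_pmulr//.
  by move=> /(_ isT); rewrite /A; lra.
have hxp : nm (x - p) ^+ 2 <= 4.
  have : nm (x - p) <= 2 by rewrite (le_trans (nmB _ _))// hp -[2]/(1 + 1) lerD2r.
  by have := nm_ge0 (x - p); move: (nm _) => *; nra.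
have hl := hN' l (leq_maxr _ _).
have eA : 0 < e ^+ 2 * A ^+ 2 by apply: mulr_gt0; apply: exprn_gt0.
rewrite ltr_pdivrMr// in hl.
have b2 : A ^+ 2 <= nm (iter (l * k) B 0 - x) ^+ 2.
  by rewrite ler_sqr// nnegrE ?nm_ge0// ltW.
rewrite -ltr_sqr ?nnegrE ?nm_ge0 ?(ltW e0)// ltNge; apply/negP => he.
have Ll0 : 0 < L ^+ l by rewrite exprn_gt0// (lt_trans _ L1).
have : L ^+ l * (e ^+ 2 * A ^+ 2) <=
    L ^+ l * nm (y - p) ^+ 2 * nm (iter (l * k) B 0 - x) ^+ 2.
  by rewrite -mulrA ler_pM2l// ler_pM// sqr_ge0.
by lra.
Qed.

Lemma backward_stay : exists n (e : R), [/\ (0 < n)%N, iter n B p = p, 0 < e &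
  forall x, nm x <= 1 -> nm (x - p) < e ->
    exists y, [/\ nm y <= 1, iter n B y = x & nm (y - p) <= nm (x - p)]].
Proof.
have [L L1 h] := backward_estimate.
(* One quarter of |z0 - p| is spent on |x - p| and one on |B^(lk)(0) - z0|, which leaves [A + A] for
   |B^(lk)(0) - x|. *)
have A0 : 0 < nm (z0 - p) / 4 by rewrite divr_gt0// nm_gt0 subr_eq0 eq_sym.
set A := nm _ / 4 in A0.
have n01 : nm (0 : C) < 1 by rewrite nm0.
have [N hN] := wd_cvg n01 A0.
have [N' hN'] := expr_unbounded ((A + A) ^- 2) L1.
set l := (maxn N N').+1.
exists (l * k)%N, A; split => //; first by rewrite muln_gt0 k0.
  by elim: l => [|n IH] //; rewrite mulSn iterD IH.
move=> x hx hxp; have [y [hy yx hyp]] := h l x hx; exists y; split => //.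
have hb : A + A <= nm (iter (l * k) B 0 - x).
  have := nm_triangle (iter (l * k) B 0) z0 p; rewrite [nm (z0 - iter _ _ _)]nm_distC.
  have := nm_triangle x (iter (l * k) B 0) p.
  have := hN (l * k)%N; rewrite (leq_trans (leq_maxl N N'))//; last first.
    by rewrite (leq_trans (leqnSn _))// leq_pmulr.
  by move=> /(_ isT); move: hxp; rewrite /A; lra.
have b2 : (A + A) ^+ 2 <= nm (iter (l * k) B 0 - x) ^+ 2.
  by rewrite ler_sqr ?nnegrE ?nm_ge0// ltW ?addr_gt0.
have hl := hN' l (leqW (leq_maxr _ _)).
have AA : 0 < (A + A) ^+ 2 by rewrite exprn_gt0// addr_gt0.
rewrite -[(A + A) ^- 2]mul1r ltr_pdivrMr// in hl.
rewrite -ler_sqr ?nnegrE ?nm_ge0//.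
apply: le_trans hyp; rewrite mulrAC mulrC ler_peMr ?sqr_ge0//.
apply: le_trans (ltW hl) _; rewrite ler_pM2l// exprn_gt0// (lt_trans _ L1)//.
Qed.

End Repelling.
End WolffDenjoy.


(** * Periodic points on the circle *)

Section CircleLift.
Variable R : realType.
Local Notation C := (R[i])^o.
Local Notation tau := (pi *+ 2 : R).

Definition cis (t : R) : C := cos t +i* sin t.

Lemma nm_cis t : nm (cis t) = 1.
Proof.
have : nm (cis t) ^+ 2 = 1 by rewrite nm_sq /= cos2Dsin2.
by move=> /eqP; rewrite sqrf_eq1 => /orP[/eqP//|/eqP h]; have := nm_ge0 (cis t); lra.
Qed.

Lemma cisD s t : cis (s + t) = cis s * cis t.
Proof. by rewrite /cis sinD cosD; congr Complex; ring. Qed.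

Lemma cis_period t n : cis (t + tau *+ n) = cis t.
Proof.
by rewrite /cis (periodicn (@cosD2pi R)) (periodicn (@sinD2pi R)).
Qed.

Lemma cis_inj s t : 0 < s < tau -> 0 < t < tau -> cis s = cis t -> s = t.
Proof.
wlog st : s t / s <= t.
  move=> h hs ht e; case: (leP s t) => [/h|/ltW/h] h'; first exact: h'.
  by rewrite (h' ht hs).
move=> /andP[s0 s1] /andP[t0 t1] [ec es].
have h : cos (t - s) = 1.
  by rewrite cosB ec es -!expr2 cos2Dsin2.
have /eqP : sin ((t - s) / 2) ^+ 2 = 0.
  have e2 : (t - s) / 2 *+ 2 = t - s by rewrite -mulr_natr mulfVK ?pnatr_eq0.
  have := cos_mulr2n ((t - s) / 2); rewrite e2 h.
  have := cos2Dsin2 ((t - s) / 2); move: (cos _ ^+ 2) (sin _ ^+ 2) => u v.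
  by rewrite -mulr_natr; lra.
rewrite sqrf_eq0 => /eqP hs; apply/eqP; rewrite eq_le st /= leNgt; apply/negP => lts.
have : 0 < sin ((t - s) / 2).
  by apply: sin_gt0_pi; move: s0 t1; rewrite -mulr_natr => s0 t1; apply/andP; split; lra.
by rewrite hs ltxx.
Qed.

Lemma cis_surj (z : C) : nm z = 1 -> exists t, cis t = z.
Proof.
case: z => x y hz; have := nm_sq (x +i* y); rewrite hz expr1n /= => h.
have x1 : -1 <= x <= 1.
  by have y2 := sqr_ge0 y; apply/andP; split; nra.
have hs := sin_acos x1; have hc : cos (acos x) = x by apply: acosK; rewrite in_itv.
have [y0|y0] := leP 0 y.
  exists (acos x); rewrite /cis hc hs; congr Complex.
  by rewrite (_ : 1 - x ^+ 2 = y ^+ 2) ?sqrtr_sqr ?ger0_norm//; lra.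
exists (- acos x); rewrite /cis cosN sinN hc hs; congr Complex.
by rewrite (_ : 1 - x ^+ 2 = y ^+ 2) ?sqrtr_sqr ?ltr0_norm ?opprK//; lra.
Qed.

(** [phi] is a lift of [f] to the universal cover of the circle and [n] is the degree, which yields
    fixed points by the intermediate value theorem. *)
Definition circle_lift (f : C -> C) (n : nat) := exists phi : R -> R,
  [/\ continuous phi, forall t, f (cis t) = cis (phi t) &
      forall t, phi (t + tau) = phi t + tau *+ n].

Lemma circle_lift_mul f g m n : circle_lift f m -> circle_lift g n ->
  circle_lift (fun z => f z * g z) (m + n).
Proof.
move=> [u [cu fu pu]] [v [cv gv pv]]; exists (fun t => u t + v t); split.
- by move=> t; apply: cvgD; [exact: cu|exact: cv].
- by move=> t; rewrite fu gv cisD.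
- by move=> t; rewrite pu pv mulrnDr addrACA.
Qed.

Lemma circle_lift_cst c : nm c = 1 -> circle_lift (fun=> c) 0.
Proof.
move=> /cis_surj[t <-]; exists (fun=> t); split => // s; first exact: cvg_cst.
by rewrite mulr0n addr0.
Qed.

(* On the circle the Moebius factor is z u / conj u with u = 1 - a / z in the right
   half plane, hence the arctangent. *)
Lemma circle_lift_mob a : nm a < 1 -> circle_lift (mob a) 1.
Proof.
move=> ha; pose ur t := 1 - (Re a * cos t + Im a * sin t).
pose ui t := Re a * sin t - Im a * cos t.
have ur0 t : 0 < ur t.
  rewrite subr_gt0; apply: le_lt_trans ha; apply: le_trans (ler_norm _) _.
  have := nm_Re (a * (cis t)^*); rewrite nmM nmJ nm_cis mulr1.
  by case: (a) => x y /=; rewrite mulrN opprK.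
exists (fun t => t + atan (ui t / ur t) *+ 2); split.
- move=> t; apply: cvgD; first exact: cvg_id.
  apply: cvgMn; apply: continuous_cvg; first exact: continuous_atan.
  have cc := @continuous_cos R t; have cs := @continuous_sin R t.
  apply: cvgM.
    by apply: cvgB; apply: cvgM => //; exact: cvg_cst.
  apply: cvgV; first by rewrite gt_eqF.
  apply: cvgB; first exact: cvg_cst.
  by apply: cvgD; apply: cvgM => //; exact: cvg_cst.
- move=> t; rewrite cisD; set v := ui t / ur t.
  have vE : ui t = v * ur t by rewrite mulfVK// gt_eqF.
  have cn0 : cos (atan v) != 0.
    by rewrite cos_atan invr_eq0 gt_eqF// sqrtr_gt0 ltr_wpDr ?sqr_ge0.
  have sv : sin (atan v) = v * cos (atan v).
    by rewrite -{2}(atanK v) /tan mulfVK.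
  have c2 : cos (atan v) ^+ 2 * (1 + v ^+ 2) = 1.
    by rewrite -[RHS](cos2Dsin2 (atan v)) sv; ring.
  apply: (mulIf (mobius_den_neq0 (_ : nm (cis t) <= 1) ha)); first by rewrite nm_cis.
  rewrite /mob divfK; last by rewrite mobius_den_neq0// nm_cis.
  rewrite mulr2n cisD /cis sv.
  have ct := cos2Dsin2 t; move: c2 ct vE; rewrite /ui /ur.
  case: (a) => x y; move: (cos (atan v)) (cos t) (sin t) => k e s /=.
  move=> hk hc hm; set r := 1 - (x * e + y * s) in hm.
  have -> : 1 - (x +i* y)^* * (e +i* s) = (r +i* (- (v * r)) : C).
    rewrite -hm /r (_ : Num.conj (x +i* y : C) = (x -i* y : C))//.
    by apply/eqP; rewrite eq_complex /=; apply/andP; split; apply/eqP; ring.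
  rewrite -mulrA (_ : _ * _ * (_ +i* _) = (r +i* (v * r) : C)); last first.
    rewrite -[in RHS](mul1r r) -hk; apply/eqP; rewrite eq_complex /=.
    by apply/andP; split; apply/eqP; ring.
  rewrite -hm /r; apply/eqP; rewrite eq_complex /=; apply/andP; split; apply/eqP.
    by rewrite -[X in e - X]mulr1 -[X in e - x * X]hc; ring.
  by rewrite -[X in s - X]mulr1 -[X in s - y * X]hc; ring.
- by move=> t; rewrite /ui /ur cosD2pi sinD2pi mulr1n addrAC.
Qed.

Lemma circle_lift_prod (I : eqType) (s : seq I) (f : I -> C -> C) :
  (forall i, circle_lift (f i) 1) ->
  circle_lift (fun z => \prod_(i <- s) f i z) (size s).
Proof.
move=> h; elim: s => [|i s IH] /=.
  rewrite (_ : (fun z => _) = fun=> 1); first by apply: circle_lift_cst; rewrite nm1.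
  by apply/funext => z; rewrite big_nil.
rewrite (_ : (fun z => _) = fun z => f i z * \prod_(j <- s) f j z).
  exact: (circle_lift_mul (h i) IH).
by apply/funext => z; rewrite big_cons.
Qed.

Lemma circle_lift_iter f n k : circle_lift f n -> circle_lift (iter k f) (n ^ k).
Proof.
move=> [phi [cphi fphi pphi]].
have pn t m : phi (t + tau *+ m) = phi t + tau *+ (m * n).
  elim: m => [|m IH]; first by rewrite mul0n !mulr0n !addr0.
  by rewrite mulrSr addrA pphi IH mulSn addnC mulrnDr addrA.
exists (iter k phi); split.
- elim: k => [|k IH] t; first exact: cvg_id.
  by apply: (@continuous_comp _ _ _ (iter k phi) phi); [exact: IH|exact: cphi].
- by move=> t; elim: k => [|k IH] //=; rewrite IH fphi.
- move=> t; elim: k => [|k IH]; first by rewrite expn0 mulr1n.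
  by rewrite /= IH pn expnSr.
Qed.

(** Over one period [phi t - t] gains [n - 1] full turns, so in the interior it takes more than
    [size F] multiples of 2 pi as values; each gives a fixed point, and [cis] is injective there. *)
Lemma circle_lift_fixed f n (F : seq C) : circle_lift f n -> (size F + 2 < n)%N ->
  exists p, [/\ nm p = 1, f p = p & p \notin F].
Proof.
move=> [phi0 [cphi0 fphi0 pphi0]] hn.
have tau0 : 0 < tau by rewrite mulrn_wgt0// pi_gt0.
have [phi [cphi fphi pphi phi_ge0]] : exists phi : R -> R, [/\ continuous phi,
    forall t, f (cis t) = cis (phi t), forall t, phi (t + tau) = phi t + tau *+ n &
    0 <= phi 0].
  (* Shifting the lift by full turns makes [phi 0] nonnegative, so that [Num.trunc] below is an
     integer part. *)
  exists (fun t => phi0 t + tau *+ (Num.trunc (- phi0 0 / tau)).+1); split.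
  - by move=> t; apply: cvgD; [exact: cphi0|exact: cvg_cst].
  - by move=> t; rewrite cis_period.
  - by move=> t; rewrite pphi0 addrAC.
  - rewrite -lerBlDl sub0r -mulr_natr mulrC -ler_pdivrMr// ltW//; exact: truncnS_gt.
pose g t := phi t - t; pose k0 := Num.trunc (g 0 / tau).
have cg : continuous g by move=> t; apply: cvgB; [exact: cphi|exact: cvg_id].
have g0 : 0 <= g 0 by rewrite /g subr0.
have gtau : g tau = g 0 + tau *+ n.-1.
  rewrite /g -[X in phi X - _]add0r pphi subr0 -addrA; congr (_ + _).
  by case: n hn {pphi pphi0} => // n _; rewrite mulrSr addrK.
have /andP[k01 k02] : k0%:R <= g 0 / tau < k0.+1%:R.
  by apply: truncn_itv; rewrite divr_ge0// ltW.
rewrite ler_pdivlMr// in k01; rewrite ltr_pdivrMr// in k02.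
(* The multiples [k0 + 1], ..., [k0 + size F + 1] of 2 pi lie strictly between [g 0] and [g tau];
   strictness keeps [t] off the endpoints, which represent the same point of the circle. *)
have /choice[th thP] : forall i : 'I_(size F).+1, exists t,
    0 < t < tau /\ g t = (k0 + i).+1%:R * tau.
  move=> i; have i0 : 0 <= (i : nat)%:R :> R by [].
  have v1 : g 0 < (k0 + i).+1%:R * tau.
    rewrite (lt_le_trans k02)// ler_wpM2r// ?(ltW tau0)// ler_nat ltnS leq_addr//.
  have v2 : (k0 + i).+1%:R * tau < g tau.
    rewrite gtau -[_ *+ n.-1]mulr_natl -addnS natrD mulrDl ler_ltD// ltr_pM2r// ltr_nat.
    by have := ltn_ord i; move: hn; case: n {pphi pphi0 gtau} => // n; lia.
  have [||t] := @IVT R g 0 tau ((k0 + i).+1%:R * tau) (ltW tau0).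
  - exact: continuous_subspaceT.
  - have le0 : g 0 <= g tau by rewrite ltW// (lt_trans v1).
    by rewrite (min_l le0) (max_r le0) !ltW.
  rewrite in_itv /= => /andP[t0 t1] gt; exists t; split => //.
  rewrite !lt_neqAle t0 t1 !andbT; apply/andP; split; apply/eqP => h.
    by move: v1; rewrite -gt -h ltxx.
  by move: v2; rewrite -gt h ltxx.
have inj : injective (fun i => cis (th i)).
  move=> i j /(cis_inj (thP i).1 (thP j).1) h; apply/val_inj => /=.
  have := (thP j).2; rewrite -h (thP i).2 => /(mulIf (lt0r_neq0 tau0))/eqP.
  by rewrite eqr_nat eqSS eqn_add2l => /eqP.
have fixed i : f (cis (th i)) = cis (th i).
  rewrite fphi -[phi _](subrK (th i)) -/(g _) (thP i).2 mulr_natl addrC.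
  exact: cis_period.
have [i hi] : exists i, cis (th i) \notin F.
  apply: contrapT => h.
  have U : uniq (map (fun i => cis (th i)) (enum 'I_(size F).+1)).
    by rewrite map_inj_uniq ?enum_uniq.
  have S : {subset map (fun i => cis (th i)) (enum 'I_(size F).+1) <= F}.
    move=> z /mapP[i _ ->]; apply/negPn/negP => hi; apply: h; exists i; exact: hi.
  by have := uniq_leq_size U S; rewrite size_map size_enum_ord ltnn.
by exists (cis (th i)); split => //; exact: nm_cis.
Qed.

End CircleLift.

(** The iterate of order n = size F + 2 has degree d^n >= 2^n > n, hence a fixed point outside [F].
    With the cycles already chosen as [F], this yields a new one. *)
Lemma blaschke_periodic (R : realType) (d : nat) (c : (R[i])^o) (a : 'I_d -> (R[i])^o)
    (F : seq (R[i])^o) :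
  (2 <= d)%N -> nm c = 1 -> (forall j, nm (a j) < 1) ->
  exists p n, [/\ nm p = 1, (0 < n)%N, iter n (blaschke c a) p = p & p \notin F].
Proof.
move=> d2 c1 a1; have L : circle_lift (blaschke c a) d.
  rewrite -[d in circle_lift _ d]add0n; apply: circle_lift_mul; first exact: circle_lift_cst.
  have := @circle_lift_prod R 'I_d (index_enum 'I_d) (fun j => mob (a j)).
  by rewrite [index_enum _]unlock -enumT size_enum_ord; apply => j; exact: circle_lift_mob.
have [|p [h1 h2 h3]] := circle_lift_fixed (F := F) (circle_lift_iter (size F + 2) L).
  by rewrite (leq_trans (ltn_expl _ (ltnSn 1)))// leq_exp2r// addn2.
by exists p, (size F + 2)%N; split => //; rewrite addn2.
Qed.


(** * Approximate eigenvectors *)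

Section Cocycle.
Variables (R : realType) (B w : (R[i])^o -> (R[i])^o).
Local Notation C := (R[i])^o.
Hypothesis BD : forall z, nm z <= 1 -> nm (B z) <= 1.
Hypothesis BU : forall z, nm z < 1 -> nm (B z) < 1.
Hypothesis BA : in_disc_algebra B.
Hypothesis wA : in_disc_algebra w.

(** The weight of the [k]-th power: [T^k f] is [cocycle k] times [f] after [iter k B]. *)
Definition cocycle k z : C := \prod_(i < k) w (iter i B z).

Lemma cocycle0 z : cocycle 0 z = 1.
Proof. by rewrite /cocycle big_ord0. Qed.

Lemma cocycle1 z : cocycle 1 z = w z.
Proof. by rewrite /cocycle big_ord1. Qed.

Lemma cocycleD m n z : cocycle (m + n) z = cocycle m z * cocycle n (iter m B z).
Proof.
rewrite /cocycle big_split_ord /=; congr (_ * _).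
by apply: eq_bigr => i _; rewrite addnC iterD.
Qed.

Lemma cocycleS k z : cocycle k.+1 z = w z * cocycle k (B z).
Proof. by rewrite -add1n cocycleD cocycle1. Qed.

Lemma disc_algebra_cocycle k : in_disc_algebra (cocycle k).
Proof.
apply: (@disc_algebra_prod R _ (index_enum 'I_k) (fun i z => w (iter i B z))) => i _.
have hD z : nm z <= 1 -> nm (iter i B z) <= 1 by exact: iter_disc.
have hU z : nm z < 1 -> nm (iter i B z) < 1.
  by move=> hz; elim: (nat_of_ord i) => [|n IH] //=; exact: BU.
exact: (disc_algebra_comp hD hU (disc_algebra_iter i BD BU BA) wA).
Qed.

Lemma contD_cocycle k : {within @Dset R, continuous (fun z => nm (cocycle k z))}.
Proof. by apply: contD_nm; exact: (disc_algebra_cocycle k).2. Qed.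

Hypothesis Blift : forall k y (e : R), nm y <= 1 -> 0 < e ->
  exists2 dl : R, 0 < dl & forall x, nm x <= 1 -> nm (x - iter k B y) < dl ->
    exists y', [/\ nm y' <= 1, iter k B y' = x & nm (y' - y) < e].

Local Notation T := (fun (f : C -> C) z => w z * f (B z)).

(** Rests on [T^(k+1) - mu^(k+1) = T (T^k - mu^k) + mu^k (T - mu)]. *)
Let approx_eigen_iter mu (f : nat -> C -> C) :
  supnorm_cvg (fun n z => T (f n) z - mu * f n z) (fun=> 0) ->
  forall k (e : R), 0 < e -> exists N, forall n, (N <= n)%N -> forall z, nm z <= 1 ->
    nm (cocycle k z * f n (iter k B z) - mu ^+ k * f n z) <= e.
Proof.
move=> hf.
have [z1 z1D hW] := disc_max (contD_nm wA.2).
set W := nm (w z1) in hW.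
elim=> [|k IH] e e0.
  by exists 0%N => n _ z hz; rewrite cocycle0 expr0 !mul1r subrr nm0 ltW.
have W0 : 0 <= W by exact: nm_ge0.
have e1 : 0 < e / 2 / (W + 1) by rewrite !divr_gt0// ltr_wpDl.
have e2 : 0 < e / 2 / (nm mu ^+ k + 1).
  by rewrite !divr_gt0// ltr_wpDl// exprn_ge0// nm_ge0.
have [N1 hN1] := IH _ e1.
have [|N2 hN2] := hf (e / 2 / (nm mu ^+ k + 1))%:C; first by rewrite ltcR.
exists (maxn N1 N2) => n hn z hz.
have h1 := hN1 n (leq_trans (leq_maxl _ _) hn) _ (BD hz).
have h2 : nm (w z * f n (B z) - mu * f n z) <= e / 2 / (nm mu ^+ k + 1).
  have := hN2 n (leq_trans (leq_maxr _ _) hn) z; rewrite normC_le1 normC_le subr0.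
  exact.
have -> : cocycle k.+1 z * f n (iter k.+1 B z) - mu ^+ k.+1 * f n z =
  w z * (cocycle k (B z) * f n (iter k B (B z)) - mu ^+ k * f n (B z)) +
  mu ^+ k * (w z * f n (B z) - mu * f n z).
  by rewrite cocycleS iterSr exprS; ring.
apply: le_trans (nmD _ _) _; rewrite !nmM nmX (_ : e = e / 2 + e / 2); last by lra.
have aux (u : R) : 0 <= u -> u * (e / 2 / (u + 1)) <= e / 2.
  move=> u0; rewrite mulrA ler_pdivrMr ?ltr_wpDl// mulrC.
  by rewrite ler_wpM2l ?divr_ge0 ?(ltW e0)// lerDl.
apply: lerD.
  apply: le_trans (ler_pM (nm_ge0 _) (nm_ge0 _) (hW _ hz) h1) _.
  exact: aux.
have m0 : 0 <= nm mu ^+ k by rewrite exprn_ge0// nm_ge0.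
by apply: le_trans (ler_wpM2l m0 h2) _; exact: aux.
Qed.

(* x is a cluster point of points where the approximate eigenvectors are almost of
   maximal modulus. *)
Lemma usf_point mu : usf_spectrum T mu -> exists2 x, nm x <= 1 &
  (forall k, nm mu ^+ k <= nm (cocycle k x)) /\
  (forall k y, nm y <= 1 -> iter k B y = x -> nm (cocycle k y) <= nm mu ^+ k).
Proof.
move=> [f [fA [f1 [fT _]]]].
have f_le1 n z : nm z <= 1 -> nm (f n z) <= 1.
  by rewrite -!normC_le1; exact: (f1 n).1.
have /choice[u uP] : forall n, exists z, nm z <= 1 /\ 1 - n.+1%:R^-1 < nm (f n z).
  move=> n; have [|z [zD hz]] := (f1 n).2 (n.+1%:R^-1)%:C.
    by rewrite ltcR invr_gt0.
  exists z; split; first by rewrite -normC_le1.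
  by move: hz; rewrite normCE -[1]/(1%:C) -rmorphB ltcR.
have uD n : nm (u n) <= 1 by exact: (uP n).1.
have [x xD xc] := disc_cluster uD.
have small (e : R) : 0 < e -> exists N, forall n, (N <= n)%N -> 1 - e <= nm (f n (u n)).
  move=> e0; exists (Num.trunc e^-1) => n hn; rewrite (le_trans _ (ltW (uP n).2))//.
  by rewrite lerD2l lerN2 ltW// invf_plt ?posrE// -truncn_le_nat.
have fTk := approx_eigen_iter fT.
exists x => //; split => [k|k y yD yx].
  rewrite leNgt; apply/negP => h.
  set m := nm mu ^+ k in h; set g := nm (cocycle k x) in h.
  have m0 : 0 <= m by rewrite exprn_ge0// nm_ge0.
  (* At [u n] the eigenvalue relation gives [m (1 - e) <= |cocycle k (u n)| + e / 2]; this [e] makes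
     [m - m e - e / 2] exceed [g]. *)
  pose e := (m - g) / (2 * (m + 1)).
  have e0 : 0 < e by rewrite divr_gt0 ?subr_gt0// mulr_gt0// ltr_wpDl.
  have eE : e * (2 * (m + 1)) = m - g by rewrite /e mulfVK// gt_eqF// mulr_gt0// ltr_wpDl.
  have e2 : 0 < e / 2 by rewrite divr_gt0.
  have [N1 hN1] := small _ e0; have [N2 hN2] := fTk k _ e2.
  have : m - m * e - e / 2 <= g.
    apply: (@cluster_le R u x (fun=> m - m * e - e / 2) (fun z => nm (cocycle k z))
      (maxn N1 N2)) => //; [exact: contD_cst|exact: contD_cocycle|move=> n hn].
    have h1 := hN1 n (leq_trans (leq_maxl _ _) hn).
    have h2 := hN2 n (leq_trans (leq_maxr _ _) hn) _ (uD n).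
    have h3 : nm (mu ^+ k * f n (u n)) <= nm (cocycle k (u n)) + e / 2.
      apply: le_trans (_ : _ <= nm (cocycle k (u n) * f n (iter k B (u n))) + e / 2) _.
        have := nm_triangle (cocycle k (u n) * f n (iter k B (u n)))
          (mu ^+ k * f n (u n)) 0.
        by rewrite !subr0 nm_distC; move: h2; lra.
      rewrite lerD2r nmM ler_piMr ?nm_ge0// f_le1//; exact: iter_disc.
    move: h3; rewrite nmM nmX -/m; move: (nm (f n _)) (nm (cocycle _ _)) h1 => v q *.
    by nra.
  by move: m0 e0 eE; move: (e) => t *; nra.
rewrite leNgt; apply/negP => h.
set m := nm mu ^+ k in h; set g := nm (cocycle k y) in h.
have m0 : 0 <= m by rewrite exprn_ge0// nm_ge0.
(* Chosen so that [(g - e) (1 - e) > m + e]. *)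
pose e := (g - m) / (2 * (g + 2)).
have g0 : 0 < g by exact: le_lt_trans h.
have e0 : 0 < e by rewrite divr_gt0 ?subr_gt0// mulr_gt0// addr_gt0.
have eE : e * (2 * (g + 2)) = g - m by rewrite /e mulfVK// gt_eqF// mulr_gt0// addr_gt0.
have e1 : e < 1 by move: eE; move: (e) e0 => t *; nra.
have [N1 hN1] := small _ e0; have [N2 hN2] := fTk k _ e0.
have /contD_RP/(_ _ yD _ e0)[d1 d10 hd1] := @contD_cocycle k.
(* The [k]-th iterate is open, so some [y'] near [y] is mapped exactly onto [u n], where the
   eigenvector has modulus almost 1. *)
have [d2 d20 hd2] := Blift k yD d10; rewrite yx in hd2.
have [n hn xn] := xc _ (maxn N1 N2) d20.
have [y' [y'D y'u y'y]] := hd2 _ (uD n) xn.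
have h1 := hN1 n (leq_trans (leq_maxl _ _) hn).
have h2 := hN2 n (leq_trans (leq_maxr _ _) hn) _ y'D.
have h3 : nm (cocycle k y' * f n (u n)) <= m + e.
  apply: le_trans (_ : _ <= nm (mu ^+ k * f n y') + e) _.
    have := nm_triangle (mu ^+ k * f n y') (cocycle k y' * f n (u n)) 0.
    by move: h2; rewrite y'u !subr0; lra.
  by rewrite lerD2r nmM nmX ler_piMr ?f_le1.
have := hd1 _ y'D y'y; rewrite ltr_norml => /andP[h4 _].
move: h3; rewrite nmM; move: (nm (f n _)) h1 h4 => v h1 h4.
have := nm_ge0 (cocycle k y'); move: (nm (cocycle k y')) h4 => q h4 q0 h3.
have : q * (1 - e) <= m + e by apply: le_trans h3; rewrite ler_wpM2l.
move: h4; rewrite -/g => h4 h5.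
by move: (e) e0 eE e1 h4 h5 => t *; nra.
Qed.

End Cocycle.


(** * Peak functions and membership in the spectrum *)

Lemma geometric_small (R : realType) (A t e : R) : 0 <= t -> t < 1 -> 0 < e ->
  exists M0, forall M, (M0 <= M)%N -> A * t ^+ M <= e.
Proof.
move=> t0 t1 e0; have [->|tn0] := eqVneq t 0.
  by exists 1%N => -[|M] // _; rewrite expr0n mulr0 ltW.
have tp : 0 < t by rewrite lt0r tn0.
have [|N hN] := @expr_unbounded R t^-1 (A / e); first by rewrite invf_gt1.
exists N => M /hN; rewrite exprVn ltr_pdivrMr// mulrC ltr_pdivlMr ?exprn_gt0//.
exact: ltW.
Qed.

(** As [M] grows only the terms with [t k = 1] survive; for peak functions these are the times at
    which the orbit is at the peak. *)
Lemma sum_geometric_limit (R : realType) (I : eqType) (s : seq I) (A t : I -> R)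
    (e : R) : (forall k, 0 <= t k <= 1) -> 0 < e ->
  exists M0, forall M, (M0 <= M)%N ->
    \sum_(k <- s) A k * t k ^+ M <= \sum_(k <- s | t k == 1) A k + e.
Proof.
move=> ht; elim: s e => [|k s IH] e e0.
  by exists 0%N => M _; rewrite !big_nil add0r ltW.
have e2 : 0 < e / 2 by rewrite divr_gt0.
have [M1 h1] := IH _ e2; have [tk|tk] := eqVneq (t k) 1.
  exists M1 => M hM; rewrite !big_cons tk eqxx expr1n mulr1 -addrA lerD2l.
  by apply: le_trans (h1 _ hM) _; rewrite lerD2l; lra.
have /andP[t0 t1] := ht k.
have [|M2 h2] := geometric_small (A k) t0 _ e2; first by rewrite lt_neqAle tk.
exists (maxn M1 M2) => M; rewrite geq_max => /andP[hM1 hM2].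
rewrite !big_cons (negbTE tk); have := h1 _ hM1; have := h2 _ hM2; lra.
Qed.

Lemma minn_tent_step k n :
  (minn k.+1 (n + n - k.+1) <= (minn k (n + n - k)).+1)%N /\
  (minn k (n + n - k) <= (minn k.+1 (n + n - k.+1)).+1)%N.
Proof. by split; lia. Qed.

Section Peak.
Variable R : realType.
Local Notation C := (R[i])^o.
Implicit Types x z : C.

Definition peak x z : C := (1 + x^* * z) / 2.

Lemma disc_algebra_peak x : in_disc_algebra (peak x).
Proof.
apply: disc_algebra_mul; last exact: disc_algebra_cst.
apply: disc_algebra_add; first exact: disc_algebra_cst.
by apply: disc_algebra_mul; [exact: disc_algebra_cst|exact: disc_algebra_id].
Qed.

Lemma nm2 : nm (2 : C) = 2.
Proof. by rewrite -[2 : C](rmorph_nat (real_complex R)) nm_real normr_nat. Qed.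

Lemma nm_peak_le1 x z : nm x = 1 -> nm z <= 1 -> nm (peak x z) <= 1.
Proof.
move=> hx hz; rewrite /peak nmM nmV nm2 ler_pdivrMr// mul1r.
by apply: le_trans (nmD _ _) _; rewrite nm1 nmM nmJ hx mul1r -[2]/(1 + 1) lerD2l.
Qed.

Lemma mulJ_circle x : nm x = 1 -> x^* * x = 1.
Proof.
case: x => u v hx; have := nm_sq (u +i* v); rewrite hx expr1n /= => h.
rewrite (_ : Num.conj (u +i* v : C) = (u -i* v : C))//.
by apply/eqP; rewrite eq_complex /=; apply/andP; split; apply/eqP; [rewrite h|]; ring.
Qed.

Lemma peak_id x : nm x = 1 -> peak x x = 1.
Proof. by move=> hx; rewrite /peak mulJ_circle// -[1 + 1]/(2) divff// pnatr_eq0. Qed.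

Lemma nm_peak_eq1 x z : nm x = 1 -> nm z <= 1 -> nm (peak x z) = 1 -> z = x.
Proof.
move=> hx hz; rewrite /peak nmM nmV nm2 => h.
have {h} : nm (1 + x^* * z) = 2 by lra.
have : nm (x^* * z) <= 1 by rewrite nmM nmJ hx mul1r.
move=> h1 h2; suff e1 : x^* * z = 1.
  by rewrite -[z]mul1r -(mulJ_circle hx) [x^* * x]mulrC -mulrA e1 mulr1.
case: (x^* * z) h1 h2 => u v; rewrite nm_le1_sq nm_sq /= => h1 h2.
have := nm_sq (1 + (u +i* v : C)); rewrite h2 /= => h3.
have u1 : u = 1 by nra.
have v0 : v = 0 by apply/eqP; rewrite -sqrf_eq0 eq_le sqr_ge0 andbT; nra.
by rewrite u1 v0.
Qed.

End Peak.

Section LowerBound.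
Variables (R : realType) (B w : (R[i])^o -> (R[i])^o).
Local Notation C := (R[i])^o.
Hypothesis BD : forall z, nm z <= 1 -> nm (B z) <= 1.
Hypothesis BU : forall z, nm z < 1 -> nm (B z) < 1.
Hypothesis BA : in_disc_algebra B.
Hypothesis wA : in_disc_algebra w.
Hypothesis Blift : forall k y (e : R), nm y <= 1 -> 0 < e ->
  exists2 dl : R, 0 < dl & forall x, nm x <= 1 -> nm (x - iter k B y) < dl ->
    exists y', [/\ nm y' <= 1, iter k B y' = x & nm (y' - y) < e].

Local Notation T := (fun (f : C -> C) z => w z * f (B z)).
Local Notation cocycle := (cocycle B w).

(* The smallness on the inner discs excludes convergent subsequences. *)
Lemma usf_of_approx mu :
  (forall e : R, 0 < e -> exists f : C -> C, [/\ in_disc_algebra f,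
     exists2 z, nm z <= 1 & 1 <= nm (f z),
     forall z, nm z <= 1 -> nm (T f z - mu * f z) <= e &
     forall z, nm z <= 1 - e -> nm (f z) <= e]) ->
  usf_spectrum T mu.
Proof.
move=> H; pose e (n : nat) : R := n.+1%:R^-1.
have e0 n : 0 < e n by rewrite invr_gt0.
have e_small (r : R) : 0 < r -> exists N, forall n, (N <= n)%N -> e n < r.
  move=> r0; exists (Num.trunc r^-1) => n hn.
  by rewrite /e invf_plt ?posrE// -truncn_le_nat.
have /choice[x xP] : forall n, exists x : C -> C, [/\ in_disc_algebra x,
   (forall z, nm z <= 1 -> nm (x z) <= 1) /\ exists2 z, nm z <= 1 & nm (x z) = 1,
   forall z, nm z <= 1 -> nm (T x z - mu * x z) <= e n &
   forall z, nm z <= 1 - e n -> nm (x z) <= e n].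
  move=> n; have [f [fA [z1 z1D fz1] fT fs]] := H _ (e0 n).
  (* The maximum [M] is at least 1, so dividing by it normalises [f] without increasing the two
     errors. *)
  have [z zD hz] := disc_max (contD_nm fA.2); set M := nm (f z) in hz.
  have M1 : 1 <= M by rewrite (le_trans fz1)// hz.
  have M0 : 0 < M by exact: lt_le_trans M1.
  have Mi : nm (M^-1)%:C = M^-1 by rewrite nm_real gtr0_norm// invr_gt0.
  have sc (v r : R) : 0 <= r -> v <= r -> M^-1 * v <= r.
    by move=> r0 vr; rewrite mulrC ler_pdivrMr// (le_trans vr)// ler_peMr.
  exists (fun z => (M^-1)%:C * f z); split.
  - exact: (disc_algebra_mul (disc_algebra_cst _) fA).
  - split; last by exists z => //; rewrite nmM Mi mulVf// gt_eqF.
    by move=> u uD; rewrite nmM Mi mulrC ler_pdivrMr// mul1r hz.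
  - move=> u uD; rewrite (_ : _ - _ = (M^-1)%:C * (T f u - mu * f u)); last by ring.
    by rewrite nmM Mi sc ?(ltW (e0 n))// fT.
  - by move=> u uD; rewrite nmM Mi sc ?(ltW (e0 n))// fs.
exists x; split; first by move=> n; have [] := xP n.
split.
  move=> n; have [_ [h1 [z zD hz]] _ _] := xP n; split.
    by move=> u; rewrite !normC_le1; exact: h1.
  move=> r r0; exists z; rewrite normC_le1 zD; split => //.
  by rewrite normCE hz ltrBlDr ltrDl.
split.
  move=> r /posC_real[q q0 ->]; have [N hN] := e_small _ q0.
  exists N => n hn z; rewrite normC_le1 normC_le subr0 => zD.
  by have [_ _ h _] := xP n; rewrite (le_trans (h _ zD))// ltW// hN.
move=> [phi [phiS [g [gA gx]]]].
have phin n : (n <= phi n)%N.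
  by elim: n => // n IH; exact: leq_ltn_trans IH (phiS n).
have gx' (r : R) : 0 < r -> exists N, forall n, (N <= n)%N -> forall z, nm z <= 1 ->
    nm (x (phi n) z - g z) <= r.
  move=> r0; have [|N hN] := gx r%:C; first by rewrite ltcR.
  by exists N => n hn z zD; rewrite -normC_le; apply: hN; rewrite ?normC_le1.
(* A uniform limit vanishes inside, hence on the closed disc, which contradicts norm 1 of the
   [x n]. *)
have g0 z : nm z < 1 -> nm (g z) <= 0.
  move=> hz; rewrite leNgt; apply/negP => gz.
  have g2 : 0 < nm (g z) / 2 by rewrite divr_gt0.
  have hz1 : 0 < 1 - nm z by rewrite subr_gt0.
  have [N1 h1] := gx' _ g2; have [N2 h2] := e_small _ g2; have [N3 h3] := e_small _ hz1.
  pose n := maxn N1 (maxn N2 N3).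
  have a1 := h1 n (leq_maxl _ _) z (ltW hz).
  have l2 : (N2 <= phi n)%N.
    by rewrite (leq_trans _ (phin n))// (leq_trans _ (leq_maxr _ _))// leq_maxl.
  have l3 : (N3 <= phi n)%N.
    by rewrite (leq_trans _ (phin n))// (leq_trans _ (leq_maxr _ _))// leq_maxr.
  have [_ _ _ h4] := xP (phi n).
  have a4 := h4 z; have a2 := h2 _ l2; have a3 := h3 _ l3.
  have {}a4 : nm (x (phi n) z) <= e (phi n) by apply: a4; lra.
  have := nm_triangle (x (phi n) z) (g z) 0; rewrite !subr0 nm_distC.
  by lra.
have gD z : nm z <= 1 -> nm (g z) <= 0.
  apply: (@disc_interior_le R (fun z => nm (g z)) (fun=> 0)) => //.
    by apply: contD_nm; exact: gA.2.
  exact: contD_cst.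
have h2 : 0 < 2^-1 :> R by [].
have [N hN] := gx' _ h2.
have [_ [_ [z zD hz]] _ _] := xP (phi N).
have := hN N (leqnn _) z zD; have := nm_triangle (g z) (x (phi N) z) 0.
rewrite !subr0 hz; have := gD z zD; lra.
Qed.

Variables (mu p : C).
Hypothesis hp : nm p = 1.
Hypothesis cocycle_le : forall k y, nm y <= 1 -> iter k B y = p ->
  nm (cocycle k y) <= nm mu ^+ k.
Hypothesis cocycle_eq : forall k, exists y,
  [/\ nm y <= 1, iter k B y = p & nm (cocycle k y) = nm mu ^+ k].
Hypothesis nonperiodic : forall e : R, 0 < e -> exists x,
  [/\ nm x = 1, nm (x - p) < e & forall k, (0 < k)%N -> iter k B x != x].

Let iterD n z : nm z <= 1 -> nm (iter n B z) <= 1.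
Proof. exact: iter_disc. Qed.

(** Carries [cocycle_le] from [p] to nearby points, with a factor 2 and for [j <= k]. Otherwise
    offending preimages would cluster at a preimage [z] of [p] with [|cocycle j z| >= 2 |mu|^j]. *)
Let near_cocycle_le k : nm mu != 0 -> exists2 dl : R, 0 < dl & forall j x y,
  (j <= k)%N -> nm x <= 1 -> nm (x - p) < dl -> nm y <= 1 -> iter j B y = x ->
  nm (cocycle j y) <= 2 * nm mu ^+ j.
Proof.
move=> mu0; have mp : 0 < nm mu by rewrite lt0r mu0 nm_ge0.
have one j : exists2 dl : R, 0 < dl & forall x y, nm x <= 1 -> nm (x - p) < dl ->
    nm y <= 1 -> iter j B y = x -> nm (cocycle j y) <= 2 * nm mu ^+ j.
  apply: contrapT => hn.
  have /choice[y yP] : forall n : nat, exists y, [/\ nm y <= 1,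
      nm (iter j B y - p) < n.+1%:R^-1 & 2 * nm mu ^+ j < nm (cocycle j y)].
    move=> n; apply: contrapT => hy; apply: hn; exists n.+1%:R^-1.
      by rewrite invr_gt0.
    move=> x y xD xp yD yx; rewrite leNgt; apply/negP => hc; apply: hy.
    by exists y; rewrite yx.
  have yD n : nm (y n) <= 1 by have [] := yP n.
  have [z zD zc] := disc_cluster yD.
  have cB : {within @Dset R, continuous (iter j B)}.
    by apply: contD_iter => //; exact: BA.2.
  have zp : iter j B z = p.
    apply/eqP; rewrite -subr_eq0 -nm_eq0 eq_le nm_ge0 andbT leNgt; apply/negP => e0.
    have e2 : 0 < nm (iter j B z - p) / 2 by rewrite divr_gt0.
    set e := nm _ / 2 in e2.
    have : nm (iter j B z - p) <= e.
      apply: (@cluster_le R y z (fun z => nm (iter j B z - p)) (fun=> e)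
        (Num.trunc e^-1)) => //.
      - by apply: contD_nm; apply: (contD_add cB); exact: contD_cst.
      - exact: contD_cst.
      - move=> n hn'; have [_ /ltW h _] := yP n; rewrite (le_trans h)// ltW//.
        by rewrite invf_plt ?posrE// -truncn_le_nat.
    by rewrite /e; move: e0; lra.
  have h1 : 2 * nm mu ^+ j <= nm (cocycle j z).
    apply: (@cluster_le R y z (fun=> 2 * nm mu ^+ j) (fun z => nm (cocycle j z)) 0%N) => //.
    - exact: contD_cst.
    - exact: contD_cocycle.
    - by move=> n _; have [_ _ /ltW] := yP n.
  have := cocycle_le zD zp; have : 0 < nm mu ^+ j by rewrite exprn_gt0.
  by move: h1; lra.
elim: k => [|k [d1 d10 h1]].
  have [d1 d10 h1] := one 0%N; exists d1 => // j x y; rewrite leqn0 => /eqP->.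
  exact: h1.
have [d2 d20 h2] := one k.+1; exists (Num.min d1 d2); first by rewrite lt_min d10.
move=> j x y hj xD; rewrite lt_min => /andP[x1 x2].
move: hj; rewrite leq_eqVlt => /orP[/eqP->|hj]; [exact: h2|exact: h1].
Qed.

(** Openness of the iterate moves the extremal preimage of [p] to one of [x]; continuity of the
    cocycle costs a factor 2. *)
Let near_cocycle_ge k : nm mu != 0 -> exists2 dl : R, 0 < dl & forall x,
  nm x <= 1 -> nm (x - p) < dl ->
  exists y, [/\ nm y <= 1, iter k B y = x & nm mu ^+ k / 2 <= nm (cocycle k y)].
Proof.
move=> mu0; have mp : 0 < nm mu ^+ k by rewrite exprn_gt0// lt0r mu0 nm_ge0.
have [y [yD yp yE]] := cocycle_eq k.
have m2 : 0 < nm mu ^+ k / 2 by rewrite divr_gt0.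
have /contD_RP/(_ _ yD _ m2)[d1 d10 h1] := @contD_cocycle R B w BD BU BA wA k.
have [d2 d20 h2] := Blift k yD d10; exists d2 => // x xD xp.
have [|y' [y'D y'x y'y]] := h2 x xD; first by rewrite yp.
exists y'; split => //; have := h1 _ y'D y'y; rewrite yE ltr_norml => /andP[h _].
by move: h; lra.
Qed.

(** Majorant of the modulus of a sum of multiples of T^k g, [k < K], with coefficients bounded by
    [A k], where g is the [M]-th power of the peak function at [x]. *)
Definition peak_sum (A : nat -> R) K x M z : R :=
  \sum_(k < K) A k * nm (cocycle k z) * nm (peak x (iter k B z)) ^+ M.

(** For fixed [z] the sum decreases with [M] to the terms whose [k] satisfies B^k(z) = x, since the
    peak function has modulus 1 at [x] only. [disc_dini] makes this uniform; scaling by [r] adapts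
    it to the disc of radius [r]. *)
Lemma peak_sum_dini (A : nat -> R) K x (r c : R) : nm x = 1 -> (forall k, 0 <= A k) -> 0 < r <= 1 ->
  (forall z, nm z <= r ->
    \sum_(k < K | iter k B z == x) A k * nm (cocycle k z) < c) ->
  exists M0, forall M z, (M0 <= M)%N -> nm z <= r -> peak_sum A K x M z < c.
Proof.
move=> hx A0 /andP[r0 r1] h.
have rD z : nm z <= 1 -> nm (r%:C * z) <= r.
  by move=> zD; rewrite nmM nm_real gtr0_norm// ler_piMr// ltW.
have rD1 z : nm z <= 1 -> nm (r%:C * z) <= 1.
  by move=> zD; rewrite (le_trans (rD _ zD)).
have cr : {within @Dset R, continuous (fun z : C => r%:C * z : C)}.
  by apply: contD_mul; [exact: contD_cst|exact: contD_id].
have hpk k z : nm z <= 1 -> 0 <= nm (peak x (iter k B z)) <= 1.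
  by move=> zD; rewrite nm_ge0 nm_peak_le1// iterD.
have [M z|M z zD|z zD|M0 hM0] := @disc_dini R (fun M z => peak_sum A K x M (r%:C * z)) c.
- suff cs : {within @Dset R, continuous (fun z => peak_sum A K x M z)}.
    exact: (contD_comp rD1 cr cs).
  apply: contD_sumR => k _; apply: contD_mulR.
    by apply: contD_mulR; [exact: contD_cst|exact: contD_cocycle].
  have cpk : {within @Dset R, continuous (fun z => nm (peak x (iter k B z)))}.
    apply: contD_nm; apply: (@contD_comp R C (iter k B) (peak x)).
    - by move=> u; exact: iterD.
    - exact: (contD_iter BD BA.2).
    - exact: (disc_algebra_peak x).2.
  elim: (M) => [|m IH].
    rewrite (_ : (fun z => _) = fun=> 1); first exact: contD_cst.
    by apply/funext => u; rewrite expr0.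
  under eq_fun do rewrite exprS; exact: (contD_mulR cpk IH).
- apply: ler_sum => k _; have /andP[t0 t1] := hpk k _ (rD1 _ zD).
  by rewrite ler_wpM2l ?mulr_ge0 ?nm_ge0// exprS ler_piMl// exprn_ge0.
- have hz := h _ (rD _ zD); set s := \sum_(_ < _ | _) _ in hz.
  have g0 : 0 < (c - s) / 2 by rewrite divr_gt0// subr_gt0.
  have [|M hM] := @sum_geometric_limit R 'I_K (index_enum 'I_K)
     (fun k => A k * nm (cocycle k (r%:C * z)))
     (fun k => nm (peak x (iter k B (r%:C * z)))) _ _ g0.
    by move=> k; exact: (hpk _ _ (rD1 _ zD)).
  exists M; apply: le_lt_trans (hM M (leqnn _)) _.
  rewrite (_ : \sum_(k < K | _) _ = s); first by move: hz; lra.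
  apply: eq_bigl => k; apply/eqP/eqP => [|->]; last by rewrite peak_id// nm1.
  by apply: nm_peak_eq1 => //; exact/iterD/rD1.
exists M0 => M z hM zr; have := hM0 M ((r^-1)%:C * z) hM.
rewrite mulrA -rmorphM divff ?gt_eqF// mul1r; apply.
by rewrite nmM nm_real gtr0_norm ?invr_gt0// mulrC ler_pdivrMr// mul1r.
Qed.

(** Orbits of the open disc never meet [x] on the circle, so the limit in [M] is 0. *)
Let peak_sum_inner (A : nat -> R) K x (r c : R) : nm x = 1 -> (forall k, 0 <= A k) -> 0 < r < 1 ->
  0 < c -> exists M0, forall M z, (M0 <= M)%N -> nm z <= r -> peak_sum A K x M z < c.
Proof.
move=> hx A0 /andP[r0 r1] c0; apply: peak_sum_dini => //; first by rewrite r0 ltW.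
move=> z zr; rewrite big1// => k /eqP h.
have : nm (iter k B z) < 1.
  by elim: (nat_of_ord k) => [|n IH] /=; [exact: le_lt_trans r1|exact: BU].
by rewrite h hx ltxx.
Qed.

Let peak_sum_term (A : nat -> R) K x M z (j : 'I_K) : (forall k, 0 <= A k) ->
  A j * nm (cocycle j z) * nm (peak x (iter j B z)) ^+ M <= peak_sum A K x M z.
Proof.
move=> A0; rewrite /peak_sum (bigD1 j)//= lerDl sumr_ge0// => k _.
by rewrite !mulr_ge0 ?nm_ge0// exprn_ge0// nm_ge0.
Qed.

Let disc_algebra_peak_iter x k M :
  in_disc_algebra (fun z => cocycle k z * peak x (iter k B z) ^+ M).
Proof.
apply: disc_algebra_mul; first exact: disc_algebra_cocycle.
have h : in_disc_algebra (fun z => peak x (iter k B z)).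
  have hU z : nm z < 1 -> nm (iter k B z) < 1.
    by move=> hz; elim: (k) => [|n IH] //=; exact: BU.
  exact: (disc_algebra_comp (@iterD k) hU (disc_algebra_iter k BD BU BA)
    (disc_algebra_peak x)).
elim: M => [|M IH]; first exact: disc_algebra_cst.
under eq_fun do rewrite exprS; exact: (disc_algebra_mul h IH).
Qed.

(* Take T^k g / mu^k summed with tent-shaped coefficients, where g is a high power of
   a peak function at a nonperiodic point near p.  An orbit meets the peak at most once,
   so the telescoping error is of the order of the slope 1 / N of the tent. *)
Lemma usf_mem : usf_spectrum T mu.
Proof.
apply: usf_of_approx => e1 e10.
pose e := Num.min e1 2^-1.
have e0 : 0 < e by rewrite lt_min e10 /=.
have ee1 : e <= e1 by rewrite ge_min lexx.
have e12 : e <= 2^-1 by rewrite ge_min lexx orbT.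
suff [f [fA fz fT fs]] : exists f : C -> C, [/\ in_disc_algebra f,
     exists2 z, nm z <= 1 & 1 <= nm (f z),
     forall z, nm z <= 1 -> nm (T f z - mu * f z) <= e &
     forall z, nm z <= 1 - e -> nm (f z) <= e].
  exists f; split => // z hz; first by rewrite (le_trans (fT _ hz)).
  by rewrite (le_trans _ ee1)// fs//; move: hz ee1; lra.
have r01 : 0 < 1 - e < 1 by apply/andP; split; lra.
(* For [mu = 0] one cannot divide by |mu|^k, but a single peak at [p] suffices: [w] vanishes on the
   preimages of [p] by [cocycle_le], so T g is uniformly small. *)
have [m0|m0] := eqVneq (nm mu) 0.
  have mu0 : mu = 0 by apply/eqP; rewrite -nm_eq0 m0.
  have A1 (n k : nat) : 0 <= ((k == n)%:R : R) by rewrite ler0n.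
  have [||M1 h1] := @peak_sum_dini _ 2 p 1 e hp (A1 1%N).
  - by rewrite ltr01 lexx.
  - move=> z zD; rewrite big1// => k /eqP hk.
    have := cocycle_le zD hk; rewrite m0.
    have [->|_] := eqVneq (nat_of_ord k) 1%N; last by rewrite mul0r.
    by rewrite expr1 mul1r => h; apply/eqP; rewrite eq_le h nm_ge0.
  have [M2 h2] := @peak_sum_inner _ 1 p (1 - e) e hp (A1 0%N) r01 e0.
  pose M := maxn M1 M2.
  exists (fun z => cocycle 0 z * peak p (iter 0 B z) ^+ M); split.
  - exact: disc_algebra_peak_iter.
  - by exists p; rewrite /= ?hp// cocycle0 mul1r peak_id// expr1n nm1.
  - move=> z zD; apply: ltW; apply: le_lt_trans (h1 M z (leq_maxl _ _) zD).
    rewrite mu0 mul0r subr0 mulrA -cocycleS nmM nmX.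
    apply: le_trans (peak_sum_term p M z (lift ord0 ord0 : 'I_2) (A1 1%N)).
    by rewrite /= mul1r.
  - move=> z zr; apply: ltW; apply: le_lt_trans (h2 M z (leq_maxr _ _) zr).
    rewrite nmM nmX; apply: le_trans (peak_sum_term p M z (ord0 : 'I_1) (A1 0%N)).
    by rewrite /= mul1r.
have mp : 0 < nm mu by rewrite lt0r m0 nm_ge0.
have mu0 : mu != 0 by rewrite -nm_eq0.
set m := nm mu in m0 mp *.
(* 12 is the factor 4 of [coef] times the bound 3 of the peak sum. *)
pose N := (Num.trunc (12 * m / e)).+1.
have N0 : 0 < (N%:R : R) by rewrite ltr0n.
have Ne : 12 * m <= e * N%:R.
  by rewrite -ler_pdivrMl// mulrC ltW//; exact: truncnS_gt.
have [d1 d10 h1] := @near_cocycle_le (N + N) m0.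
have [d2 d20 h2] := @near_cocycle_ge N m0.
have [|x [hx xp xper]] := nonperiodic (_ : 0 < Num.min d1 d2); first by rewrite lt_min d10.
have xD : nm x <= 1 by rewrite hx.
rewrite lt_min in xp; case/andP: xp => xp1 xp2.
have [y [yD yx yc]] := h2 x xD xp2.
have per z i j : iter i B z = x -> iter j B z = x -> i = j.
  wlog ij : i j / (i <= j)%N.
    by move=> H hi hj; case: (leqP i j) => [/H|/ltnW/H] H'; [exact: H'|rewrite H'].
  move=> hi hj; apply/eqP; rewrite eqn_leq ij /= leqNgt; apply/negP => lt.
  have /xper/negP : (0 < j - i)%N by rewrite subn_gt0.
  by apply; rewrite -{1}hi -ssrnat.iterD subnK// hj.
pose A k : R := m ^- k.
have A0 k : 0 <= A k by rewrite invr_ge0 exprn_ge0// ltW.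
pose K := (N + N).+1.
(* The one surviving term is at most 2 by [near_cocycle_le], whence the strict bound 3. *)
have [||M1 g1] := @peak_sum_dini A K x 1 3 hx A0.
- by rewrite ltr01 lexx.
- move=> z zD; have [[j /eqP hj]|hj] := pselect (exists j : 'I_K, iter j B z == x).
    rewrite (bigD1 j)/=; last by rewrite hj.
    rewrite big1 ?addr0; last first.
      move=> k /andP[/eqP hk]; rewrite -val_eqE => /negP; case.
      by apply/eqP; exact: per hk hj.
    have jK : (j <= N + N)%N by rewrite -ltnS ltn_ord.
    have := h1 j x z jK xD xp1 zD hj; rewrite /A -ler_pdivrMr ?exprn_gt0// mulrC.
    by move=> h; apply: le_lt_trans h _; lra.
  by rewrite big1 ?ltr0n// => k hk; case: hj; exists k.
have e4 : 0 < e / 4 by rewrite divr_gt0.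
have [M2 g2] := @peak_sum_inner A K x (1 - e) (e / 4) hx A0 r01 e4.
have q4 : 0 < 4^-1 :> R by [].
(* At [y] the term [k = N] sits exactly at the peak; the others together drop below 1/4, hence below
   1 after the factor 4. *)
have [|M3 g3] := @sum_geometric_limit R 'I_K (index_enum 'I_K)
     (fun k => (k != N :> nat)%:R * (A k * nm (cocycle k y)))
     (fun k => nm (peak x (iter k B y))) _ _ q4.
  by move=> k; rewrite nm_ge0 nm_peak_le1// iterD.
pose M := maxn M1 (maxn M2 M3).
have hM1 : (M1 <= M)%N by rewrite leq_maxl.
have hM2 : (M2 <= M)%N by rewrite (leq_trans _ (leq_maxr _ _))// leq_maxl.
have hM3 : (M3 <= M)%N by rewrite (leq_trans _ (leq_maxr _ _))// leq_maxr.
pose tent k : R := (minn k (N + N - k))%:R / N%:R.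
have tent0 k : 0 <= tent k by rewrite divr_ge0.
have tent1 k : tent k <= 1.
  rewrite ler_pdivrMr// mul1r ler_nat geq_min; case: (leqP k N) => //= kN.
  by rewrite leq_subLR leq_add2r ltnW.
have tentS k : `|tent k - tent k.+1| <= N%:R^-1.
  rewrite /tent -mulrBl normrM [X in _ * X]ger0_norm ?invr_ge0// ler_piMl ?invr_ge0//.
  have [h3 h4] := minn_tent_step k N.
  set u := minn _ _ in h3 h4 *; set v := minn _ _ in h3 h4 *.
  have [|/ltnW] := leqP u v => uv; last rewrite distrC.
    by rewrite -natrB// normr_nat -[1]/(1%:R) ler_nat leq_subLR addnC.
  by rewrite -natrB// normr_nat -[1]/(1%:R) ler_nat leq_subLR addnC.
(* The factor 4 gives the term [k = N] at [y] modulus at least 4 / 2 = 2, against at most 1 for the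
   rest. *)
pose coef k : C := 4 * (tent k)%:C * mu ^- k.
have nm4 : nm (4 : C) = 4.
  by rewrite -[4 : C](rmorph_nat (real_complex R)) nm_real normr_nat.
pose h k z : C := cocycle k z * peak x (iter k B z) ^+ M.
have nmh k z : nm (h k z) = nm (cocycle k z) * nm (peak x (iter k B z)) ^+ M.
  by rewrite nmM nmX.
have nmc k : nm (coef k) <= 4 * A k.
  rewrite /coef !nmM nm4 nm_real nmV nmX ger0_norm//.
  by apply: ler_wpM2r; [exact: A0|rewrite ler_piMr].
exists (fun z => \sum_(k < K) coef k * h k z); split.
- apply: (@disc_algebra_sum R _ (index_enum 'I_K) (fun k z => coef k * h k z)) => k.
  by apply: disc_algebra_mul; [exact: disc_algebra_cst|exact: disc_algebra_peak_iter].
- exists y => //.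
  have NK : (N < K)%N by rewrite ltnS leq_addr.
  rewrite (bigD1 (Ordinal NK))//=; set S := \sum_(_ < _ | _) _.
  have S4 : nm S <= 1.
    apply: le_trans (nm_sum _ _ _) _.
    apply: le_trans (_ : _ <= 4 * \sum_(k < K) ((k != N :> nat)%:R *
      (A k * nm (cocycle k y)) * nm (peak x (iter k B y)) ^+ M)) _.
      rewrite mulr_sumr [leLHS]big_mkcond ler_sum// => k _.
      rewrite -val_eqE /=; case: ifP => _; last by rewrite !mul0r mulr0.
      rewrite mul1r nmM nmh -(mulrA (A k)) (mulrA 4).
      by rewrite ler_wpM2r ?nmc// mulr_ge0 ?exprn_ge0 ?nm_ge0.
    rewrite -ler_pdivlMl// mulr1; apply: le_trans (g3 _ hM3) _.
    rewrite big1 ?add0r// => k /eqP /(nm_peak_eq1 hx (iterD _ yD)) hk.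
    by rewrite (per _ _ _ hk yx) eqxx mul0r.
  have tN : tent N = 1 by rewrite /tent addnK minnn divff// gt_eqF.
  have h2N : 2 <= nm (coef N * h N y).
    rewrite nmM nmh yx peak_id// nm1 expr1n mulr1 /coef !nmM nm4 nm_real tN normr1.
    rewrite mulr1 nmV nmX -/m mulrAC; have mN : 0 < m ^+ N by rewrite exprn_gt0.
    by rewrite ler_pdivlMr//; move: yc; rewrite -/m; lra.
  by have := nmB (coef N * h N y + S) S; rewrite addrK; lra.
- move=> z zD.
  have c0 : coef 0%N = 0 by rewrite /coef /tent min0n mul0r mulr0 mul0r.
  have cK : coef (N + N)%N = 0 by rewrite /coef /tent subnn minn0 mul0r mulr0 mul0r.
  have hS k : w z * h k (B z) = h k.+1 z by rewrite /h mulrA -cocycleS -iterSr.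
  (* Summation by parts: T sends [h k] to [h k.+1], and the end terms drop because the tent vanishes
     at 0 and at [N + N]. *)
  have -> : w z * (\sum_(k < K) coef k * h k (B z)) - mu * (\sum_(k < K) coef k * h k z) =
      \sum_(k < N + N) (coef k - mu * coef k.+1) * h k.+1 z.
    rewrite big_ord_recr [X in _ - mu * X]big_ord_recl /= c0 cK !mul0r addr0 add0r.
    rewrite !mulr_sumr -sumrB; apply: eq_bigr => k _.
    by rewrite mulrCA hS mulrBl mulrA.
  apply: le_trans (nm_sum _ _ _) _.
  have cd k : nm (coef k - mu * coef k.+1) <= 4 * m / N%:R * A k.+1.
    rewrite (_ : coef k - _ = 4 * (tent k - tent k.+1)%:C * mu ^- k); last first.
      by rewrite /coef exprS rmorphB; field; rewrite mu0 expf_neq0.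
    rewrite !nmM nm4 nm_real nmV nmX -/m.
    have -> : 4 * m / N%:R * A k.+1 = 4 * N%:R^-1 / m ^+ k.
      by rewrite /A exprS; field; rewrite !gt_eqF// exprn_gt0.
    by rewrite ler_wpM2r ?invr_ge0 ?exprn_ge0 ?(ltW mp)// ler_wpM2l.
  apply: le_trans (_ : _ <= 4 * m / N%:R * peak_sum A K x M z) _.
    rewrite /peak_sum [X in _ * X]big_ord_recl mulrDr ler_wpDl//.
      by rewrite !mulr_ge0 ?invr_ge0 ?exprn_ge0 ?nm_ge0 ?(ltW mp).
    rewrite mulr_sumr ler_sum// => k _; rewrite nmM nmh.
    rewrite -(mulrA (A _)) (mulrA (4 * m / N%:R)).
    by apply: ler_wpM2r; [rewrite mulr_ge0 ?exprn_ge0 ?nm_ge0|exact: cd].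
  apply: le_trans (_ : _ <= 4 * m / N%:R * 3) _.
    by rewrite ler_wpM2l ?(ltW (g1 _ _ hM1 zD))// !mulr_ge0 ?invr_ge0 ?(ltW mp).
  by rewrite mulrAC ler_pdivrMr//; move: Ne; lra.
- move=> z zr; apply: le_trans (nm_sum _ _ _) _.
  apply: le_trans (_ : _ <= 4 * peak_sum A K x M z) _.
    rewrite /peak_sum mulr_sumr ler_sum// => k _.
    rewrite nmM nmh -(mulrA (A k)) (mulrA 4).
    by apply: ler_wpM2r; [rewrite mulr_ge0 ?exprn_ge0 ?nm_ge0|exact: nmc].
  by have := g2 _ _ hM2 zr; lra.
Qed.

End LowerBound.


(** * Interpolation by functions of norm at most 1 *)

Section Interpolation.
Variable R : realType.
Local Notation C := (R[i])^o.
Implicit Types (p q z : C) (F : seq C).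

Lemma ReD (u v : C) : Re (u + v) = Re u + Re v.
Proof. by case: u; case: v. Qed.
Lemma ReN (u : C) : Re (- u) = - Re u.
Proof. by case: u. Qed.

Lemma Re_sum (I : Type) (s : seq I) (f : I -> C) :
  Re (\sum_(i <- s) f i) = \sum_(i <- s) Re (f i).
Proof. exact: (big_morph (@complex.Re R : C -> R) ReD). Qed.

Lemma Re_one_sub z : nm z <= 1 -> 0 <= Re (1 - z) /\ (Re (1 - z) <= 0 -> z = 1).
Proof.
case: z => u v; rewrite nm_le1_sq nm_sq /= => h.
have u1 : u <= 1 by have := sqr_ge0 v; nra.
rewrite subr_ge0; split => // h'; have e : u = 1 by lra.
have v0 : v ^+ 2 = 0 by apply/eqP; rewrite eq_le sqr_ge0 andbT; move: h; rewrite e; nra.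
by move/eqP: v0; rewrite sqrf_eq0 e => /eqP->.
Qed.

Lemma Re_inv_one_sub z : nm z <= 1 -> z != 1 ->
  2^-1 <= Re ((1 - z)^-1) /\ (nm z = 1 -> Re ((1 - z)^-1) = 2^-1).
Proof.
case: z => u v hz z1.
have n0 : 0 < (1 - u) ^+ 2 + v ^+ 2.
  rewrite lt0r addr_ge0 ?sqr_ge0// andbT paddr_eq0 ?sqr_ge0// !sqrf_eq0.
  apply: contra z1 => /andP[/eqP h1 /eqP ->].
  by rewrite (_ : u = 1)//; lra.
have -> : Re ((1 - (u +i* v : C))^-1) = (1 - u) / ((1 - u) ^+ 2 + v ^+ 2).
  by rewrite /= sub0r sqrrN.
have hE := nm_sq (u +i* v); rewrite nm_le1_sq hE /= in hz; split.
  by rewrite ler_pdivlMr// mulrC ler_pdivrMr//; nra.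
move=> h; rewrite h expr1n /= in hE.
by apply: (mulIf (lt0r_neq0 n0)); rewrite divfK ?gt_eqF//; nra.
Qed.

Lemma one_sub_circle p z : nm p = 1 -> (1 - p^* * z == 0) = (z == p).
Proof.
move=> hp; rewrite subr_eq0; apply/eqP/eqP => [h|->]; last by rewrite mulJ_circle.
by rewrite -[z]mul1r -(mulJ_circle hp) [p^* * p]mulrC -mulrA -h mulr1.
Qed.

Definition fac p z : C := 1 - p^* * z.

Lemma disc_algebra_fac p : in_disc_algebra (fac p).
Proof.
rewrite /fac; under eq_fun do rewrite -mulNr.
apply: disc_algebra_add; first exact: disc_algebra_cst.
by apply: disc_algebra_mul; [exact: disc_algebra_cst|exact: disc_algebra_id].
Qed.

(* [pole_den F] and [pole_num F] are the denominator and the numerator of the sum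
   of the fractions 1 / (1 - conj p z) over p in F. *)
Fixpoint pole_den F z : C :=
  if F is p :: F' then fac p z * pole_den F' z else 1.
Fixpoint pole_num F z : C :=
  if F is p :: F' then pole_den F' z + fac p z * pole_num F' z else 0.
Definition pole_sum F z : C := \sum_(p <- F) (fac p z)^-1.

Lemma disc_algebra_pole_den F : in_disc_algebra (pole_den F).
Proof.
elim: F => [|p F IH]; first exact: disc_algebra_cst.
exact: (disc_algebra_mul (disc_algebra_fac p) IH).
Qed.

Lemma disc_algebra_pole_num F : in_disc_algebra (pole_num F).
Proof.
elim: F => [|p F IH]; first exact: disc_algebra_cst.
exact: (disc_algebra_add (disc_algebra_pole_den F)
  (disc_algebra_mul (disc_algebra_fac p) IH)).
Qed.

Definition on_circle F := forall p, p \in F -> nm p = 1.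

Lemma on_circle_cons p F : on_circle (p :: F) -> nm p = 1 /\ on_circle F.
Proof.
by move=> h; split => [|q qF]; apply: h; rewrite inE ?eqxx// qF orbT.
Qed.

Lemma pole_den_eq0 F z : on_circle F -> (pole_den F z == 0) = (z \in F).
Proof.
elim: F => [|p F IH] /=; first by rewrite oner_eq0.
by move=> /on_circle_cons[hp hF]; rewrite mulf_eq0 IH// inE one_sub_circle.
Qed.

Lemma pole_numE F z : on_circle F -> z \notin F ->
  pole_num F z = pole_sum F z * pole_den F z.
Proof.
elim: F => [|p F IH] /=; first by rewrite /pole_sum big_nil mul0r.
move=> /on_circle_cons[hp hF]; rewrite inE negb_or => /andP[zp zF].
have f0 : fac p z != 0 by rewrite /fac one_sub_circle.
rewrite IH// /pole_sum big_cons; set u := \sum_(_ <- _) _.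
by move: (fac p z) (pole_den F z) u f0 => f v u f0; field.
Qed.

Lemma pole_num_neq0 F z : on_circle F -> uniq F -> z \in F -> pole_num F z != 0.
Proof.
elim: F => //= p F IH /on_circle_cons[hp hF] /andP[pF uF].
rewrite inE; have [->|zp] := eqVneq z p => /=.
  move=> _; rewrite (_ : fac p p = 0) ?mul0r ?addr0 ?pole_den_eq0//.
  by apply/eqP; rewrite /fac one_sub_circle.
move=> zF; have -> : pole_den F z = 0 by apply/eqP; rewrite pole_den_eq0.
by rewrite add0r mulf_neq0 ?IH// /fac one_sub_circle.
Qed.

(** Each summand maps the disc to the half plane of real part at least 1/2 and the circle to its
    boundary. As the real part is constant on the circle, subtracting the value at a circle point
    leaves it nonnegative on the disc. *)
Lemma Re_pole_sum F z : on_circle F -> nm z <= 1 -> z \notin F ->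
  (size F)%:R / 2 <= Re (pole_sum F z) /\
  (nm z = 1 -> Re (pole_sum F z) = (size F)%:R / 2).
Proof.
move=> hF hz; rewrite /pole_sum Re_sum.
elim: F hF => [|p F IH]; first by rewrite big_nil mul0r.
move=> /on_circle_cons[hp hF]; rewrite inE negb_or => /andP[zp zF].
have [h1 h2] := IH hF zF; rewrite big_cons /=.
have n1 : nm (p^* * z) = nm z by rewrite nmM nmJ hp mul1r.
have [||h3 h4] := @Re_inv_one_sub (p^* * z).
- by rewrite n1.
- by rewrite -subr_eq0 -opprB oppr_eq0 one_sub_circle.
rewrite -natr1 /fac; split; first by move: h1 h3; lra.
by move=> z1; rewrite h2// h4 ?n1//; lra.
Qed.

Lemma nm_shift_le (u : C) (b g : R) : 0 <= Re u -> 0 <= b <= g ->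
  nm (u + b%:C) <= nm (u + g%:C).
Proof.
case: u => x y /= x0 /andP[b0 bg]; rewrite -ler_sqr ?nnegrE ?nm_ge0// !nm_sq /=.
by nra.
Qed.

(* Adding b or c >= b to a function of nonnegative real part that is infinite on F gives
   a quotient of modulus at most 1 that is 1 on F. *)
Definition interp F (g : C -> C) (b c : R) z : C :=
  (pole_num F z + (g z + b%:C) * pole_den F z) /
  (pole_num F z + (g z + c%:C) * pole_den F z).

Section Interp.
Variables (F : seq C) (g : C -> C) (b c : R).
Hypotheses (hF : on_circle F) (uF : uniq F) (gA : in_disc_algebra g).
Hypotheses (b0 : 0 <= b) (bc : b <= c) (c0 : 0 < c).
Hypothesis Re_ge0 : forall z, nm z <= 1 -> z \notin F -> 0 <= Re (pole_sum F z + g z).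

Lemma interp_den z : nm z <= 1 -> z \notin F -> pole_sum F z + g z + c%:C != 0.
Proof.
move=> hz zF; apply/eqP => /(congr1 (@complex.Re R)); rewrite ReD /=.
by have := Re_ge0 hz zF; move: c0; lra.
Qed.

Lemma interpE z : nm z <= 1 -> z \notin F ->
  interp F g b c z = (pole_sum F z + g z + b%:C) / (pole_sum F z + g z + c%:C).
Proof.
move=> hz zF; have d0 : pole_den F z != 0 by rewrite pole_den_eq0.
by rewrite /interp pole_numE// -!mulrDl !addrA -mulf_div divff// mulr1.
Qed.

Lemma interp_node z : z \in F -> interp F g b c z = 1.
Proof.
move=> zF; have -> : interp F g b c z = pole_num F z / pole_num F z.
  have d0 : pole_den F z = 0 by apply/eqP; rewrite pole_den_eq0.
  by rewrite /interp d0 !mulr0 !addr0.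
by rewrite divff// pole_num_neq0.
Qed.

Lemma interp_le1 z : nm z <= 1 -> nm (interp F g b c z) <= 1.
Proof.
move=> hz; have [zF|zF] := boolP (z \in F); first by rewrite interp_node// nm1.
rewrite interpE// nmM nmV ler_pdivrMr ?nm_gt0 ?interp_den// mul1r.
by rewrite nm_shift_le ?Re_ge0// b0.
Qed.

(** With denominators cleared there is no pole at a node: [pole_den] vanishes there and [pole_num],
    the nodes being distinct, does not. Elsewhere the denominator divided by [pole_den] has real
    part at least [c > 0]. *)
Lemma disc_algebra_interp : in_disc_algebra (interp F g b c).
Proof.
have H (e : R) : in_disc_algebra (fun z => pole_num F z + (g z + e%:C) * pole_den F z).
  apply: disc_algebra_add; first exact: disc_algebra_pole_num.
  apply: disc_algebra_mul; last exact: disc_algebra_pole_den.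
  exact: (disc_algebra_add gA (disc_algebra_cst _)).
apply: disc_algebra_mul; first exact: H.
apply: disc_algebra_inv; last exact: H.
move=> z hz; have [zF|zF] := boolP (z \in F).
  have -> : pole_den F z = 0 by apply/eqP; rewrite pole_den_eq0.
  by rewrite mulr0 addr0 pole_num_neq0.
by rewrite pole_numE// -mulrDl addrA mulf_neq0 ?interp_den// pole_den_eq0.
Qed.

End Interp.

(** The term [g] makes [pole_sum F + g] vanish at [q], so the quotient there is [al * eta / eta].
    The real part of [pole_sum F + g] dominates Re (1 - (conj q) z), positive except at [q], which
    locates the zeros. *)
Lemma boundary_bump F q z1 (al e : R) : on_circle F -> uniq F -> nm q = 1 ->
  q \notin F -> 0 <= al <= 1 -> nm z1 < 1 -> 0 < e ->
  exists h : C -> C, [/\ in_disc_algebra h, forall z, nm z <= 1 -> nm (h z) <= 1,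
    forall z, z \in F -> h z = 1, h q = al%:C &
    (forall z, nm z <= 1 -> h z = 0 -> z = q /\ al = 0) /\ 1 - e <= nm (h z1)].
Proof.
move=> hF uF hq qF /andP[al0 al1] hz1 e0.
have q1 : nm q <= 1 by rewrite hq.
pose g z := fac q z - pole_sum F q.
have gA : in_disc_algebra g.
  exact: (disc_algebra_add (disc_algebra_fac q) (disc_algebra_cst _)).
have nq z : nm z <= 1 -> nm (q^* * z) <= 1 by rewrite nmM nmJ hq mul1r.
have Re_ge z : nm z <= 1 -> z \notin F -> Re (fac q z) <= Re (pole_sum F z + g z).
  move=> hz zF; rewrite /g (ReD (pole_sum F z)) (ReD (fac q z)) (ReN (pole_sum F q)).
  have [_ ->//] := Re_pole_sum hF q1 qF.
  by have [h _] := Re_pole_sum hF hz zF; move: h; lra.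
have Re_ge0 z : nm z <= 1 -> z \notin F -> 0 <= Re (pole_sum F z + g z).
  by move=> hz zF; rewrite (le_trans _ (Re_ge _ hz zF))//; have [] := Re_one_sub (nq _ hz).
have r0 : 0 < Re (fac q z1).
  have [h1 h2] := Re_one_sub (nq _ (ltW hz1)); rewrite ltNge; apply/negP => h3.
  have : nm (q^* * z1) = 1 by rewrite h2// nm1.
  by rewrite nmM nmJ hq mul1r => h; rewrite h ltxx in hz1.
(* 1 - h(z1) = eta (1 - al) / (X + eta), and |X + eta| is at least Re (fac q z1). *)
pose eta := e * Re (fac q z1); have eta0 : 0 < eta by rewrite mulr_gt0.
have b0 : 0 <= al * eta by rewrite mulr_ge0// ltW.
have bc : al * eta <= eta by rewrite ler_piMl// ltW.
exists (interp F g (al * eta) eta); split.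
- exact: disc_algebra_interp.
- by move=> z; exact: interp_le1.
- by move=> z; exact: interp_node.
- rewrite interpE//; have -> : pole_sum F q + g q = 0.
    by rewrite /g (_ : fac q q = 0) ?sub0r ?subrr//; apply/eqP; rewrite /fac one_sub_circle.
  by rewrite !add0r rmorphM mulfK// -nm_eq0 nm_real normr_eq0 gt_eqF.
split.
  move=> z hz; have [zF|zF] := boolP (z \in F).
    by rewrite interp_node// => /eqP; rewrite oner_eq0.
  rewrite interpE// => /eqP; rewrite mulf_eq0 invr_eq0.
  rewrite (negbTE (interp_den eta0 Re_ge0 hz zF)) orbF => /eqP /(congr1 (@complex.Re R)).
  rewrite ReD /= => h.
  have [h1 h2] := Re_one_sub (nq _ hz); have h3 := Re_ge _ hz zF.
  have h3' : Re (1 - q^* * z) <= Re (pole_sum F z + g z) by exact: h3.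
  split; last first.
    have /eqP : al * eta = 0 by apply/eqP; rewrite eq_le b0 andbT; move: h h1 h3'; lra.
    by rewrite mulf_eq0 (gt_eqF eta0) orbF => /eqP.
  apply/eqP; rewrite -one_sub_circle// h2 ?subrr//; move: h h3'; lra.
have [zF|zF] := boolP (z1 \in F).
  by move: hz1; rewrite (hF _ zF) ltxx.
rewrite interpE ?(ltW hz1)//; have d0 := interp_den eta0 Re_ge0 (ltW hz1) zF.
set X := pole_sum F z1 + g z1 in d0 *.
have -> : (X + (al * eta)%:C) / (X + eta%:C) = 1 - (eta * (1 - al))%:C / (X + eta%:C).
  apply: (mulIf d0); rewrite mulrBl !divfK// !rmorphM rmorphB rmorph1; ring.
have := nmD (1 - (eta * (1 - al))%:C / (X + eta%:C)) ((eta * (1 - al))%:C / (X + eta%:C)).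
rewrite subrK nm1 [X in _ + X]nmM nmV nm_real ger0_norm; last first.
  by rewrite mulr_ge0 ?subr_ge0// ltW.
suff : eta * (1 - al) / nm (X + eta%:C) <= e by lra.
have hX : Re (fac q z1) <= nm (X + eta%:C).
  apply: le_trans (nm_Re _); apply: le_trans (ler_norm _); rewrite (ReD X) -[Re eta%:C]/eta.
  by have := Re_ge _ (ltW hz1) zF; rewrite -/X; move: eta0; lra.
rewrite ler_pdivrMr ?(lt_le_trans r0)//; apply: le_trans (_ : _ <= e * Re (fac q z1)) _.
  by rewrite -/eta ler_piMr ?(ltW eta0)//; lra.
by rewrite ler_wpM2l// ltW.
Qed.

End Interpolation.


(** * Weights of norm at most 1 with prescribed moduli and zeros *)

Section Weight.
Variable R : realType.
Local Notation C := (R[i])^o.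
Implicit Types (q z : C) (L : seq C).

(** A product of bumps, one per node and equal to 1 at the other nodes. Each takes the share e /
    (size L + 1) of the deficit at [z1], so that the modulus at an interior point stays high and can
    then be lowered to any value below 1. *)
Lemma boundary_weight L (tau : C -> R) z1 (e : R) : on_circle L -> uniq L ->
  (forall q, 0 <= tau q <= 1) -> nm z1 < 1 -> 0 < e ->
  exists W : C -> C, [/\ in_disc_algebra W, forall z, nm z <= 1 -> nm (W z) <= 1,
    forall q, q \in L -> nm (W q) = tau q,
    forall z, nm z <= 1 -> W z = 0 -> z \in L /\ tau z = 0 & 1 - e <= nm (W z1)].
Proof.
move=> hL uL htau hz1 e0.
have e1 : 0 < e / (size L).+1%:R by rewrite divr_gt0.
have /choice[h hP] : forall q, exists h : C -> C, q \in L ->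
   [/\ in_disc_algebra h, forall z, nm z <= 1 -> nm (h z) <= 1,
    forall z, z \in rem q L -> h z = 1, h q = (tau q)%:C &
    (forall z, nm z <= 1 -> h z = 0 -> z = q /\ tau q = 0) /\
    1 - e / (size L).+1%:R <= nm (h z1)].
  move=> q; have [qL|qL] := boolP (q \in L); last by exists id.
  have hr : on_circle (rem q L) by move=> p /mem_rem; exact: hL.
  have qr : q \notin rem q L by rewrite mem_rem_uniqF.
  have [h hh] := boundary_bump hr (rem_uniq _ uL) (hL _ qL) qr (htau q) hz1 e1.
  by exists h.
exists (fun z => \prod_(q <- L) h q z); split.
- by apply: (@disc_algebra_prod R _ L h) => q /hP[].
- move=> z hz; rewrite nm_prod.
  have [|/andP[]//] := @one_sub_prod_le R C L (fun q => nm (h q z)).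
  by move=> q /hP[_ h1 _ _ _]; rewrite nm_ge0 h1.
- move=> q qL; rewrite nm_prod (big_rem q qL) /=.
  have [_ _ _ -> _] := hP q qL; rewrite nm_real ger0_norm; last by have /andP[] := htau q.
  rewrite big_seq big1 ?mulr1// => p pr.
  have pL : p \in L by exact: mem_rem pr.
  have [_ _ h1 _ _] := hP p pL; rewrite h1 ?nm1//.
  rewrite mem_rem_uniq// inE qL andbT eq_sym.
  by move: pr; rewrite mem_rem_uniq// inE => /andP[].
- move=> z hz /eqP; rewrite prodf_seq_eq0 => /hasP[q qL /= /eqP hq].
  by have [_ _ _ _ [h1 _]] := hP q qL; have [-> ->] := h1 z hz hq.
- rewrite nm_prod; have [|_ h1] := @one_sub_prod_le R C L (fun q => nm (h q z1)).
    by move=> q /hP[_ h1 _ _ _]; rewrite nm_ge0 h1// ltW.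
  have : \sum_(q <- L) (1 - nm (h q z1)) <= e; last by move: h1; lra.
  apply: le_trans (_ : _ <= \sum_(q <- L) e / (size L).+1%:R) _.
    rewrite !big_seq ler_sum// => q /hP[_ _ _ _ [_]].
    by rewrite lerBlDr -lerBlDl.
  rewrite big_const_seq count_predT iter_addr_0 -[leLHS]mulr_natr -mulrA ler_piMr ?(ltW e0)//.
  by rewrite mulrC ler_pdivrMr// mul1r ler_nat.
Qed.

Lemma disc_weight L (tau : C -> R) z0 (k : R) : on_circle L -> uniq L ->
  (0 < size L)%N -> (forall q, 0 <= tau q <= 1) -> nm z0 <= 1 -> z0 \notin L ->
  0 <= k < 1 ->
  exists W : C -> C, [/\ in_disc_algebra W, forall z, nm z <= 1 -> nm (W z) <= 1,
    forall q, q \in L -> nm (W q) = tau q, nm (W z0) = k &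
    forall z, nm z <= 1 -> W z = 0 -> (z \in L /\ tau z = 0) \/ z = z0].
Proof.
move=> hL uL sL htau hz0 z0L /andP[k0 k1].
have [z0T|z0T] := eqVneq (nm z0) 1.
  (* On the circle, [z0] is just one more node. *)
  pose tau' q := if q == z0 then k else tau q.
  have [||||//|W [WA W1 Wt Wz _]] := @boundary_weight (z0 :: L) tau' 0 1.
  - by move=> q; rewrite inE => /orP[/eqP->//|]; exact: hL.
  - by rewrite /= z0L.
  - by move=> q; rewrite /tau'; case: ifP => // _; rewrite k0 ltW.
  - by rewrite nm0.
  exists W; split => //.
  - move=> q qL; rewrite Wt ?inE ?qL ?orbT// /tau' ifN//.
    by apply: contra z0L => /eqP<-.
  - by rewrite Wt ?mem_head// /tau' eqxx.
  - move=> z hz hW; have [->|zz] := eqVneq z z0; first by right.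
    by left; have := Wz z hz hW; rewrite inE /tau' (negbTE zz).
have z0U : nm z0 < 1 by rewrite lt_neqAle z0T.
(* For [k = 0] a Moebius factor puts a zero at [z0] and keeps the moduli on the circle. *)
have [->|kn0] := eqVneq k 0.
  have [//|W [WA W1 Wt Wz _]] := boundary_weight hL uL htau z0U (_ : 0 < 1).
  exists (fun z => W z * mob z0 z); split.
  - exact: (disc_algebra_mul WA (disc_algebra_mob z0U)).
  - by move=> z hz; rewrite nmM mulr_ile1 ?nm_ge0 ?W1 ?nm_mob_le1.
  - by move=> q qL; rewrite nmM nm_mob_eq1 ?mulr1 ?Wt// hL.
  - by rewrite /mob subrr mul0r mulr0 nm0.
  - move=> z hz /eqP; rewrite mulf_eq0 => /orP[/eqP/(Wz _ hz)|]; first by left.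
    rewrite mulf_eq0 invr_eq0 (negbTE (mobius_den_neq0 hz z0U)) orbF subr_eq0.
    by move=> /eqP; right.
have kp : 0 < k by rewrite lt0r kn0.
have [|W [WA W1 Wt Wz Wz0]] := boundary_weight hL uL htau z0U (_ : 0 < 1 - k).
  by rewrite subr_gt0.
have b0 : k <= nm (W z0) by move: Wz0; lra.
have bp : 0 < nm (W z0) by exact: lt_le_trans b0.
have b1 := W1 _ hz0.
pose t := k / nm (W z0).
have t0 : 0 < t by rewrite divr_gt0.
have t1 : t <= 1 by rewrite ler_pdivrMr// mul1r.
pose r := Re (pole_sum L z0).
have r0 : 0 < r.
  have [h _] := Re_pole_sum hL hz0 z0L; apply: lt_le_trans h.
  by rewrite divr_gt0// ltr0n.
(* A purely imaginary constant making [pole_sum L + g] equal to the real number [r] at [z0]. With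
   shifts t r and r / t the quotient there is (r + t r) / (r + r / t) = t, and it has no zero. *)
pose g (z : C) : C := r%:C - pole_sum L z0.
have gA : in_disc_algebra g by exact: disc_algebra_cst.
have Re_ge0 z : nm z <= 1 -> z \notin L -> 0 <= Re (pole_sum L z + g z).
  move=> hz zL; rewrite (ReD (pole_sum L z)) (ReD r%:C) (ReN (pole_sum L z0)).
  rewrite -[Re r%:C]/r subrr addr0.
  by have [h _] := Re_pole_sum hL hz zL; rewrite (le_trans _ h)// divr_ge0.
have bb : 0 <= t * r by rewrite mulr_ge0 ?ltW.
have bc : t * r <= r / t by rewrite ler_pdivlMr//; nra.
have cp : 0 < r / t by rewrite divr_gt0.
exists (fun z => W z * interp L g (t * r) (r / t) z); split.
- by apply: (disc_algebra_mul WA); exact: (disc_algebra_interp _ hL uL gA cp Re_ge0).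
- by move=> z hz; rewrite nmM mulr_ile1 ?nm_ge0 ?W1// interp_le1.
- by move=> q qL; rewrite nmM interp_node// nm1 mulr1 Wt.
- rewrite nmM interpE// /g addrCA subrr addr0 -!rmorphD nmM nmV !nm_real.
  rewrite !ger0_norm ?addr_ge0 ?(ltW r0) ?(ltW cp)//.
  have -> : (r + t * r) / (r + r / t) = t.
    by field; rewrite !gt_eqF// ?mulr_gt0// addr_gt0// mulr_gt0.
  by rewrite mulrC /t divfK// gt_eqF.
- move=> z hz /eqP; rewrite mulf_eq0 => /orP[/eqP/(Wz _ hz)|]; first by left.
  have [zL|zL] := boolP (z \in L); first by rewrite interp_node// oner_eq0.
  rewrite interpE// mulf_eq0 invr_eq0 (negbTE (interp_den cp Re_ge0 hz zL)) orbF.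
  move=> /eqP/(congr1 (@complex.Re R)); rewrite (ReD (_ + _)) -[Re (t * r)%:C]/(t * r).
  rewrite -[Re 0]/(0 : R) => h; exfalso; move: h (Re_ge0 _ hz zL) (mulr_gt0 t0 r0).
  by lra.
Qed.

End Weight.


Section Orbits.
Variables (T : eqType) (f : T -> T).

Definition orbit_seq (k : nat) (p : T) : seq T := [seq iter i f p | i <- iota 0 k].

Lemma iter_modn k p i : iter k f p = p -> iter (i %% k) f p = iter i f p.
Proof.
move=> kp; rewrite {2}(divn_eq i k) addnC iterD; congr iter.
by elim: (i %/ k)%N => [|l IH] //; rewrite mulSn iterD -IH kp.
Qed.

Lemma mem_orbit_seq k p i : (0 < k)%N -> iter k f p = p -> iter i f p \in orbit_seq k p.
Proof.
move=> k0 kp; rewrite -(iter_modn i kp); apply/mapP; exists (i %% k)%N => //.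
by rewrite mem_iota /= add0n ltn_mod.
Qed.

Lemma orbit_seqP k p z : z \in orbit_seq k p -> exists i, z = iter i f p.
Proof. by move=> /mapP[i _ ->]; exists i. Qed.

Lemma iter_return k p i : (0 < k)%N -> iter k f p = p ->
  exists j, iter j f (iter i f p) = p.
Proof.
move=> k0 kp; exists (i * k - i)%N; rewrite -iterD subnK ?leq_pmulr//.
by rewrite -(iter_modn _ kp) modnMl.
Qed.

End Orbits.

(** * The spectrum of a weight with prescribed moduli on cycles *)

Section Spectrum.
Variables (R : realType) (d : nat) (c : (R[i])^o) (a : 'I_d -> (R[i])^o).
Local Notation C := (R[i])^o.
Hypothesis d2 : (2 <= d)%N.
Hypothesis c1 : nm c = 1.
Hypothesis a1 : forall j, nm (a j) < 1.
Local Notation B := (blaschke c a).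
Variable z0 : C.
Hypothesis wd : wolff_denjoy_point B z0.

Let d0 : (0 < d)%N. Proof. exact: leq_trans d2. Qed.
Let BD z : nm z <= 1 -> nm (B z) <= 1. Proof. exact: blaschke_disc. Qed.
Let BU z : nm z < 1 -> nm (B z) < 1. Proof. exact: blaschke_open_disc. Qed.
Let BA : in_disc_algebra B. Proof. exact: disc_algebra_blaschke. Qed.
Let Blift := blaschke_iter_lift d0 c1 a1.
Let z0D : nm z0 <= 1. Proof. exact: (wd_disc wd). Qed.
Let Bz0 : B z0 = z0. Proof. exact: (wd_fixed c1 a1 wd). Qed.

Lemma finite_dist (s : seq C) p : p \notin s ->
  exists2 e : R, 0 < e & forall z, z \in s -> e <= nm (z - p).
Proof.
elim: s => [|z s IH]; first by exists 1.
rewrite inE negb_or => /andP[pz /IH[e e0 he]].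
exists (Num.min e (nm (z - p))).
  by rewrite lt_min e0 nm_gt0 subr_eq0 eq_sym.
move=> u; rewrite inE ge_min => /orP[/eqP->|us]; first by rewrite lexx orbT.
by rewrite he.
Qed.

(** The cycle of another point [q] has a backward branch reaching some [y] close to [p]. If [y] were
    periodic it would lie on the cycle of [q], which keeps a positive distance from [p]. *)
Lemma nonperiodic_near p k : nm p = 1 -> (0 < k)%N -> iter k B p = p -> p != z0 ->
  forall e : R, 0 < e -> exists x,
    [/\ nm x = 1, nm (x - p) < e & forall j, (0 < j)%N -> iter j B x != x].
Proof.
move=> hp k0 kp pz0 e e0.
have [q [n [hq n0 nq]]] := blaschke_periodic (z0 :: orbit_seq B k p) d2 c1 a1.
rewrite inE negb_or => /andP[qz0 qp].
have pq : p \notin orbit_seq B n q.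
  apply/negP => /orbit_seqP[i pE]; have [j] := iter_return i n0 nq.
  by rewrite -pE => qE; move: qp; rewrite -qE mem_orbit_seq.
have [e1 e10 he1] := finite_dist pq.
have q1 : nm q <= 1 by rewrite hq.
have [|N [y [yD yq yp]]] := backward_reach d0 c1 a1 wd hp k0 kp pz0 q1 qz0
    (_ : 0 < Num.min e e1); first by rewrite lt_min e0.
rewrite lt_min in yp; case/andP: yp => yp1 yp2.
exists y; split => //.
  apply/eqP; rewrite eq_le yD /= leNgt; apply/negP => yU.
  by have := iter_open_disc d0 c1 a1 N yU; rewrite yq hq ltxx.
move=> j j0; apply/negP => /eqP jy.
have [i yE] := iter_return N j0 jy; rewrite yq in yE.
have := he1 y; rewrite -{1}yE mem_orbit_seq// => /(_ isT).
by rewrite leNgt yp2.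
Qed.

Lemma orbits_exist (vals : seq R) : exists (O : seq C) (rate : C -> R),
  [/\ uniq O, on_circle O, z0 \notin O,
   (forall q, q \in O -> B q \in O /\ rate (B q) = rate q) &
   [/\ forall q, q \in O -> exists2 q', q' \in O & B q' = q,
    forall q, q \in O -> exists2 k, (0 < k)%N & iter k B q = q,
    forall q, q \in O -> rate q \in vals &
    forall v, v \in vals -> exists2 q, q \in O & rate q = v]].
Proof.
elim: vals => [|v vals [ O [rate [uO cO z0O fO [pO kO rO vO]]]]].
  by exists [::], (fun=> 0); split.
have [p [k [hp k0 kp]]] := blaschke_periodic (z0 :: O) d2 c1 a1.
rewrite inE negb_or => /andP[pz0 pO'].
have fOn q n : q \in O -> iter n B q \in O.
  by move=> qO; elim: n => //= n IH; have [] := fO _ IH.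
have orbO i : iter i B p \notin O.
  apply/negP => h; have [j jp] := iter_return i k0 kp.
  by move: pO'; rewrite -jp fOn.
set S := orbit_seq B k p; have memS i : iter i B p \in S by exact: mem_orbit_seq.
exists (undup S ++ O), (fun q => if q \in S then v else rate q).
have inU q : (q \in undup S ++ O) = (q \in S) || (q \in O) by rewrite mem_cat mem_undup.
have SO q : q \in O -> (q \in S) = false.
  move=> qO; apply/negP => /orbit_seqP[i qE].
  by move: (orbO i); rewrite -qE qO.
split.
- rewrite cat_uniq undup_uniq uO andbT /=; apply/hasPn => q qO.
  by rewrite mem_undup SO.
- move=> q; rewrite inU => /orP[/orbit_seqP[i ->]|]; last exact: cO.
  exact: iter_circle.
- rewrite inU negb_or z0O andbT; apply/negP => /orbit_seqP[i z0E].
  have [j] := iter_return i k0 kp; rewrite -z0E => pE; move: pz0; rewrite -pE.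
  by rewrite (_ : iter j B z0 = z0) ?eqxx//; elim: j {pE} => //= j ->.
- move=> q; rewrite !inU => /orP[/orbit_seqP[i ->]|qO].
    by rewrite -iterS !memS.
  by have [h1 h2] := fO _ qO; rewrite h1 orbT !SO.
split.
- move=> q; rewrite inU => /orP[/orbit_seqP[i ->]|qO].
    exists (iter (i + k).-1 B p); first by rewrite inU memS.
    by rewrite -iterS prednK ?addn_gt0 ?k0 ?orbT// iterD kp.
  by have [q' h1 h2] := pO _ qO; exists q' => //; rewrite inU h1 orbT.
- move=> q; rewrite inU => /orP[/orbit_seqP[i ->]|]; last exact: kO.
  by exists k => //; rewrite -iterD addnC iterD kp.
- move=> q; rewrite inU inE; case: ifP => [_ _|_ /= /rO->]; first by rewrite eqxx.
  by rewrite orbT.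
- move=> u; rewrite inE => /orP[/eqP->|/vO[q qO qv]].
    by exists p; rewrite ?inU (memS 0%N).
  by exists q; rewrite ?inU ?qO ?orbT// SO.
Qed.

Section Weighted.
Variables (w : C -> C) (L : R) (O : seq C) (rate : C -> R) (p : C) (k : nat).
Hypothesis wA : in_disc_algebra w.
Hypothesis wL : forall z, nm z <= 1 -> nm (w z) <= L.
Hypotheses (hp : nm p = 1) (k0 : (0 < k)%N) (kp : iter k B p = p) (pz0 : p != z0).
Hypothesis wp : forall i, nm (w (iter i B p)) = L.
Hypotheses (cO : on_circle O) (z0O : z0 \notin O).
Hypothesis fO : forall q, q \in O -> B q \in O /\ rate (B q) = rate q.
Hypothesis pO : forall q, q \in O -> exists2 q', q' \in O & B q' = q.
Hypothesis kO : forall q, q \in O -> exists2 k, (0 < k)%N & iter k B q = q.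
Hypothesis wO : forall q, q \in O -> nm (w q) = rate q.
Hypothesis w0 : forall z, nm z <= 1 -> B z \in O -> z \notin O -> w z = 0.
Hypothesis wn0 : 0 < L -> forall z, nm z <= 1 -> w z = 0 -> B z \in O \/ z = z0.

Local Notation T := (fun (f : C -> C) z => w z * f (B z)).
Local Notation cocycle := (cocycle B w).

Let iterBD n z : nm z <= 1 -> nm (iter n B z) <= 1. Proof. exact: iter_disc. Qed.

Let OD q : q \in O -> nm q <= 1. Proof. by move=> /cO->. Qed.

Let iter_O n q : q \in O -> iter n B q \in O.
Proof. by move=> qO; elim: n => //= n IH; have [] := fO IH. Qed.

Let L_ge0 : 0 <= L. Proof. by rewrite -(wp 0) nm_ge0. Qed.

Let cocycle_orbit n i : nm (cocycle n (iter i B p)) = L ^+ n.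
Proof.
rewrite /cocycle nm_prod (eq_bigr (fun=> L)) ?prodr_const ?card_ord// => j _.
by rewrite -iterD wp.
Qed.

Lemma usf_max mu : nm mu = L -> usf_spectrum T mu.
Proof.
move=> muL; apply: (@usf_mem R B w BD BU BA wA Blift mu p hp).
- move=> n y yD _; rewrite muL /cocycle nm_prod -[n in L ^+ n]card_ord -prodr_const.
  by apply: ler_prod => i _; rewrite nm_ge0 wL// iterBD.
- move=> n; exists (iter (n * k - n) B p); rewrite muL cocycle_orbit; split => //.
    by apply: iterBD; rewrite hp.
  by rewrite -iterD subnKC ?leq_pmulr// -(iter_modn _ kp) modnMl.
- exact: nonperiodic_near kp pz0.
Qed.

Let cocycle_O n y q : nm y <= 1 -> iter n B y = q -> q \in O ->
  nm (cocycle n y) = 0 \/ [/\ y \in O, rate y = rate q & nm (cocycle n y) = rate q ^+ n].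
Proof.
elim: n y => [|n IH] y yD /= yq qO.
  by right; rewrite yq cocycle0 nm1.
rewrite -iterS iterSr in yq; rewrite cocycleS nmM.
have [->|[ByO rB ->]] := IH _ (BD yD) yq qO; first by left; rewrite mulr0.
have [yO|yO] := boolP (y \in O); last by left; rewrite w0// nm0 mul0r.
by right; have [_ h] := fO yO; rewrite wO// exprS -rB h.
Qed.

Lemma usf_orbit mu q : q \in O -> nm mu = rate q -> usf_spectrum T mu.
Proof.
move=> qO muq; have [kq kq0 kqq] := kO qO.
have rq n y : y \in O -> rate (iter n B y) = rate y.
  by move=> yO; elim: n => //= n <-; have [_] := fO (iter_O n yO).
have qz0 : q != z0 by apply: contra z0O => /eqP<-.
apply: (@usf_mem R B w BD BU BA wA Blift mu q (cO qO)).
- move=> n y yD yq; rewrite muq.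
  have [->|[_ _ ->]//] := cocycle_O yD yq qO.
  by rewrite exprn_ge0// -wO// nm_ge0.
- move=> n; have [y yO yq] : exists2 y, y \in O & iter n B y = q.
    elim: n q qO {muq kqq qz0} => [|n IH] q qO; first by exists q.
    by have [q' q'O <-] := pO qO; have [y yO <-] := IH _ q'O; exists y.
  exists y; split => //; first exact: OD.
  rewrite muq -yq rq// /cocycle nm_prod (eq_bigr (fun=> rate y)).
    by rewrite prodr_const card_ord.
  by move=> i _; rewrite wO ?iter_O// rq.
- exact: nonperiodic_near (cO qO) kq0 kqq qz0.
Qed.

Lemma usf_bound mu : usf_spectrum T mu ->
  [\/ nm mu = L, nm mu = nm (w z0) | exists2 q, q \in O & nm mu = rate q].
Proof.
move=> /(usf_point BD BU BA wA Blift)[x xD [fwd bwd]].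
have fwd1 : nm mu <= nm (w x) by have := fwd 1%N; rewrite expr1 cocycle1.
have bwd1 y : nm y <= 1 -> B y = x -> nm (w y) <= nm mu.
  by move=> yD yx; have := bwd 1%N y yD yx; rewrite expr1 cocycle1.
have [xO|xO] := boolP (x \in O).
  constructor 3; exists x => //; apply/eqP; rewrite eq_le -{1}wO// fwd1 /=.
  have [y yO yx] := pO xO; have := bwd1 y (OD yO) yx.
  by rewrite wO//; have [_ <-] := fO yO; rewrite yx.
have [xz0|xz0] := eqVneq x z0.
  by constructor 2; apply/eqP; rewrite eq_le -{1}xz0 fwd1 bwd1// xz0.
constructor 1; apply/eqP; rewrite eq_le (le_trans fwd1) ?wL//= leNgt; apply/negP => muL.
have L0 : 0 < L by apply: le_lt_trans muL; exact: nm_ge0.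
have [n1 [e1 [n10 n1p e10 stay]]] := backward_stay d0 c1 a1 wd hp k0 kp pz0.
set m := nm mu in fwd bwd muL *; have m0 : 0 <= m by exact: nm_ge0.
have lt1 : m ^+ n1 < L ^+ n1 by rewrite ltr_pXn2r ?nnegrE// -lt0n.
(* Strictly between |mu|^n1 and L^n1: each turn near [p] multiplies the cocycle by at least [rho],
   in the end too much for [bwd]. *)
pose rho := (L ^+ n1 + m ^+ n1) / 2.
have mn0 : 0 <= m ^+ n1 by rewrite exprn_ge0.
have rho1 : m ^+ n1 < rho by rewrite /rho; move: lt1; lra.
have rho0 : 0 < rho by exact: le_lt_trans rho1.
have gap0 : 0 < L ^+ n1 - rho by rewrite /rho; move: lt1; lra.
have p1 : nm p <= 1 by rewrite hp.
have /contD_RP/(_ _ p1 _ gap0)[e2 e20 he2] := @contD_cocycle R B w BD BU BA wA n1.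
have near z : nm z <= 1 -> nm (z - p) < e2 -> rho <= nm (cocycle n1 z).
  move=> zD zp; have := he2 z zD zp; rewrite (cocycle_orbit n1 0) ltr_norml => /andP[h _].
  by move: h; lra.
have [|n [y [yD yx]]] := backward_reach d0 c1 a1 wd hp k0 kp pz0 xD xz0
    (_ : 0 < Num.min e1 e2); first by rewrite lt_min e10.
rewrite lt_min => /andP[yp1 yp2].
(* A zero of [w] on the path from [y] to [x] would be [z0] or be mapped into [O]; both are
   invariant, so [x] would be [z0] or lie in [O]. *)
have c0 : 0 < nm (cocycle n y).
  rewrite nm_gt0; apply/prodf_neq0 => i _; apply/eqP.
  have xE : iter (n - i) B (iter i B y) = x by rewrite -iterD subnK// ltnW.
  move=> /(wn0 L0 (iterBD i yD))[]h.
    have ni : (n - i = (n - i).-1.+1)%N by rewrite prednK// subn_gt0.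
    by move: xO; rewrite -xE ni iterSr iter_O.
  move: xz0; rewrite -xE h (_ : iter _ B z0 = z0) ?eqxx//.
  by elim: (n - i)%N => //= j ->.
have chain l : exists z, [/\ nm z <= 1, iter (l * n1) B z = y, nm (z - p) < e1,
    nm (z - p) < e2 & rho ^+ l <= nm (cocycle (l * n1) z)].
  elim: l => [|l [z [zD zy z1 z2 zc]]]; first by exists y; rewrite cocycle0 nm1.
  have [u [uD uz up]] := stay z zD z1.
  exists u; split; rewrite ?(le_lt_trans up)//.
    by rewrite mulSn addnC iterD uz.
  rewrite mulSn cocycleD uz nmM exprS ler_pM ?exprn_ge0 ?(ltW rho0)// near//.
  exact: le_lt_trans z2.
have key l : rho ^+ l * nm (cocycle n y) <= (m ^+ n1) ^+ l * m ^+ n.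
  have [z [zD zy _ _ zc]] := chain l.
  have := bwd (l * n1 + n)%N z zD; rewrite addnC iterD zy yx => /(_ erefl).
  have -> : m ^+ (n + l * n1) = (m ^+ n1) ^+ l * m ^+ n.
    by rewrite addnC exprD mulnC exprM.
  rewrite addnC cocycleD zy nmM => h; apply: le_trans h.
  by rewrite ler_wpM2r ?nm_ge0.
have [q0|q0] := eqVneq (m ^+ n1) 0.
  have := key 1%N; rewrite q0 !expr1 mul0r leNgt => /negP; apply.
  by rewrite mulr_gt0.
have qp : 0 < m ^+ n1 by rewrite lt0r q0.
have [|N hN] := @expr_unbounded R (rho / m ^+ n1) (m ^+ n / nm (cocycle n y)).
  by rewrite ltr_pdivlMr// mul1r.
have qN : 0 < (m ^+ n1) ^+ N by apply: exprn_gt0.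
have := hN N (leqnn _); rewrite ltr_pdivrMr// expr_div_n mulrAC ltr_pdivlMr//.
by rewrite [ltLHS]mulrC ltNge key.
Qed.

End Weighted.

End Spectrum.


(** * Realisation of the prescribed circles *)

Section WeightedSpectrum.
Variables (R : realType) (d : nat) (c : (R[i])^o) (a : 'I_d -> (R[i])^o).
Local Notation C := (R[i])^o.
Hypothesis d2 : (2 <= d)%N.
Hypothesis c1 : nm c = 1.
Hypothesis a1 : forall j, nm (a j) < 1.
Local Notation B := (blaschke c a).
Variable z0 : C.
Hypothesis wd : wolff_denjoy_point B z0.

Let d0 : (0 < d)%N. Proof. exact: leq_trans d2. Qed.

(** The case of a single circle: with [O] empty, the alternatives of [usf_bound] all reduce to |mu|
    = |l|. *)
Lemma usf_constant_weight (l mu : C) :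
  usf_spectrum (fun f z => l * f (B z)) mu <-> nm mu = nm l.
Proof.
have [p [k [hp k0 kp]]] := blaschke_periodic [:: z0] d2 c1 a1.
rewrite inE => pz0.
have lA : in_disc_algebra (fun _ : C => l) by exact: disc_algebra_cst.
split => [h|h]; last first.
  by apply: (@usf_max R d c a d2 c1 a1 z0 wd (fun=> l) (nm l) p k lA).
have wl (z : C) : nm z <= 1 -> nm l <= nm l by [].
have wp (i : nat) : nm l = nm l by [].
have noO (P : C -> Prop) q : q \in [::] -> P q by [].
have wn0 : 0 < nm l -> forall z : C, nm z <= 1 -> l = 0 -> B z \in [::] \/ z = z0.
  by move=> + z _ l0; rewrite l0 nm0 ltxx.
by have [//|//|[]//] := usf_bound d2 c1 a1 wd (O := [::]) (rate := fun=> 0) lA wl hp k0 kp pz0 wp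
  (noO _) (noO _) (noO _) (noO _) wn0 h.
Qed.

(** The values |l| and [v0] come from the cycle of [p] and from [z0]; once both belong to [vals],
    the two implications form an equivalence. *)
Lemma usf_prescribed (l : C) (v0 : R) (vals : seq R) :
  (forall v, v \in vals -> 0 <= v <= nm l) -> 0 <= v0 < nm l ->
  exists w : C -> C, in_disc_algebra w /\ forall mu,
    (usf_spectrum (fun f z => w z * f (B z)) mu ->
       [\/ nm mu = nm l, nm mu = v0 | nm mu \in vals]) /\
    (nm mu \in vals -> usf_spectrum (fun f z => w z * f (B z)) mu).
Proof.
move=> hvals /andP[v00 v0l]; set L := nm l in hvals v0l *.
have L0 : 0 < L by exact: le_lt_trans v0l.
have [Orb [rate [uO cO z0O fO [pO kO rO vO]]]] := orbits_exist d2 c1 a1 wd vals.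
have [p [k [hp k0 kp]]] := blaschke_periodic (z0 :: Orb) d2 c1 a1.
rewrite inE negb_or => /andP[pz0 pO'].
have OD q : q \in Orb -> nm q <= 1 by move=> /cO->.
set S := orbit_seq B k p; have memS i : iter i B p \in S by exact: mem_orbit_seq.
have fOn q n : q \in Orb -> iter n B q \in Orb.
  by move=> qO; elim: n => //= n IH; have [] := fO _ IH.
have SO q : q \in S -> q \notin Orb.
  move=> /orbit_seqP[i ->]; apply/negP => h; have [j jp] := iter_return i k0 kp.
  by move: pO'; rewrite -jp fOn.
have SB q : q \in S -> B q \in S by move=> /orbit_seqP[i ->]; rewrite -iterS.
have z0S : z0 \notin S.
  apply/negP => /orbit_seqP[i z0E]; have [j] := iter_return i k0 kp.
  rewrite -z0E => pE; move: pz0; rewrite -pE (_ : iter j B z0 = z0) ?eqxx//.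
  by elim: j {pE} => //= j ->; exact: (wd_fixed c1 a1 wd).
have /choice[r rP] : forall q, exists r : seq C, nm q <= 1 ->
    forall y, (nm y <= 1 /\ B y = q) <-> y \in r.
  move=> q; have [hq|hq] := boolP (nm q <= 1); last by exists [::].
  by have [r hr] := blaschke_fiber_finite d0 c1 a1 hq; exists r.
(* The exits, where backward branches leave the cycles; they are finitely many because fibres are
   finite, so vanishing there can be interpolated. *)
pose E := [seq z <- undup (flatten (map r Orb)) | z \notin Orb].
have memE z : z \in E <-> [/\ nm z <= 1, B z \in Orb & z \notin Orb].
  rewrite mem_filter mem_undup; split.
    move=> /andP[zO /flattenP[s /mapP[q qO ->] /(rP _ (OD _ qO))[zD zq]]].
    by split => //; rewrite zq.
  move=> [zD zB zO]; rewrite zO; apply/flattenP; exists (r (B z)); first exact: map_f.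
  by apply/(rP _ (OD _ zB)).
pose nodes := undup S ++ Orb ++ E.
have inN z : (z \in nodes) = [|| z \in S, z \in Orb | z \in E].
  by rewrite !mem_cat mem_undup.
have cN : on_circle nodes.
  move=> z; rewrite inN => /or3P[/orbit_seqP[i ->]|/cO//|/memE[zD zB _]].
    exact: iter_circle.
  apply/eqP; rewrite eq_le zD /= leNgt; apply/negP => zU.
  by have := blaschke_open_disc d0 c1 a1 zU; rewrite cO// ltxx.
have uN : uniq nodes.
  rewrite cat_uniq undup_uniq cat_uniq uO filter_uniq ?undup_uniq//= !andbT.
  apply/andP; split; apply/hasPn => z; last by move=> /memE[].
  rewrite mem_cat mem_undup => /orP[zO|/memE[_ zB _]]; apply/negP.
    by move=> /SO/negP; apply.
  by move=> /SB/SO/negP; apply.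
have z0N : z0 \notin nodes.
  rewrite inN !negb_or z0S z0O; apply/negP => /memE[_ + _].
  by rewrite (wd_fixed c1 a1 wd) (negbTE z0O).
have sN : (0 < size nodes)%N.
  have : p \in nodes by rewrite inN (memS 0%N).
  by case: (nodes).
pose tau z : R := if z \in S then 1 else if z \in Orb then rate z / L else 0.
have htau z : 0 <= tau z <= 1.
  rewrite /tau; case: ifP => _; first by rewrite ler01 lexx.
  case: ifP => [/rO/hvals/andP[h1 h2]|_]; last by rewrite lexx ler01.
  by rewrite divr_ge0 ?(ltW L0)// ler_pdivrMr// mul1r.
have hk : 0 <= v0 / L < 1 by rewrite divr_ge0 ?(ltW L0)// ltr_pdivrMr// mul1r.
have [W [WA W1 Wt Wz0 Wn0]] := disc_weight cN uN sN htau (wd_disc wd) z0N hk.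
have nmw z : nm (l * W z) = L * nm (W z) by rewrite nmM.
have wA : in_disc_algebra (fun z => l * W z).
  exact: (disc_algebra_mul (disc_algebra_cst l) WA).
have wL z : nm z <= 1 -> nm (l * W z) <= L.
  by move=> zD; rewrite nmw ler_piMr ?W1// ltW.
have wp i : nm (l * W (iter i B p)) = L.
  by rewrite nmw Wt ?inN ?memS// /tau memS mulr1.
have wO q : q \in Orb -> nm (l * W q) = rate q.
  move=> qO; rewrite nmw Wt ?inN ?qO ?orbT// /tau qO ifN; last first.
    by apply/negP => /SO; rewrite qO.
  by rewrite mulrC divfK// gt_eqF.
have w0 z : nm z <= 1 -> B z \in Orb -> z \notin Orb -> l * W z = 0.
  move=> zD zB zO; have zE : z \in E by apply/memE.
  apply/eqP; rewrite -nm_eq0 nmw Wt ?inN ?zE ?orbT// /tau (negbTE zO) ifN ?mulr0//.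
  by apply/negP => /SB/SO; rewrite zB.
have wn0 : 0 < L -> forall z, nm z <= 1 -> l * W z = 0 -> B z \in Orb \/ z = z0.
  move=> _ z zD /eqP; rewrite mulf_eq0 -[l == 0]nm_eq0 (gt_eqF L0) /=.
  move=> /eqP/(Wn0 _ zD)[[zN tz]|]; last by right.
  (* A node with [tau] zero is an exit or lies on a cycle of rate 0, as happens for lambda_1 = 0; in
     both cases its image is in [Orb]. *)
  left; move: zN tz; rewrite inN /tau; case: ifP => /= [_ _ /eqP|_].
    by rewrite oner_eq0.
  by move=> /orP[zO _|/memE[]//]; have [] := fO _ zO.
exists (fun z => l * W z); split => // mu; split => [h|/vO[q qO qv]].
  have [e|e|[q qO e]] := usf_bound d2 c1 a1 wd wA wL hp k0 kp pz0 wp cO fO pO wO wn0 h.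
  - by constructor 1.
  - by constructor 2; rewrite e nmw Wz0 mulrC divfK// gt_eqF.
  - by constructor 3; rewrite e rO.
exact: (usf_orbit d2 c1 a1 wd wA cO z0O fO pO kO wO w0 qO (esym qv)).
Qed.

End WeightedSpectrum.

Theorem theorem8 (R : realType) (d : nat) (c : (R[i])^o) (a : 'I_d -> (R[i])^o)
    (m : nat) (lam : 'I_m -> (R[i])^o) :
  (2 <= d)%N ->
  `|c| = 1 ->
  (forall j, `|a j| < 1) ->
  elliptic (blaschke c a) \/ doubly_parabolic (blaschke c a) ->
  (0 < m)%N ->
  (forall i j : 'I_m, (i < j)%N -> `|lam i| < `|lam j|) ->
  exists w : (R[i])^o -> (R[i])^o,
    in_disc_algebra w /\
    forall mu : (R[i])^o,
      usf_spectrum (fun f z => w z * f (blaschke c a z)) mu <->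
      exists j : 'I_m, `|mu| = `|lam j|.
Proof.
move=> d2 hc ha hB m0 hlam.
have c1 : nm c = 1 by move: hc; rewrite normCE => -[].
have a1 j : nm (a j) < 1 by rewrite -normC_lt1.
have lt_lam (i j : 'I_m) : (i < j)%N -> nm (lam i) < nm (lam j).
  by move=> /hlam; rewrite !normCE ltcR.
have [z0 wd] : exists z0, wolff_denjoy_point (blaschke c a) z0.
  by case: hB => [[z0 [wd _]]|[z0 [wd _]]]; exists z0.
have mm : (m.-1 < m)%N by rewrite prednK.
pose jm := Ordinal mm; pose j1 := Ordinal m0.
have le_lam j : nm (lam j) <= nm (lam jm).
  have : (j <= jm)%N by rewrite /= -ltnS prednK.
  by rewrite leq_eqVlt => /orP[/eqP/val_inj->//|/lt_lam/ltW].
(* [usf_prescribed] asks for |lambda_1| < |lambda_m|, so a single circle is realised by a constant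
   weight. *)
have [m1|m1] := eqVneq (m.-1) 0%N.
  exists (fun=> lam jm); split; first exact: disc_algebra_cst.
  move=> mu; apply: (iff_trans (usf_constant_weight d2 c1 a1 wd (lam jm) mu)).
  split => [h|[j /normC_eq ->]]; first by exists jm; apply/normC_eq.
  congr (nm (lam _)); apply/val_inj => /=; rewrite m1.
  by have := ltn_ord j; rewrite -[X in (_ < X)%N](prednK m0) m1 ltnS leqn0 => /eqP.
have v0 : 0 <= nm (lam j1) < nm (lam jm) by rewrite nm_ge0 lt_lam//= lt0n.
pose vals := [seq nm (lam j) | j <- enum 'I_m].
have valsP v : v \in vals <-> exists j, v = nm (lam j).
  split=> [/mapP[j _ ->]|[j ->]]; first by exists j.
  by apply: map_f; rewrite mem_enum.
have hv v : v \in vals -> 0 <= v <= nm (lam jm).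
  by move=> /valsP[j ->]; rewrite nm_ge0 le_lam.
have [w [wA hw]] := usf_prescribed d2 c1 a1 wd hv v0.
exists w; split => // mu; have [h1 h2] := hw mu; split.
  move=> /h1[h|h|/valsP[j h]]; [exists jm|exists j1|exists j]; exact/normC_eq.
by move=> [j /normC_eq h]; apply/h2/valsP; exists j.
Qed.
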